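(* Let $t \in \mathbb{N}$ be fixed. There is an algorithm that, given any 3-colorable graph $G$ that contains no induced subgraph isomorphic to $P_t$, computes either (a) a proper coloring of $G$ with at most $\max\{5,\,2\lceil\frac{t-1}{2}\rceil-2\}$ colors, together with a triangle of $G$, or (b) a proper coloring of $G$ with at most $\max\{4,\,\lceil\frac{t-1}{2}\rceil+1\}$ colors, and the algorithm runs in time $O\big((3^{t-2}+t^2)|E(G)|+|V(G)|\big)$.
   Context: $P_t$ denotes the chordless (induced) path on $t$ vertices. A graph is $P_t$-free if it has no induced subgraph isomorphic to $P_t$. A $k$-coloring (proper coloring with at most $k$ colors) of $G$ is a map $c:V(G)\to\{1,\dots,k\}$ with $c(u)\neq c(v)$ for every edge $uv$. A triangle is a set of three pairwise adjacent vertices. *)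

(* Defs.v *)
From mathcomp Require Import all_boot.

Set Implicit Arguments.
Unset Strict Implicit.
Unset Printing Implicit Defensive.

(** * Graphs

    A finite simple graph is a symmetric irreflexive relation [e] on a finite
    type; both properties are hypotheses wherever a graph is quantified over. *)

Definition edges (T : finType) (e : rel T) : {set {set T}} :=
  [set [set x; y] | x in T, y in T & e x y].

(* [t] is the number of vertices of the path, not its length. *)
Definition path_graph (t : nat) : rel 'I_t :=
  fun i j => (i.+1 == j :> nat) || (j.+1 == i :> nat).

Definition induced_subgraph (S T : finType) (h : rel S) (e : rel T) : Prop :=
  exists f : S -> T, injective f /\ forall x y, e (f x) (f y) = h x y.

Definition path_free (t : nat) (T : finType) (e : rel T) : Prop :=
  ~ induced_subgraph (@path_graph t) e.

(* Colors are [1, ..., k].  The codomain is [nat] rather than ['I_k] because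
   colorings are also read off from memory cells of the machine below. *)
Definition proper_coloring (k : nat) (T : finType) (e : rel T) (c : T -> nat) :
    Prop :=
  (forall v, 1 <= c v <= k) /\ (forall u v, e u v -> c u <> c v).

Definition colorable (k : nat) (T : finType) (e : rel T) : Prop :=
  exists c : T -> nat, proper_coloring k e c.

Definition triangle (T : finType) (e : rel T) (x y z : T) : Prop :=
  [/\ e x y, e y z & e x z].

(** * Machine model

    A random access machine with unit cost, programmed in a structured
    language.  Its storage consists of registers and of arrays with indirect
    addressing; a program mentions only finitely many of them.  The only
    arithmetic is increment and (truncated) decrement, so in [k] steps no cell
    can exceed by more than [k] the largest number occurring in the input and
    the program: the unit cost hides no computation on long numbers. *)

Record state := State {
  reg : nat -> nat;
  arr : nat -> nat -> nat   (* [arr s a i] is the cell [i] of the array [a] *)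
}.

Definition upd (V : Type) (f : nat -> V) (i : nat) (v : V) : nat -> V :=
  fun j => if j == i then v else f j.

Definition set_reg (s : state) (x v : nat) : state :=
  State (upd (reg s) x v) (arr s).

Definition set_arr (s : state) (a i v : nat) : state :=
  State (reg s) (upd (arr s) a (upd (arr s a) i v)).

Inductive aexp : Type :=
| Const of nat
| Reg of nat
| Read of nat & aexp
| Incr of aexp
| Decr of aexp.

Inductive bexp : Type :=
| Eq of aexp & aexp
| Lt of aexp & aexp
| Not of bexp
| And of bexp & bexp.

Inductive cmd : Type :=
| Skip
| Assign of nat & aexp
| Write of nat & aexp & aexp
| Seq of cmd & cmd
| If of bexp & cmd & cmd
| While of bexp & cmd.

Fixpoint aeval (s : state) (a : aexp) : nat :=
  match a with
  | Const n => n
  | Reg x => reg s x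
  | Read b i => arr s b (aeval s i)
  | Incr a' => (aeval s a').+1
  | Decr a' => (aeval s a').-1
  end.

Fixpoint beval (s : state) (b : bexp) : bool :=
  match b with
  | Eq a1 a2 => aeval s a1 == aeval s a2
  | Lt a1 a2 => aeval s a1 < aeval s a2
  | Not b' => ~~ beval s b'
  | And b1 b2 => beval s b1 && beval s b2
  end.

Fixpoint acost (a : aexp) : nat :=
  match a with
  | Const _ | Reg _ => 1
  | Read _ a' | Incr a' | Decr a' => (acost a').+1
  end.

Fixpoint bcost (b : bexp) : nat :=
  match b with
  | Eq a1 a2 | Lt a1 a2 => (acost a1 + acost a2).+1
  | Not b' => (bcost b').+1
  | And b1 b2 => (bcost b1 + bcost b2).+1
  end.

(* [exec c s k s']: started in [s], the command [c] halts in [s'] after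
   exactly [k] steps. *)
Inductive exec : cmd -> state -> nat -> state -> Prop :=
| ExecSkip s : exec Skip s 1 s
| ExecAssign s x a :
    exec (Assign x a) s (acost a).+1 (set_reg s x (aeval s a))
| ExecWrite s b i a :
    exec (Write b i a) s (acost i + acost a).+1
      (set_arr s b (aeval s i) (aeval s a))
| ExecSeq c1 c2 s k1 s1 k2 s2 :
    exec c1 s k1 s1 -> exec c2 s1 k2 s2 -> exec (Seq c1 c2) s (k1 + k2) s2
| ExecIfTrue b c1 c2 s k s' :
    beval s b -> exec c1 s k s' -> exec (If b c1 c2) s (bcost b + k).+1 s'
| ExecIfFalse b c1 c2 s k s' :
    ~~ beval s b -> exec c2 s k s' -> exec (If b c1 c2) s (bcost b + k).+1 s'
| ExecWhileTrue b c s k1 s1 k2 s2 :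
    beval s b -> exec c s k1 s1 -> exec (While b c) s1 k2 s2 ->
    exec (While b c) s (bcost b + k1 + k2).+1 s2
| ExecWhileFalse b c s :
    ~~ beval s b -> exec (While b c) s (bcost b).+1 s.

(** * Input and output

    A graph on the vertices [0, ..., n-1] is given by adjacency lists, each in
    an arbitrary order. *)

Definition adjacency_lists (n : nat) (e : rel 'I_n) (adj : 'I_n -> seq 'I_n) :
    Prop :=
  forall u, uniq (adj u) /\ forall v, (v \in adj u) = e u v.

(* Register 0 holds [n].  The lists are stored consecutively in array 1, and
   the list of [v] occupies its cells [i] with [off v <= i < off v.+1], where
   [off] is array 0 (of length [n.+1]).  All other cells are initially zero. *)
Definition input (n : nat) (adj : 'I_n -> seq 'I_n) : state :=
  let lists := [seq adj u | u <- enum 'I_n] in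
  State
    (fun x => if x == 0 then n else 0)
    (fun a i =>
       if a == 0 then (if i <= n then sumn (take i (shape lists)) else 0)
       else if a == 1 then nth 0 [seq val v | v <- flatten lists] i
       else 0).

(* Register 0 announces which of the two kinds of result was computed; the
   coloring is stored in array 0, and the triangle in registers 1 to 3. *)
Definition output_kind (s : state) : nat := reg s 0.

Definition output_coloring (n : nat) (s : state) : 'I_n -> nat :=
  fun v => arr s 0 v.

Definition output_triangle (n : nat) (e : rel 'I_n) (s : state) : Prop :=
  exists x y z : 'I_n,
    [/\ reg s 1 = x, reg s 2 = y, reg s 3 = z & triangle e x y z].

(* Main.v *)
Require Import Defs.
From mathcomp Require Import all_boot zify.

Set Implicit Arguments.
Unset Strict Implicit.
Unset Printing Implicit Defensive.



(** Let [h] be the maximum of 3 and the ceiling of (t-1)/2. Then t <= 2h+1, so every induced path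
    has at most 2h vertices ([ipath_short]). Each component with an edge is treated separately. Its
    vertices are split into a part dominated by a set [S] of at most h+5 vertices and a part
    arranged in levels 2, ..., h-1; the vertices put into a level by one step are the neighbors of
    one parent from the level before. The dominated part gets the colors 1, 2, 3: all colorings of
    [S] are tried, and fixing one leaves two colors for each other dominated vertex. The
    neighborhood of a parent is bipartite, so a level needs only two colors, and one if it has no
    inner edge. All lists thus have size at most two, and a list coloring is found by propagation if
    there is one. The 3-coloring of the graph is never computed; it only shows that one of the
    guesses admits a list coloring.

    Levels. [S] grows in rounds. Let [U] be the set of vertices still to be treated and [K] the
    vertices picked in the round before. The vertices of [U] with a neighbor in [K] form level 1 and
    end up dominated. In each component of the rest an attacher of level 1 is chosen, and its
    neighbors there become level 2; in each component of what remains an attacher of level 2 is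
    chosen, and so on up to level h-1. A component that is used up is settled. One that is not
    fails, and then the successive attachers trace an induced path on [h] vertices that starts in
    level 1 and continues inside the component ([chain_step], [chain_fail]). Among the failing
    components one with the fewest attachers is selected and its attacher joins [S]. The vertices of
    level 1 that see this component are barred for the rest of the round, and the components that
    the picked vertex sees wait for the next round. By the choice of the component every other one
    keeps an attacher ([progress_pick]), so the process can go on.

    Number of rounds. Two failing paths joined through a common neighbor of their first vertices
    would form an induced path on 2h+1 vertices unless these are adjacent; so picks with a common
    neighbor in [K] are adjacent ([picks_adj]), and three of them would give a K4. While each round
    picks one vertex, the picks form an induced path that a failing path prolongs, which bounds its
    length ([path_phase_le]). A round with two picks is followed by one with at most one pick, which
    sees both, and then by one with none ([pair_next], [long_next]). Hence h+3 rounds and h+5 picks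
    suffice ([phase_end], [phase_size]).

    Colors. If no level has an inner edge, 3 + (h-2) = h+1 colors are enough. An inner edge forms a
    triangle with the common parent of its ends. Two colors for each level would then amount to
    2h-1; one is saved in the last level. Its attacher is chosen with fewest neighbors in the
    component, and it sees the whole component because that component is used up; so every attacher
    sees the whole component ([last_ok_peel]). If the component contains an edge, its attachers
    therefore agree in the 3-coloring. They also have the same parent, so they use only one of the
    two colors of level h-2. The other one is free for the odd side of the component, and the even
    side takes color 4 ([guided_proper_le]). For h = 3 there is no such level, which is why five
    colors appear.

    Time. A sweep over a component costs its volume, the sum of deg + 1. There are h+3 rounds of
    three passes over h-2 levels, and 3^(h+5) guesses. Each guess is decided in linear time because
    the two propagations from a vertex run in lockstep, and the one that ends first pays for
    both. *)

Fixpoint modr (c : cmd) : seq nat :=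
  match c with
  | Assign x _ => [:: x]
  | Seq c1 c2 | If _ c1 c2 => modr c1 ++ modr c2
  | While _ c' => modr c'
  | _ => [::]
  end.

Fixpoint moda (c : cmd) : seq nat :=
  match c with
  | Write a _ _ => [:: a]
  | Seq c1 c2 | If _ c1 c2 => moda c1 ++ moda c2
  | While _ c' => moda c'
  | _ => [::]
  end.

(** The frame condition. With the syntactic [modr] and [moda] it holds for every execution
    ([exec_same]), so invariants mention only what a loop really changes. *)
Definition same (rs bs : seq nat) (s s' : state) : Prop :=
  (forall r, r \notin rs -> reg s' r = reg s r) /\
  (forall a, a \notin bs -> arr s' a = arr s a).

Lemma same_refl rs bs s : same rs bs s s.
Proof. by []. Qed.

Lemma same_trans rs bs s1 s2 s3 :
  same rs bs s1 s2 -> same rs bs s2 s3 -> same rs bs s1 s3.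
Proof.
move=> [r1 a1] [r2 a2]; split=> x Hx; first by rewrite r2 ?r1.
by rewrite a2 ?a1.
Qed.

Lemma same_sub rs bs rs' bs' s s' :
  {subset rs <= rs'} -> {subset bs <= bs'} -> same rs bs s s' ->
  same rs' bs' s s'.
Proof.
move=> Hr Hb [r a]; split=> x Hx; first by apply: r; apply: contra Hx => /Hr.
by apply: a; apply: contra Hx => /Hb.
Qed.

Lemma exec_same c s k s' : exec c s k s' -> same (modr c) (moda c) s s'.
Proof.
elim=> {c s k s'} //=.
- move=> s x a; split=> // r; rewrite inE => /negbTE Hr.
  by rewrite /= /upd Hr.
- move=> s b i a; split=> // r; rewrite inE => /negbTE Hr.
  by rewrite /= /upd Hr.
- move=> c1 c2 s k1 s1 k2 s2 _ S1 _ S2.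
  apply: (@same_trans _ _ _ s1); first apply: same_sub S1.
  + by move=> z Hz; rewrite mem_cat Hz.
  + by move=> z Hz; rewrite mem_cat Hz.
  apply: same_sub S2 => z Hz; by rewrite mem_cat Hz orbT.
- by move=> b c1 c2 s k s' _ _ S; apply: same_sub S => z Hz; rewrite mem_cat Hz.
- move=> b c1 c2 s k s' _ _ S; apply: same_sub S => z Hz;
  by rewrite mem_cat Hz orbT.
- by move=> b c s k1 s1 k2 s2 _ _ S1 _ S2; apply: same_trans S1 S2.
Qed.

(** * Program logic for total correctness with step counts *)

Definition wp (c : cmd) (s : state) (Q : state -> nat -> Prop) : Prop :=
  exists k s', exec c s k s' /\ Q s' k.

Definition wpb (c : cmd) (s : state) (b : nat) (P : state -> Prop) : Prop :=
  wp c s (fun s' k => k <= b /\ P s').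

Lemma wp_cons c s (Q Q' : state -> nat -> Prop) :
  wp c s Q ->
  (forall s' k, same (modr c) (moda c) s s' -> Q s' k -> Q' s' k) -> wp c s Q'.
Proof.
move=> [k [s' [E H]]] HQ; exists k, s'; split=> //.
by apply: HQ H; apply: exec_same E.
Qed.

Lemma wpb_cons c s b b' (P P' : state -> Prop) :
  wpb c s b P -> b <= b' ->
  (forall s', same (modr c) (moda c) s s' -> P s' -> P' s') -> wpb c s b' P'.
Proof.
move=> H Hb HP; apply: (wp_cons H) => s' k S [Hk /(HP _ S) H']; split=> //.
exact: leq_trans Hb.
Qed.

Lemma wp_seq c1 c2 s (Q1 Q : state -> nat -> Prop) :
  wp c1 s Q1 ->
  (forall s1 k1, same (modr c1) (moda c1) s s1 -> Q1 s1 k1 ->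
     wp c2 s1 (fun s' k => Q s' (k1 + k))) ->
  wp (Seq c1 c2) s Q.
Proof.
move=> [k1 [s1 [E1 H1]]] H.
case: (H s1 k1 (exec_same E1) H1) => k2 [s2 [E2 H2]].
by exists (k1 + k2), s2; split=> //; apply: ExecSeq E1 E2.
Qed.

Lemma wpb_seq c1 c2 s b1 b2 b (P1 P : state -> Prop) :
  wpb c1 s b1 P1 ->
  (forall s1, same (modr c1) (moda c1) s s1 -> P1 s1 -> wpb c2 s1 b2 P) ->
  b1 + b2 <= b -> wpb (Seq c1 c2) s b P.
Proof.
move=> H1 H2 Hb; apply: (wp_seq H1) => s1 k1 S [Hk1 /(H2 _ S) H].
apply: (wp_cons H) => s' k _ [Hk Hs]; split=> //; lia.
Qed.

Lemma wpb_if b c1 c2 s m m' (P : state -> Prop) :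
  (beval s b -> wpb c1 s m P) -> (~~ beval s b -> wpb c2 s m P) ->
  bcost b + m + 1 <= m' -> wpb (If b c1 c2) s m' P.
Proof.
move=> H1 H2 Hm; case Hb: (beval s b).
  have [k [s' [E [Hk Hs]]]] := H1 Hb.
  by exists (bcost b + k).+1, s'; split; [apply: ExecIfTrue|split=> //; lia].
have [k [s' [E [Hk Hs]]]] := H2 (negbT Hb).
exists (bcost b + k).+1, s'; split; last by split=> //; lia.
by apply: ExecIfFalse => //; rewrite Hb.
Qed.

Lemma wp_if b c1 c2 s (Q : state -> nat -> Prop) :
  (beval s b -> wp c1 s (fun s' k => Q s' (bcost b + k).+1)) ->
  (~~ beval s b -> wp c2 s (fun s' k => Q s' (bcost b + k).+1)) ->
  wp (If b c1 c2) s Q.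
Proof.
move=> H1 H2; case Hb: (beval s b).
  have [k [s' [E H]]] := H1 Hb.
  by exists (bcost b + k).+1, s'; split=> //; apply: ExecIfTrue.
have [k [s' [E H]]] := H2 (negbT Hb).
exists (bcost b + k).+1, s'; split=> //.
by apply: ExecIfFalse => //; rewrite Hb.
Qed.

(** No separate variant is needed for termination: the invariant carries the number [u] of steps
    spent, each iteration spends at least one, and [bound] caps them. The induction is on
    [bound - u]. *)
Lemma wp_while (Inv : state -> nat -> Prop) bound b c s0
    (Q : state -> nat -> Prop) :
  (forall s u, same (modr c) (moda c) s0 s -> Inv s u -> u <= bound) ->
  (forall s u, same (modr c) (moda c) s0 s -> Inv s u -> beval s b ->
     wp c s (fun s' k => Inv s' (u + k + bcost b + 1))) ->
  (forall s u, same (modr c) (moda c) s0 s -> Inv s u -> ~~ beval s b ->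
     Q s (u + bcost b + 1)) ->
  Inv s0 0 -> wp (While b c) s0 Q.
Proof.
move=> Hbd Hstep Hexit H0.
suff: forall d s u, bound - u < d -> same (modr c) (moda c) s0 s -> Inv s u ->
    wp (While b c) s (fun s' k => Q s' (u + k)).
  move=> /(_ _ s0 0 (ltnSn _)) /(_ (same_refl _ _ _) H0) W.
  by apply: (wp_cons W).
elim=> // d IH s u Hd Ss Hs; case Hb: (beval s b).
  have [k [s1 [E1 H1]]] := Hstep s u Ss Hs Hb.
  have S1 := same_trans Ss (exec_same E1).
  have Bu := Hbd _ _ S1 H1.
  have [|k2 [s2 [E2 H2]]] := IH s1 _ _ S1 H1; first by lia.
  exists (bcost b + k + k2).+1, s2; split.
    exact: (ExecWhileTrue Hb E1 E2).
  by rewrite (_ : u + _ = u + k + bcost b + 1 + k2) //; lia.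
exists (bcost b).+1, s; split; first by apply: ExecWhileFalse; rewrite Hb.
by rewrite addnS -addn1; apply: Hexit => //; rewrite Hb.
Qed.

(** * Loop-free code *)

Fixpoint loop_free (c : cmd) : bool :=
  match c with
  | Seq c1 c2 | If _ c1 c2 => loop_free c1 && loop_free c2
  | While _ _ => false
  | _ => true
  end.

Fixpoint den (c : cmd) (s : state) : state :=
  match c with
  | Assign x a => set_reg s x (aeval s a)
  | Write b i a => set_arr s b (aeval s i) (aeval s a)
  | Seq c1 c2 => den c2 (den c1 s)
  | If b c1 c2 => if beval s b then den c1 s else den c2 s
  | _ => s
  end.

Fixpoint maxcost (c : cmd) : nat :=
  match c with
  | Skip => 1
  | Assign _ a => (acost a).+1
  | Write _ i a => (acost i + acost a).+1
  | Seq c1 c2 => maxcost c1 + maxcost c2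
  | If b c1 c2 => (bcost b + maxn (maxcost c1) (maxcost c2)).+1
  | While _ _ => 0
  end.

(** Loop-free code is verified by computing its effect [den]; of its running time only the worst
    branch is kept. *)
Lemma wpb_den c s b (P : state -> Prop) :
  loop_free c -> maxcost c <= b -> P (den c s) -> wpb c s b P.
Proof.
move=> lf Hb HP.
suff [k [E Hk]]: exists k, exec c s k (den c s) /\ k <= maxcost c.
  by exists k, (den c s); split=> //; split=> //; apply: leq_trans Hb.
elim: c s lf {b P Hb HP} => /=.
- by move=> s _; exists 1; split=> //; constructor.
- by move=> x a s _; eexists; split; [constructor|].
- by move=> x i a s _; eexists; split; [constructor|].
- move=> c1 IH1 c2 IH2 s /andP[/IH1 H1 /IH2 H2].
  have [k1 [E1 L1]] := H1 s; have [k2 [E2 L2]] := H2 (den c1 s).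
  by exists (k1 + k2); split; [apply: ExecSeq E1 E2|lia].
- move=> b c1 IH1 c2 IH2 s /andP[/IH1 H1 /IH2 H2]; case Hb: (beval s b).
    have [k1 [E1 L1]] := H1 s; eexists; split; first by apply: ExecIfTrue E1.
    lia.
  have [k1 [E1 L1]] := H2 s; exists (bcost b + k1).+1; split; last by lia.
  by apply: ExecIfFalse => //; rewrite Hb.
- by [].
Qed.

Lemma wp_den c s (Q : state -> nat -> Prop) :
  loop_free c -> (forall k, k <= maxcost c -> Q (den c s) k) -> wp c s Q.
Proof.
move=> lf H; case: (@wpb_den c s (maxcost c) (fun s' => s' = den c s)) => // k.
by move=> [s' [E [Hk Es]]]; exists k, s'; split=> //; rewrite Es; apply: H.
Qed.

(** * Iteration over lists and over neighborhoods *)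

Section Iteration.

Variables (n : nat) (nb : nat -> seq nat).

Definition repr_graph (s : state) : Prop :=
  [/\ forall x, x < n -> arr s 0 x.+1 = arr s 0 x + size (nb x)
    & forall x i, x < n -> i < size (nb x) ->
        arr s 1 (arr s 0 x + i) = nth 0 (nb x) i].

Lemma repr_graph_eq s s' :
  arr s' 0 = arr s 0 -> arr s' 1 = arr s 1 -> repr_graph s -> repr_graph s'.
Proof. by move=> E0 E1; rewrite /repr_graph E0 E1. Qed.

Lemma repr_graph_same rs bs s s' :
  0 \notin bs -> 1 \notin bs -> same rs bs s s' -> repr_graph s -> repr_graph s'.
Proof. by move=> H0 H1 [_ S]; apply: repr_graph_eq; apply: S. Qed.

Definition repr_list (q len : nat) (s : state) (l : seq nat) : Prop :=
  reg s len = size l /\ forall i, i < size l -> arr s q i = nth 0 l i.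

Definition for_list (q i len x : nat) (body : cmd) : cmd :=
  Seq (Assign i (Const 0))
    (While (Lt (Reg i) (Reg len))
       (Seq (Assign x (Read q (Reg i))) (Seq (Assign i (Incr (Reg i))) body))).

Definition for_nbr (x p y : nat) (body : cmd) : cmd :=
  Seq (Assign p (Read 0 (Reg x)))
    (While (Lt (Reg p) (Read 0 (Incr (Reg x))))
       (Seq (Assign y (Read 1 (Reg p))) (Seq (Assign p (Incr (Reg p))) body))).

Lemma set_regE s x v y : reg (set_reg s x v) y = if y == x then v else reg s y.
Proof. by []. Qed.

(** The 10 extra steps of an iteration are 4 for the test and 3 for each of the two assignments; the
    final 6 are 2 for the initialization and 4 for the failing test. The index has already advanced
    when the body runs, hence the arbitrary [k] in register [i]. *)
Lemma wp_for_list (I : seq nat -> state -> nat -> Prop) bound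
    q i len x body s l (Q : state -> nat -> Prop) :
  repr_list q len s l -> i \notin modr body -> len \notin modr body ->
  q \notin moda body -> i != len -> x != i -> x != len ->
  (forall pre s1 u, I pre s1 u -> u <= bound) ->
  (forall k, I [::] (set_reg s i k) 0) ->
  (forall pre z post s1 u k, l = pre ++ z :: post ->
     same (modr (for_list q i len x body)) (moda body) s s1 ->
     I pre s1 u -> wp body (set_reg (set_reg s1 x z) i k)
       (fun s' k' => I (rcons pre z) s' (u + k' + 10))) ->
  (forall s1 u, same (modr (for_list q i len x body)) (moda body) s s1 ->
     I l s1 u -> Q s1 (u + 6)) ->
  wp (for_list q i len x body) s Q.
Proof.
move=> [Hlen Hq] Ni Nlen Nq Hil Hxi Hxl Ib I0 Istep IQ.
have mE : modr (for_list q i len x body) = i :: x :: i :: modr body by [].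
apply: (@wp_seq _ _ s (fun s1 k => s1 = set_reg s i 0 /\ k = 2)).
  by exists 2; eexists; split; first exact: ExecAssign.
move=> s1 _ S1 [-> ->].
pose J (s2 : state) u := exists pre post, [/\ l = pre ++ post,
   reg s2 i = size pre, I pre s2 u & same (i :: x :: i :: modr body) (moda body) s s2].
have lenJ s2 : same (i :: x :: i :: modr body) (moda body) s s2 ->
    reg s2 len = size l /\ arr s2 q = arr s q.
  case=> R A; split; last exact: A.
  by rewrite R // !inE !negb_or ![len == _]eq_sym Hil Hxl.
apply: (@wp_while J bound).
- by move=> s2 u _ [pre [post [_ _ /Ib]]].
- move=> s2 u _ [pre [post [El Hi HI S2]]] /=.
  have [Hl2 Hq2] := lenJ _ S2; rewrite Hi Hl2 El size_cat.
  case: post El => [|z post] El; first by rewrite addn0 ltnn.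
  move=> _.
  have Ez : arr s2 q (reg s2 i) = z.
    rewrite Hq2 Hi Hq ?El ?nth_cat ?ltnn ?subnn // size_cat /=; lia.
  rewrite -Ez in El *.
  apply: (@wp_seq _ _ _ (fun s3 k => s3 = set_reg s2 x (arr s2 q (reg s2 i)) /\ k = 3)).
    by exists 3; eexists; split; first exact: ExecAssign.
  move=> s3 k3 _ [-> ->].
  apply: (@wp_seq _ _ _ (fun s4 k => s4 = set_reg (set_reg s2 x (arr s2 q (reg s2 i))) i
     (reg s2 i).+1 /\ k = 3)).
    exists 3; eexists; split; first exact: ExecAssign.
    by split=> //=; rewrite /upd eq_sym (negbTE Hxi).
  move=> s4 k4 _ [-> ->].
  apply: (wp_cons (Istep _ _ _ s2 u (reg s2 i).+1 El S2 HI)).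
  move=> s5 k5 S5 HI5.
  exists (rcons pre (arr s2 q (reg s2 i))), post; split.
  + by rewrite cat_rcons.
  + by case: S5 => R _; rewrite R //= /upd eqxx size_rcons Hi.
  + by rewrite (_ : u + _ + _ + 1 = u + k5 + 10); last lia.
  + apply: same_trans S2 _; apply: (@same_trans _ _ _ (set_reg (set_reg s2 x
      (arr s2 q (reg s2 i))) i (reg s2 i).+1)).
      split=> // r; rewrite !inE !negb_or => /and3P[H1 H2 _] /=.
      by rewrite /upd (negbTE H1) (negbTE H2).
    apply: same_sub S5 => r Hr //; by rewrite !inE Hr !orbT.
- move=> s2 u _ [pre [post [El Hi HI S2]]] /=.
  have [Hl2 Hq2] := lenJ _ S2; rewrite Hi Hl2 El size_cat.
  case: post El => [|z post] El; last by rewrite /= addnS ltnS leq_addr.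
  move=> _; rewrite cats0 in El; subst pre.
  by rewrite (_ : 2 + _ = u + 6); [apply: IQ|lia].
- exists [::], l; split=> //=; rewrite ?eqxx /upd ?eqxx ?big_nil //.
  by split=> // r; rewrite !inE !negb_or => /and3P[/negbTE H1 _ _]; rewrite /= /upd H1.
Qed.

Lemma wpb_for_list (I : seq nat -> state -> Prop) (cb : nat -> nat)
    q i len x body s l b (P : state -> Prop) :
  repr_list q len s l -> i \notin modr body -> len \notin modr body ->
  q \notin moda body -> i != len -> x != i -> x != len ->
  (forall k, I [::] (set_reg s i k)) ->
  (forall pre z post s1 k, l = pre ++ z :: post ->
     same (modr (for_list q i len x body)) (moda body) s s1 ->
     I pre s1 -> wpb body (set_reg (set_reg s1 x z) i k) (cb z) (I (rcons pre z))) ->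
  (forall s1, same (modr (for_list q i len x body)) (moda body) s s1 -> I l s1 -> P s1) ->
  \sum_(z <- l) (cb z + 10) + 6 <= b ->
  wpb (for_list q i len x body) s b P.
Proof.
move=> Hq Ni Nlen Nq Hil Hxi Hxl I0 Istep IP Hb.
pose J pre s1 u := [/\ I pre s1, u <= \sum_(z <- pre) (cb z + 10)
   & \sum_(z <- pre) (cb z + 10) <= \sum_(z <- l) (cb z + 10)].
apply: (@wp_for_list J (\sum_(z <- l) (cb z + 10)) _ _ _ _ _ _ l) => //.
- by move=> pre s1 u [_]; apply: leq_trans.
- by move=> k; split; rewrite ?big_nil.
- move=> pre z post s1 u k El S [HI Hu _].
  apply: (wp_cons (Istep _ _ _ _ k El S HI)) => s2 k2 _ [Hk2 HI2]; split=> //.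
    by rewrite -cats1 big_cat big_seq1 /=; move: Hu; set B := \sum_(z <- pre) _; lia.
  by rewrite El -cat_rcons [leqRHS]big_cat leq_addr.
- by move=> s1 u S [HI Hu _]; split; [lia|exact: IP].
Qed.

(** The end of the adjacency list is read again at every test, so the body must leave arrays 0 and 1
    and register [x] alone; this test is the reason for 12 instead of 10. *)
Lemma wpb_for_nbr (I : seq nat -> state -> Prop) cb
    x p y body s v b (P : state -> Prop) :
  repr_graph s -> reg s x = v -> v < n ->
  p \notin modr body -> x \notin modr body ->
  0 \notin moda body -> 1 \notin moda body -> x != p -> y != p -> x != y ->
  (forall k, I [::] (set_reg s p k)) ->
  (forall pre z post s1 k, nb v = pre ++ z :: post ->
     same (modr (for_nbr x p y body)) (moda body) s s1 ->
     I pre s1 -> wpb body (set_reg (set_reg s1 y z) p k) cb (I (rcons pre z))) ->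
  (forall s1, same (modr (for_nbr x p y body)) (moda body) s s1 -> I (nb v) s1 -> P s1) ->
  (cb + 12) * size (nb v) + 9 <= b ->
  wpb (for_nbr x p y body) s b P.
Proof.
move=> [G0 G1] Hx Hv Np Nx N0 N1 xp yp xy I0 Istep IP Hb.
apply: (@wpb_seq _ _ s 3 (b - 3)); last 1 first.
- lia.
- by apply: (@wpb_den _ _ 3 (fun s1 => s1 = set_reg s p (arr s 0 (reg s x)))).
move=> s1 S1 ->; rewrite /wpb.
pose J (s2 : state) u := exists pre post, [/\ nb v = pre ++ post,
   reg s2 p = arr s 0 v + size pre, I pre s2, same (p :: y :: p :: modr body) (moda body) s s2 &
   u <= (cb + 12) * size pre].
have lenJ s2 : same (p :: y :: p :: modr body) (moda body) s s2 -> 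
    [/\ reg s2 x = v, arr s2 0 = arr s 0 & arr s2 1 = arr s 1].
  case=> R A; split; [|exact: A|exact: A].
  by rewrite R // !inE !negb_or xp xy.
apply: (@wp_while J ((cb + 12) * size (nb v))).
- move=> s2 u _ [pre [post [El _ _ _ Hu]]].
  by apply: leq_trans Hu _; rewrite El size_cat leq_mul2l leq_addr orbT.
- move=> s2 u _ [pre [post [El Hi HI S2 Hu]]] /=.
  have [Hx2 H02 H12] := lenJ _ S2; rewrite Hx2 H02 Hi G0 // ltn_add2l El size_cat.
  case: post El => [|z post] El; first by rewrite addn0 ltnn.
  move=> _.
  have Ez : arr s2 1 (reg s2 p) = z.
    rewrite H12 Hi G1 ?El ?nth_cat ?ltnn ?subnn // size_cat /=; lia.
  rewrite -Ez in El *.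
  apply: (@wp_seq _ _ _ (fun s3 k => s3 = set_reg s2 y (arr s2 1 (reg s2 p)) /\ k = 3)).
    by exists 3; eexists; split; first exact: ExecAssign.
  move=> s3 k3 _ [-> ->].
  apply: (@wp_seq _ _ _ (fun s4 k => s4 = set_reg (set_reg s2 y (arr s2 1 (reg s2 p))) p
     (reg s2 p).+1 /\ k = 3)).
    exists 3; eexists; split; first exact: ExecAssign.
    by split=> //=; rewrite /upd eq_sym (negbTE yp).
  move=> s4 k4 _ [-> ->].
  have S2' : same (modr (for_nbr x p y body)) (moda body) s s2 by [].
  apply: (wp_cons (Istep _ _ _ s2 (reg s2 p).+1 El S2' HI)).
  move=> s5 k5 S5 [Hk5 HI5].
  exists (rcons pre (arr s2 1 (reg s2 p))), post; split.
  + by rewrite cat_rcons.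
  + by case: S5 => R _; rewrite R //= /upd eqxx size_rcons Hi addnS.
  + by [].
  + apply: same_trans S2 _; apply: (@same_trans _ _ _ (set_reg (set_reg s2 y
      (arr s2 1 (reg s2 p))) p (reg s2 p).+1)).
      split=> // r; rewrite !inE !negb_or => /and3P[H1 H2 _] /=.
      by rewrite /upd (negbTE H1) (negbTE H2).
    apply: same_sub S5 => r Hr //; by rewrite !inE Hr !orbT.
  + rewrite size_rcons mulnS; move: Hu Hk5.
    by set A := _ * size pre; lia.
- move=> s2 u _ [pre [post [El Hi HI S2 Hu]]] /=.
  have [Hx2 H02 H12] := lenJ _ S2; rewrite Hx2 H02 Hi G0 // ltn_add2l El size_cat.
  case: post El => [|z post] El; last by rewrite /= addnS ltnS leq_addr.
  move=> _; rewrite cats0 in El; rewrite -El in Hu HI.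
  split; first by move: Hu Hb; set A := _ * size _; lia.
  by apply: IP HI; apply: same_trans S2.
- exists [::], (nb v); split=> //=; rewrite ?eqxx /upd ?eqxx ?addn0 ?Hx //.
  by split=> // r; rewrite !inE !negb_or => /and3P[/negbTE H1 _ _]; rewrite /= /upd H1.
Qed.

End Iteration.


(** * Induced paths and connected sets *)

Section InducedPaths.

Variables (T : eqType) (e : rel T).
Hypotheses (e_sym : symmetric e) (e_irr : irreflexive e).

Definition far x y := ~~ e x y && (x != y).

Lemma farC x y : far x y = far y x.
Proof. by rewrite /far e_sym eq_sym. Qed.

Fixpoint ipath (p : seq T) : bool :=
  if p is x :: q then
    (if q is y :: r then e x y && all (far x) r else true) && ipath q
  else true.

Lemma ipath_cons2 x y r :
  ipath [:: x, y & r] = [&& e x y, all (far x) r & ipath (y :: r)].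
Proof. by rewrite /= -!andbA. Qed.

(** The gluing lemma behind all length bounds: two induced paths are joined at their first vertices,
    the first one being reversed, when [e x y] is the only contact between them. *)
Lemma ipath_catrev x p y q :
  ipath (x :: p) -> ipath (y :: q) -> e x y ->
  all (far x) q -> all (fun z => all (far z) (y :: q)) p ->
  ipath (catrev (x :: p) (y :: q)).
Proof.
elim: p x y q => [|x' p IH] x y q.
  by move=> _ Hq Hxy Hx _; rewrite /= Hxy Hx.
rewrite ipath_cons2 => /and3P[Hxx' Hx Hp] Hq Hxy Hxq /=.
case/andP=> Hx' Hpq; apply: IH => //.
- by rewrite ipath_cons2 Hxy Hxq.
- by rewrite e_sym.
- apply/allP=> z Hz /=; rewrite farC (allP Hx) //=.
  exact: (allP Hpq).
Qed.

Lemma ipath_rev p : ipath p -> ipath (rev p).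
Proof.
case: p => [|x [|x' p]] // ; rewrite ipath_cons2 => /and3P[Hxx' Hx Hp].
rewrite /rev -[catrev _ _]/(catrev (x' :: p) [:: x]).
apply: ipath_catrev => //; first by rewrite e_sym.
by apply/allP=> z Hz /=; rewrite farC (allP Hx).
Qed.

Lemma ipath_path x p : ipath (x :: p) -> path e x p.
Proof.
elim: p x => [|y p IH] x //; rewrite ipath_cons2 => /and3P[H _ /IH Hp].
by rewrite /= H.
Qed.

Lemma ipath_nth x0 p i j : ipath p -> i < size p -> j < size p ->
  (e (nth x0 p i) (nth x0 p j) = (i.+1 == j) || (j.+1 == i)) /\
  ((nth x0 p i == nth x0 p j) = (i == j)).
Proof.
elim: p i j => [|x [|y p] IH] i j //.
  by move=> _; case: i => [|i] //; case: j => [|j] //=; rewrite e_irr eqxx.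
rewrite ipath_cons2 => /and3P[Hxy Hx Hr].
have Hfar k : k < size (y :: p) ->
    e x (nth x0 (y :: p) k) = (k == 0) /\ (x == nth x0 (y :: p) k) = false.
  case: k => [|k] Hk /=.
    by split=> //; apply/negP => /eqP E; rewrite E e_irr in Hxy.
  have /andP[/negbTE -> /negbTE ->] := allP Hx _ (mem_nth x0 (Hk : k < size p)).
  by [].
case: i => [|i]; case: j => [|j] Hi Hj.
- by rewrite /= e_irr eqxx.
- by have [E1 E2] := Hfar j Hj; rewrite [nth x0 [:: x, y & p] 0]/= 
     [nth x0 _ j.+1]/= E1 E2 [0 == j.+1]/= orbF eqSS eq_sym.
- have [E1 E2] := Hfar i Hi; rewrite [nth x0 [:: x, y & p] 0]/= 
     [nth x0 _ i.+1]/= e_sym E1 [_ == x]eq_sym E2;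
     by split=> //=; rewrite eqSS eq_sym.
- exact: (IH i j Hr Hi Hj).
Qed.

Definition conn (W : pred T) x y : Prop :=
  exists p, [/\ path e x p, all W (x :: p) & y = last x p].

Lemma conn_refl (W : pred T) x : W x -> conn W x x.
Proof. by move=> Hx; exists [::]; split=> //=; rewrite Hx. Qed.

Lemma conn_trans (W : pred T) x y z : conn W x y -> conn W y z -> conn W x z.
Proof.
move=> [p [Hp Wp ->]] [q [Hq Wq ->]]; exists (p ++ q).
rewrite cat_path Hp Hq last_cat; split=> //.
by move: Wp Wq; rewrite /= all_cat => /andP[-> ->] /andP[_ ->].
Qed.

Lemma conn_step (W : pred T) x y : W x -> W y -> e x y -> conn W x y.
Proof. by move=> Hx Hy H; exists [:: y]; split=> //=; rewrite ?H ?Hx ?Hy. Qed.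

Lemma conn_memr (W : pred T) x y : conn W x y -> W y.
Proof. by move=> [p [_ /allP Wp ->]]; apply: Wp; apply: mem_last. Qed.

Lemma conn_meml (W : pred T) x y : conn W x y -> W x.
Proof. by move=> [p [_ /andP[]]]. Qed.

Lemma conn_sub (W W' : pred T) x y :
  (forall z, W z -> W' z) -> conn W x y -> conn W' x y.
Proof. by move=> H [p [Hp Wp Ey]]; exists p; split=> //; apply: sub_all Wp. Qed.

Lemma conn_sym (W : pred T) x y : conn W x y -> conn W y x.
Proof.
move=> [p [Hp Wp ->]]; elim: p x Hp Wp => [|z p IH] x /=.
  by move=> _ /andP[Hx _]; apply: conn_refl.
move=> /andP[Hxz Hp] /and3P[Hx Hz Wp].
apply: (@conn_trans _ _ z); first by apply: IH => //=; rewrite Hz.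
by apply: conn_step => //; rewrite e_sym.
Qed.

Lemma conn_ind (W : pred T) (P : T -> Prop) x y :
  P x -> (forall a b, conn W x a -> P a -> W b -> e a b -> P b) ->
  conn W x y -> P y.
Proof.
move=> Px HP [p [Hp Wp ->]]; elim/last_ind: p Hp Wp => [|p z IH] //.
rewrite rcons_path last_rcons -rcons_cons all_rcons => /andP[Hp Hz] /andP[Wz Wp].
apply: (HP (last x p) z) (IH Hp Wp) Wz Hz; first by exists p.
Qed.

(** A walk from [P] to its complement has a first vertex [b] outside [P], and the part before it
    stays inside. Applied to walks that leave the surviving part of a component. *)
Lemma conn_exit (W P : pred T) x y :
  conn W x y -> P x -> ~~ P y ->
  exists a b, [/\ conn (predI W P) x a, conn W x b, ~~ P b & e a b].
Proof.
move=> [p [Hp Wp ->]] Px NP.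
suff: forall q z, conn (predI W P) x z -> path e z q -> all W (z :: q) ->
   ~~ P (last z q) ->
   exists a b, [/\ conn (predI W P) x a, conn W x b, ~~ P b & e a b].
  apply; [|exact: Hp|exact: Wp|exact: NP].
  by apply: conn_refl; rewrite /= Px; case/andP: Wp => ->.
elim=> [|t q IH] z Hz.
  by move=> _ _ /=; move: (conn_memr Hz) => /andP[_ ->].
rewrite /= => /andP[Hzt Hq] /and3P[Wz Wt Wq] Hl.
have Ht : conn W x t.
  apply: (@conn_trans _ _ z); first by apply: conn_sub Hz => ? /andP[].
  exact: conn_step.
case Pt: (P t); last by exists z, t; rewrite Pt; split.
apply: (IH t) => //=; last by rewrite Wt.
apply: (conn_trans Hz); apply: conn_step => //; last by rewrite /= Wt Pt.
exact: conn_memr Hz.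
Qed.

(** A set that is connected to some vertex of a failing path is connected to the neighbor of its
    first vertex; this turns statements about attachers into nonadjacency of whole paths. *)
Lemma conn_ipath (W : pred T) b r x :
  ipath (b :: r) -> all W r -> x \in r ->
  exists y, [/\ y \in r, e b y & conn W x y].
Proof.
case: r => [|y r] //; rewrite ipath_cons2 => /and3P[Hby _ Hr] Wr Hx.
exists y; split=> //; first by rewrite mem_head.
apply: conn_sym; move/ipath_path: Hr => Hr.
case/splitPl: Hx Hr Wr => p1 p2 Hl Hr Wr.
exists p1; split=> //; first by move: Hr; rewrite cat_path => /andP[].
by move: Wr; rewrite /= all_cat => /and3P[-> ->].
Qed.

(** * Descending levels *)

(* [z :: q] is an induced path from the component of [x] in [A] back to [a];
   only its first vertex has neighbors in [B] that see the component. *)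
Definition chain (a : T) (D A B : pred T) (x : T) (l : nat) : Prop :=
  exists z q,
  [/\ [/\ size q = l, ipath (z :: q), last z q = a & all D (belast z q)],
      forall y, conn A x y -> D y /\ all (far y) (z :: q),
      forall w y, B w -> conn A x y -> e w y -> [/\ e w z, all (far w) q & D w]
    & exists u y, [/\ B u, conn A x y & e u y]].

Definition peel_step (A B A' B' : pred T) (x u : T) : Prop :=
  [/\ B u, exists y, conn A x y /\ e u y
    & forall y, conn A x y -> A' y = ~~ e u y /\ B' y = e u y].

Lemma peel_step_exit (A B A' B' : pred T) x u :
  (forall y, A' y -> A y) -> A' x -> peel_step A B A' B' x u ->
  exists v y, [/\ B' v, conn A' x y & e v y].
Proof.
move=> sA Ax [_ [y [Hy uy]] Hs].
have := conn_exit (P := A') Hy Ax; case.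
  by have [-> _] := Hs _ Hy; rewrite uy.
move=> p [b [Hp Hb NAb pb]]; exists b, p; split.
- by have [EA ->] := Hs _ Hb; move: NAb; rewrite EA negbK.
- by apply: conn_sub Hp => z /andP[].
- by rewrite e_sym.
Qed.

Lemma chain_init (D A B A' B' : pred T) x a :
  (forall y, A' y -> A y) ->
  (forall w y, B' w -> conn A' x y -> e w y -> A w) ->
  (forall y, B y -> ~~ A y) -> (forall y, conn A x y -> D y) ->
  A' x -> peel_step A B A' B' x a -> chain a D A' B' x 0.
Proof.
move=> sA sB dB sD Ax Hs; exists a, [::]; split=> //=.
- move=> y Hy; have Ay := sA _ (conn_memr Hy).
  have Hy' := conn_sub sA Hy; split; first exact: sD.
  case: Hs => Ba _ /(_ _ Hy')[E _].
  rewrite andbT /far e_sym -E (conn_memr Hy) /=.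
  by apply: contraNneq (dB _ Ba) => <-.
- move=> w y Bw Hy wy; have Hy' := conn_sub sA Hy.
  have Hw : conn A x w.
    apply: (conn_trans Hy'); apply: conn_step => //; [|exact: sB Hy wy|by rewrite e_sym].
    exact: conn_memr Hy'.
  case: Hs => Ba _ /(_ _ Hw)[_ E]; split=> //; last exact: sD.
  by rewrite e_sym -E.
- exact: peel_step_exit Hs.
Qed.

Lemma chain_sub (D D' A B : pred T) x a l :
  (forall y, D y -> D' y) -> chain a D A B x l -> chain a D' A B x l.
Proof.
move=> sD [z [q [[sz Hp Hl Hd] Hfar HB Hx]]]; exists z, q; split=> //.
- by split=> //; apply: sub_all Hd.
- by move=> y /Hfar[/sD].
- by move=> w y Bw Cy wy; have [? ? /sD] := HB _ _ Bw Cy wy.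
Qed.

(** The chosen attacher [u] becomes the new head. Like every attacher it sees the old head and
    nothing else of the path; the surviving component avoids the neighbors of [u], so it is far from
    the whole new path. *)
Lemma chain_step (D A B A' B' : pred T) x a l u :
  (forall y, A' y -> A y) ->
  (forall w y, B' w -> conn A' x y -> e w y -> A w) ->
  (forall y, B y -> ~~ A y) -> A' x ->
  chain a D A B x l -> peel_step A B A' B' x u -> chain a D A' B' x l.+1.
Proof.
move=> sA sB dB Ax [z [q [[sz Hp Hl Hd] Hfar HB _]]] Hs.
case: (Hs) => Bu [y0 [Hy0 uy0]] Hs'.
have [uz uq Du] := HB _ _ Bu Hy0 uy0.
exists u, (z :: q); split.
- by split; rewrite ?ipath_cons2 ?uz ?uq ?Hp //= ?sz ?Du.
- move=> y Hy; have Ay := sA _ (conn_memr Hy).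
  have Hy' := conn_sub sA Hy; have [Dy fy] := Hfar _ Hy'; split=> //.
  have [E _] := Hs' _ Hy'; apply/andP; split=> //.
  rewrite /far e_sym -E (conn_memr Hy) /=.
  by apply: contraNneq (dB _ Bu) => <-.
- move=> w y Bw Hy wy; have Hy' := conn_sub sA Hy.
  have Hw : conn A x w.
    apply: (conn_trans Hy'); apply: conn_step => //; [|exact: sB Hy wy|by rewrite e_sym].
    exact: conn_memr Hy'.
  have [_ E] := Hs' _ Hw; have [Dw fw] := Hfar _ Hw; split=> //.
  by rewrite e_sym -E.
- exact: peel_step_exit Hs.
Qed.

Definition fail_path (h : nat) (a : T) (W : pred T) (R : seq T) :=
  [&& ipath (a :: R), size R == h.-1 & all W R].

(** An attacher of the surviving component and a neighbor of it inside the component prolong the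
    path by two vertices; reversed, it starts at [a]. After level [T] the chain has T-1 vertices, so
    level h-1 yields a path on [h] vertices. *)
Lemma chain_fail (D A B : pred T) x a l :
  (forall y, B y -> ~~ A y) ->
  chain a D A B x l -> exists R, fail_path l.+3 a D R.
Proof.
move=> dB [z [q [[sz Hp Hl Hd] Hfar HB [u [y [Bu Hy uy]]]]]].
have [uz uq Du] := HB _ _ Bu Hy uy; have [Dy fy] := Hfar _ Hy.
have Hr : ipath [:: y, u, z & q].
  by rewrite ipath_cons2 e_sym uy fy ipath_cons2 uz uq.
have := ipath_rev Hr; rewrite [z :: q]lastI Hl -!rcons_cons rev_rcons => HR.
exists (rev [:: y, u & belast z q]); rewrite /fail_path HR /=.
rewrite size_rev /= size_belast sz eqxx /=.
by rewrite all_rev /= Dy Du Hd.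
Qed.

(** * Growing the dominating set *)

Section Rounds.

Variable h : nat.
Hypothesis h_gt1 : 1 < h.
Hypothesis short : forall p, ipath p -> size p <= h.*2.
Hypothesis noK4 : forall a b c d,
  [&& e a b, e a c, e a d, e b c, e b d & e c d] = false.

Definition layer (U : pred T) (K : seq T) : pred T :=
  fun y => U y && has (e y) K.
Definition rest (U : pred T) (K : seq T) : pred T :=
  fun y => U y && ~~ has (e y) K.

(* The attachers [K'] chosen in one round, with their failing paths. *)
Definition round_picks (U : pred T) (K : seq T) (U' : pred T) (K' : seq T) : Prop :=
  [/\ uniq K',
      forall b, b \in K' -> layer U K b,
      exists R, forall b, b \in K' -> fail_path h b U' (R b) /\
        forall b', b' \in K' -> b != b' ->
          forall x y, x \in R b -> conn (rest U K) x y -> ~~ e b' y,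
      forall y, U' y -> rest U K y
    & forall x, U' x -> exists b y, [/\ b \in K', conn (rest U K) x y & e b y]].

(** All rounds so far picked a single vertex: [k] is the latest pick and [M] lists the earlier ones.
    The case [j = 0] is the start vertex, which was not picked because of a failing component. *)
Definition path_phase (j : nat) (U : pred T) (K : seq T) : Prop :=
  exists k M, [/\ K = [:: k], ipath (k :: M), size M = j,
    all (fun z => ~~ U z) (k :: M) /\ (forall y, U y -> all (far y) M)
    & j = 0 \/ exists R, fail_path h k U R].

(** No vertex of the next layer can start a failing path, so the next round picks nothing. *)
Definition long_phase (U : pred T) (K : seq T) : Prop :=
  forall b R, layer U K b -> fail_path h b (rest U K) R -> False.

(** The last round picked two adjacent vertices, neither of which sees the component holding the
    failing path of the other. *)
Definition pair_phase (U : pred T) (K : seq T) : Prop :=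
  exists b b' R R', [/\ K = [:: b; b'], e b b',
    fail_path h b U R /\ fail_path h b' U R',
    ~~ U b /\ ~~ U b'
    & (forall x y, x \in R -> conn U x y -> ~~ e b' y) /\
        (forall x y, x \in R' -> conn U x y -> ~~ e b y)].

(** If [a] and [a'] were not adjacent, the reversed [a :: R], then [k], then [a' :: R'] would be an
    induced path on h + 1 + h vertices: [R] and [R'] lie in different components of [W], and [k]
    sees neither. *)
Lemma join_paths k a R a' R' (W : pred T) :
  fail_path h a W R -> fail_path h a' W R' ->
  (forall x y, x \in R -> conn W x y -> ~~ e a' y /\ a' != y) ->
  (forall x y, x \in R' -> conn W x y -> ~~ e a y /\ a != y) ->
  e k a -> e k a' -> (forall y, W y -> far k y) -> a != a' -> e a a'.
Proof.
move=> /and3P[Hp /eqP sR WR] /and3P[Hp' /eqP sR' WR'] H H' ka ka' Hk aa'.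
apply/negPn/negP => naa'.
have Hfa x : x \in R' -> far a x.
  move=> Hx; apply/andP; apply: (H' x) => //; apply: conn_refl; exact: (allP WR').
have Hfa' x : x \in R -> far a' x.
  move=> Hx; apply/andP; apply: (H x) => //; apply: conn_refl; exact: (allP WR).
have : ipath (catrev (a :: R) [:: k, a' & R']).
  apply: ipath_catrev => //.
  - rewrite ipath_cons2 ka' Hp' andbT; apply/allP => x /(allP WR'); exact: Hk.
  - by rewrite e_sym.
  - rewrite /= /far naa' aa' /=; apply/allP => x; exact: Hfa.
  - apply/allP => x Hx; have Wx := allP WR _ Hx.
    rewrite /= farC Hk //= farC Hfa' //=; apply/allP => y Hy.
    have [y0 [Hy0 Hay0 Cy]] := conn_ipath Hp' WR' Hy.
    have Nxy : ~ conn W x y.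
      move=> Cxy; have [] := H x y0 Hx; last by rewrite Hay0.
      exact: (conn_trans Cxy Cy).
    apply/andP; split; last by apply/eqP => E; apply: Nxy; rewrite -E; apply: conn_refl.
    apply/negP => exy; apply: Nxy; apply: conn_step => //; exact: (allP WR').
move=> /short; rewrite catrevE size_cat size_rev /= sR sR'; lia.
Qed.

Lemma fail_path_sub a (W W' : pred T) R :
  (forall y, W y -> W' y) -> fail_path h a W R -> fail_path h a W' R.
Proof. by move=> H /and3P[? ? /(sub_all H) ?]; apply/and3P. Qed.

Lemma picks_adj U K U' K' k :
  round_picks U K U' K' -> k \in K -> ~~ U k ->
  forall a a', a \in K' -> a' \in K' -> e k a -> e k a' -> a != a' -> e a a'.
Proof.
move=> [_ HL [R HR] HU _] Hk Uk a a' Ha Ha' ka ka' aa'.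
have [Fa Ma] := HR _ Ha; have [Fa' Ma'] := HR _ Ha'.
have NR x y b : b \in K' -> conn (rest U K) x y -> b != y.
  move=> /HL /andP[_ Lb] /conn_memr /andP[_ Ny]; apply: contraNneq Ny => <- //.
apply: (@join_paths k a (R a) a' (R a') (rest U K)) => //.
- exact: fail_path_sub Fa.
- exact: fail_path_sub Fa'.
- by move=> x y Hx Cxy; split; [apply: Ma Hx Cxy|apply: NR Cxy].
- by move=> x y Hx Cxy; split; [apply: Ma' Hx Cxy; rewrite // eq_sym|apply: NR Cxy].
- move=> y /andP[Uy /hasPn Ny]; rewrite /far e_sym Ny //=.
  by apply: contraNneq Uk => ->.
Qed.

(** The picks [k :: M] and the failing path of [k] form one induced path on j + h vertices. *)
Lemma path_phase_le j U K : path_phase j U K -> j <= h.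
Proof.
move=> [k [M [_ Hp sM [HM HU] [->|[R /and3P[HR /eqP sR UR]]]]]] //.
case: R HR sR UR => [|r R] HR sR UR; first by move: sR h_gt1; case: h => [|[]].
move: HR; rewrite ipath_cons2 => /and3P[kr kR HR].
have : ipath (catrev (k :: M) (r :: R)).
  apply: ipath_catrev => //; apply/allP => z Hz; apply/allP => y /(allP UR) /HU.
  by move=> /allP /(_ _ Hz); rewrite farC.
by move/short; rewrite catrevE size_cat size_rev /= sM; move: sR => /=; lia.
Qed.

Lemma picks_nil U K U' : round_picks U K U' [::] -> forall x, ~~ U' x.
Proof. by move=> [_ _ _ _ H] x; apply/negP => /H[b [y []]]. Qed.

Lemma layer_far (U : pred T) K (U' : pred T) b : (forall y, U' y -> rest U K y) -> layer U K b -> ~~ U' b.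
Proof. by move=> H /andP[_ Hb]; apply/negP => /H /andP[_]; rewrite Hb. Qed.

(** All new picks see the single vertex [k], hence are pairwise adjacent. One pick prolongs the path
    of picks, two give the pair phase, three would form a K4 with [k]. *)
Lemma path_next j U K U' K' :
  path_phase j U K -> round_picks U K U' K' ->
  [\/ K' = [::], size K' = 1 /\ path_phase j.+1 U' K'
    | size K' = 2 /\ pair_phase U' K'].
Proof.
move=> [k [M [-> Hp sM [/andP[Uk UM] HM] _]]] HR.
have adj := picks_adj HR (mem_head _ _) Uk.
case: HR => uK' HL [R HR] HU HC.
have ek b : b \in K' -> e k b.
  by move=> /HL /andP[_]; rewrite /= orbF e_sym.
have nU b : b \in K' -> ~~ U' b by move=> /HL; apply: layer_far.
case: K' uK' HL HR HC adj ek nU => [|b [|b' [|b'' K']]] uK' HL HR HC adj ek nU.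
- by constructor 1.
- constructor 2; split=> //; exists b, (k :: M).
  have Hb : b \in [:: b] by rewrite inE.
  have Ub : U b by case/andP: (HL b Hb).
  split=> //.
  + by rewrite ipath_cons2 e_sym ek //= HM // Hp.
  + by rewrite /= sM.
  + split; last first.
      move=> y /HU /andP[Uy]; rewrite /= orbF HM // andbT /far => -> /=.
      by apply: contraNneq Uk => <-.
    rewrite /= nU //=; apply/andP; split.
      by apply: contra Uk => /HU /andP[].
    by apply: sub_all UM => z; apply: contra => /HU /andP[].
  + by right; exists (R b); case: (HR b Hb).
- constructor 3; split=> //.
  have Hb : b \in [:: b; b'] by rewrite !inE eqxx.
  have Hb' : b' \in [:: b; b'] by rewrite !inE eqxx orbT.
  have Nbb' : b != b' by move: uK'; rewrite /= inE andbT.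
  have [Fb Mb] := HR _ Hb; have [Fb' Mb'] := HR _ Hb'.
  exists b, b', (R b), (R b'); split=> //.
  + by apply: adj => //; apply: ek.
  + by split; apply: nU.
  + split=> x y Hx /(conn_sub HU); first by apply: Mb.
    by apply: Mb'; rewrite // eq_sym.
- have [Hb Hb' Hb''] : [/\ b \in [:: b, b', b'' & K'], b' \in [:: b, b', b'' & K']
     & b'' \in [:: b, b', b'' & K']] by rewrite !inE !eqxx !orbT.
  move: uK'; rewrite /= !inE !negb_or => /andP[/and3P[N1 N2 _] /andP[/andP[N3 _] _]].
  have kb := ek _ Hb; have kb' := ek _ Hb'; have kb'' := ek _ Hb''.
  have := noK4 k b b' b''; rewrite kb kb' kb'' (adj _ _ Hb Hb' kb kb' N1).
  by rewrite (adj _ _ Hb Hb'' kb kb'' N2) (adj _ _ Hb' Hb'' kb' kb'' N3) /=.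
Qed.

(** Otherwise the failing path of [c], then [b], then the failing path of [b'] would be an induced
    path on 2h+1 vertices. *)
Lemma pair_attacher (U : pred T) b b' R' c Rc :
  e b b' -> ~~ U b -> ~~ U b' -> fail_path h b' U R' ->
  (forall x y, x \in R' -> conn U x y -> ~~ e b y) ->
  U c -> fail_path h c (rest U [:: b; b']) Rc -> e c b -> e c b'.
Proof.
move=> bb' Ub Ub' /and3P[Hp' /eqP sR' UR'] Hb Uc /and3P[Hp /eqP sR WR] cb.
apply/negPn/negP => ncb'.
have neqU a y : ~~ U a -> U y -> (y == a) = false.
  by move=> Na Uy; apply: contraNF Na => /eqP <-.
have Cc x : x \in R' -> ~ conn U x c.
  by move=> Hx /(Hb _ _ Hx); rewrite e_sym cb.
have fU x y : x \in R' -> U y -> ~ conn U x y -> far y x.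
  move=> Hx Uy NC; apply/andP; split; apply/negP.
    move=> exy; apply: NC; apply: conn_step => //; first exact: (allP UR').
    by rewrite e_sym.
  move=> /eqP E; apply: NC; rewrite E; apply: conn_refl; exact: (allP UR').
have URc : all U Rc by apply: sub_all WR => z /andP[].
have : ipath (catrev (c :: Rc) [:: b, b' & R']).
  apply: ipath_catrev => //.
  - rewrite ipath_cons2 bb' Hp' andbT; apply/allP => x Hx.
    rewrite /far (Hb x x Hx) /=; last by apply: conn_refl; apply: (allP UR').
    by apply: contraNneq Ub => ->; apply: (allP UR').
  - rewrite /= {1}/far ncb' neqU //=.
    by apply/allP => x Hx; apply: fU => //; apply: Cc.
  - apply/allP => y Hy; have /andP[Uy] := allP WR _ Hy.
    rewrite /= orbF negb_or => /andP[nyb nyb'].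
    rewrite {1 2}/far nyb nyb' !neqU //=.
    apply/allP => x Hx; apply: fU => //.
    have [y0 [_ cy0 Cy]] := conn_ipath Hp URc Hy.
    move=> Cxy; apply: (Cc x Hx); apply: (conn_trans Cxy); apply: (conn_trans Cy).
    by apply: conn_step; rewrite ?(conn_memr Cy) // e_sym.
move=> /short; rewrite catrevE size_cat size_rev /= sR sR'; lia.
Qed.

(** Every new pick sees both [b] and [b'], so two of them would complete a K4. After a single pick
    [c], a failing path at a later candidate [d] could be joined through [c] to the failing path of
    [b], again with 2h+1 vertices. *)
Lemma pair_next U K U' K' :
  pair_phase U K -> round_picks U K U' K' ->
  K' = [::] \/ size K' = 1 /\ long_phase U' K'.
Proof.
move=> [b [b' [Rb [Rb' [-> bb' [Fb Fb'] [Ub Ub'] [Mb Mb']]]]]] HR.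
have bb : b \in [:: b; b'] by rewrite !inE eqxx.
have adj := picks_adj HR bb Ub.
case: HR => uK' HL [R HR] HU HC.
have b'b : e b' b by rewrite e_sym.
have both c : c \in K' -> e c b && e c b'.
  move=> Hc; case/andP: (HL _ Hc) => Uc; rewrite /= orbF.
  have Fc := fail_path_sub HU (HR _ Hc).1.
  have Fc' : fail_path h c (rest U [:: b'; b]) (R c).
    by apply: fail_path_sub Fc => y; rewrite /rest /= !orbF orbC.
  case/orP=> H; rewrite H ?andbT /=.
    exact: (pair_attacher bb' Ub Ub' Fb' Mb' Uc Fc H).
  exact: (pair_attacher b'b Ub' Ub Fb Mb Uc Fc' H).
case: K' uK' HL HR HC adj both => [|c [|c' K']] uK' HL HR HC adj both.
- by left.
- right; split=> // d Rd /andP[U'd]; rewrite /= orbF => dc /and3P[Hp /eqP sR WR].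
  have Hc : c \in [:: c] by rewrite inE.
  have /andP[cb cb'] := both c Hc; have Uc : U c by case/andP: (HL c Hc).
  case/and3P: Fb => Hpb /eqP sRb URb.
  have Cc x : x \in Rb -> ~ conn U x c.
    by move=> Hx /(Mb _ _ Hx); rewrite e_sym cb'.
  have Cd x : x \in Rb -> ~ conn U x d.
    move=> Hx /conn_trans Cxd; apply: (Cc x Hx); apply: Cxd; apply: conn_step => //.
    by case/andP: (HU _ U'd).
  have fU x y : x \in Rb -> U y -> ~ conn U x y -> far y x.
    move=> Hx Uy NC; apply/andP; split; apply/negP.
      move=> exy; apply: NC; apply: conn_step => //; first exact: (allP URb).
      by rewrite e_sym.
    move=> /eqP E; apply: NC; rewrite E; apply: conn_refl; exact: (allP URb).
  have Ud : U d by case/andP: (HU _ U'd).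
  have URd : all U Rd by apply: sub_all WR => z /andP[/HU /andP[]].
  have fb y : U' y -> far y b.
    move=> /HU /andP[Uy]; rewrite /= orbF negb_or /far => /andP[-> _] /=.
    by apply: contraNneq Ub => <-.
  have : ipath (catrev (d :: Rd) [:: c, b & Rb]).
    apply: ipath_catrev => //.
    + rewrite ipath_cons2 cb Hpb andbT; apply/allP => x Hx.
      by apply: fU => //; apply: Cc.
    + rewrite /= fb //=; apply/allP => x Hx; apply: fU => //; exact: Cd.
    + apply/allP => y Hy; have /andP[U'y] := allP WR _ Hy.
      rewrite /= orbF => nyc; rewrite fb // {1}/far nyc /=.
      have Nc : ~~ U' c by apply: (layer_far HU); apply: HL.
      rewrite (contraNneq _ Nc) => [|<- //] /=.
      apply/allP => x Hx; apply: fU => //; first by case/andP: (HU _ U'y).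
      have [y0 [_ dy0 Cy]] := conn_ipath Hp URd Hy.
      move=> Cxy; apply: (Cd x Hx); apply: (conn_trans Cxy); apply: (conn_trans Cy).
      by apply: conn_step; rewrite ?(conn_memr Cy) // e_sym.
  move=> /short; rewrite catrevE size_cat size_rev /= sR sRb; clear -h_gt1; lia.
- have [Hc Hc'] : c \in [:: c, c' & K'] /\ c' \in [:: c, c' & K'].
    by rewrite !inE !eqxx orbT.
  have Ncc' : c != c' by move: uK'; rewrite /= inE negb_or => /andP[/andP[]].
  have /andP[cb cb'] := both c Hc; have /andP[c'b c'b'] := both c' Hc'.
  have := noK4 b b' c c'; rewrite bb' ![e b _]e_sym ![e b' _]e_sym cb cb' c'b c'b' /=.
  by rewrite adj // e_sym.
Qed.

Lemma long_next U K U' K' : long_phase U K -> round_picks U K U' K' -> K' = [::].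
Proof.
case: K' => // b K' HL [_ H [R HR] HU _].
have Hb := mem_head b K'; case: (HR b Hb) => Fb _; case: (HL b (R b)).
  exact: H.
exact: (fail_path_sub HU Fb).
Qed.

(* [sz] counts the vertices picked so far, the start vertex included. *)
Definition phase i (U : pred T) K sz : Prop :=
  [\/ (forall x, ~~ U x) /\ sz <= i.+2, path_phase i U K /\ sz = i.+1,
      [/\ pair_phase U K, sz <= i.+2 & i <= h.+1]
    | [/\ long_phase U K, sz <= i.+2 & i <= h.+2]].

Lemma phase_next i U K sz U' K' :
  phase i U K sz -> round_picks U K U' K' ->
  size K' <= 2 /\ phase i.+1 U' K' (sz + size K').
Proof.
move=> Hph HR.
have Hnil : K' = [::] -> sz <= i.+2 ->
    size K' <= 2 /\ phase i.+1 U' K' (sz + size K').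
  move=> E; rewrite E in HR *; split=> //; constructor 1; split.
    exact: picks_nil HR.
  by rewrite addn0; lia.
case: Hph => [[U0 Hsz]|[Hp Hsz]|[Hp Hsz Hi]|[Hp Hsz Hi]].
- apply: Hnil => //; case: HR; case: K' => // b K' _ /(_ _ (mem_head _ _)).
  by rewrite /layer (negbTE (U0 b)).
- case: (path_next Hp HR) => [E|[E P]|[E P]]; first by apply: Hnil => //; lia.
    by rewrite E; split=> //; constructor 2; split=> //; lia.
  have := path_phase_le Hp.
  by rewrite E; split=> //; constructor 3; split=> //; lia.
- case: (pair_next Hp HR) => [E|[E P]]; first exact: Hnil.
  by rewrite E; split=> //; constructor 4; split=> //; lia.
- by apply: Hnil => //; apply: long_next Hp HR.
Qed.

Lemma phase_end U K sz : phase h.+3 U K sz -> forall x, ~~ U x.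
Proof.
case=> [[]|[/path_phase_le]|[]|[]] //; lia.
Qed.

Lemma phase_size i U K sz : phase i U K sz -> sz <= i.+2.
Proof. by case=> [[]|[_ ->]|[]|[]]. Qed.

Lemma phase_init v (U : pred T) : ~~ U v -> phase 0 U [:: v] 1.
Proof.
move=> Uv; constructor 2; split=> //; exists v, [::]; split=> //=; last by left.
by rewrite Uv.
Qed.

End Rounds.
End InducedPaths.


(** * The program *)

Notation rN := 0 (only parsing).
Notation rHN := 4 (only parsing).
Notation rI := 5 (only parsing).
Notation rX := 6 (only parsing).
Notation rP := 7 (only parsing).
Notation rY := 8 (only parsing).
Notation rC := 9 (only parsing).
Notation rBase := 10 (only parsing).
Notation rQh := 11 (only parsing).
Notation rQt := 12 (only parsing).
Notation rNa := 13 (only parsing).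
Notation rZ := 14 (only parsing).
Notation rJ := 15 (only parsing).
Notation rW := 16 (only parsing).
Notation rBest := 17 (only parsing).
Notation rA := 18 (only parsing).
Notation rSn := 19 (only parsing).
Notation rTri := 21 (only parsing).
Notation rTf := 22 (only parsing).
Notation rDone := 23 (only parsing).
Notation rBad := 24 (only parsing).
Notation rV := 25 (only parsing).

Notation aLev := 2 (only parsing).
Notation aTop := 3 (only parsing).
Notation aCid := 4 (only parsing).
Notation aSide := 5 (only parsing).
Notation aPar := 6 (only parsing).
Notation aSeen := 7 (only parsing).
Notation aCnt := 8 (only parsing).
Notation aAl := 9 (only parsing).
Notation aL0 := 10 (only parsing).
Notation aL1 := 11 (only parsing).
Notation aAtt := 12 (only parsing).
Notation aAcnt := 13 (only parsing).
Notation aFail := 14 (only parsing).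
Notation aPark := 15 (only parsing).
Notation aHL := 16 (only parsing).
Notation aQ := 17 (only parsing).
Notation aS := 18 (only parsing).
Notation aG := 19 (only parsing).
Notation aCol := 20 (only parsing).

Notation rd a x := (Read a (Reg x)) (only parsing).
Notation "c1 ;; c2" := (Seq c1 c2) (at level 90, right associativity, only parsing).

(** [aCid] and [aSeen] hold the number of the search that wrote them. Since this number [rC] only
    grows, the arrays never have to be cleared. *)
Definition visit (T1 : nat) : cmd :=
  If (Eq (rd aLev rY) (Const 0))
    (If (Eq (rd aCid rY) (Reg rC)) Skip
       (Write aCid (Reg rY) (Reg rC) ;;
        If (Eq (rd aSide rZ) (Const 0)) (Write aSide (Reg rY) (Const 1))
          (Write aSide (Reg rY) (Const 0)) ;;
        Write aQ (Reg rQt) (Reg rY) ;;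
        Assign rQt (Incr (Reg rQt))))
    (If (Eq (rd aLev rY) (Const T1))
       (If (Eq (rd aSeen rY) (Reg rC))
          (Write aCnt (Reg rY) (Incr (rd aCnt rY)))
          (Write aSeen (Reg rY) (Reg rC) ;;
           Write aCnt (Reg rY) (Const 1) ;;
           Write aAl (Reg rNa) (Reg rY) ;;
           Assign rNa (Incr (Reg rNa))))
       Skip).

(* Breadth-first search for the component of the alive vertices that contains
   the one in register [xr], and for the vertices of level [T1] attached to it. *)
Definition explore (T1 xr : nat) : cmd :=
  (Assign rC (Incr (Reg rC)) ;;
   Write aCid (Reg xr) (Reg rC) ;;
   Write aSide (Reg xr) (Const 0) ;;
   Write aQ (Const 0) (Reg xr) ;;
   Assign rQh (Const 0) ;;
   Assign rQt (Const 1) ;;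
   Assign rNa (Const 0)) ;;
  While (Lt (Reg rQh) (Reg rQt))
    ((Assign rZ (rd aQ rQh) ;; Assign rQh (Incr (Reg rQh))) ;;
     for_nbr rZ rP rY (visit T1)).

Lemma set_arr_if (b : bool) s a i :
  (if b then set_arr s a i 1 else set_arr s a i 0) = set_arr s a i b.
Proof. by case: b. Qed.

Lemma sum_uniq_sub (f : nat -> nat) (D E : seq nat) :
  uniq D -> {subset D <= E} -> \sum_(z <- D) f z <= \sum_(z <- E) f z.
Proof.
elim: D E => [|x D IH] E; first by rewrite big_nil.
move=> /= /andP[Hx uD] sD; have xE : x \in E by apply: sD; rewrite mem_head.
rewrite (perm_big _ (perm_to_rem xE)) !big_cons leq_add2l.
apply: IH => // y Hy; have := sD y; rewrite inE Hy orbT => /(_ isT).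
rewrite (perm_mem (perm_to_rem xE)) inE => /orP[/eqP E1|//].
by rewrite -E1 Hy in Hx.
Qed.

Section Graph.

Variables (n : nat) (nb : nat -> seq nat).
Hypothesis nb_lt : forall x y, y \in nb x -> (x < n) && (y < n).
Hypothesis nb_sym : forall x y, (y \in nb x) = (x \in nb y).
Hypothesis nb_irr : forall x, x \notin nb x.
Hypothesis nb_uniq : forall x, uniq (nb x).

Definition edge : rel nat := fun x y => y \in nb x.

Lemma edge_sym : symmetric edge.
Proof. by move=> x y; rewrite /edge nb_sym. Qed.

Lemma edge_irr : irreflexive edge.
Proof. by move=> x; apply/negbTE/nb_irr. Qed.

(** The unit in which all sweeps are charged: one step for a vertex and one for each entry of its
    adjacency list. *)
Definition vol (l : seq nat) := \sum_(z <- l) (size (nb z)).+1.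

Lemma vol_sub D E : uniq D -> {subset D <= E} -> vol D <= vol E.
Proof. exact: sum_uniq_sub. Qed.

Lemma vol_rcons l x : vol (rcons l x) = vol l + (size (nb x)).+1.
Proof. by rewrite /vol -cats1 big_cat big_seq1. Qed.

Section Explore.

Variables (T1 x c : nat) (s0 : state).
Let A : pred nat := fun y => arr s0 aLev y == 0.

(** The sides found by the search mean something only in a bipartite component, so they are
    specified relative to any 2-coloring of it. *)
Definition two_coloring (chi : nat -> bool) :=
  forall a b, conn edge A x a -> conn edge A x b -> edge a b -> chi a != chi b.

(* [D] is the list of the vertices whose edges have all been scanned, [pre] the
   part of the current list of neighbors that has been scanned. *)
Record explored (D pre Q AL : seq nat) (s : state) : Prop := Explored {
  ex_lev : arr s aLev = arr s0 aLev;
  ex_c : reg s rC = c;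
  ex_q : repr_list aQ rQt s Q;
  ex_al : repr_list aAl rNa s AL;
  ex_uniq : uniq Q;
  ex_x : x \in Q;
  ex_conn : forall y, y \in Q -> conn edge A x y;
  ex_cid : forall y, arr s aCid y = if y \in Q then c else arr s0 aCid y;
  ex_side0 : arr s aSide x = 0;
  ex_side : forall chi, two_coloring chi ->
    forall y, y \in Q -> arr s aSide y = (chi y != chi x);
  ex_side_out : forall y, y \notin Q -> arr s aSide y = arr s0 aSide y;
  ex_aluniq : uniq AL;
  ex_att : forall w, (w \in AL) =
    (arr s0 aLev w == T1) && (0 < count (edge w) D + (w \in pre));
  ex_cnt : forall w, w \in AL -> arr s aSeen w = c /\
    arr s aCnt w = count (edge w) D + (w \in pre);
  ex_seen : forall w, w \notin AL -> arr s aSeen w = arr s0 aSeen w;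
  ex_closed : forall z y, z \in D -> edge z y -> A y -> y \in Q;
  ex_closed_pre : forall y, y \in pre -> A y -> y \in Q
}.

Hypothesis T1_gt0 : 0 < T1.
Hypothesis cid_lt : forall y, arr s0 aCid y < c.
Hypothesis seen_lt : forall y, arr s0 aSeen y < c.

Lemma repr_list_rcons q len s l y s' :
  repr_list q len s l -> reg s' len = (reg s len).+1 ->
  (forall i, arr s' q i = if i == reg s len then y else arr s q i) ->
  repr_list q len s' (rcons l y).
Proof.
move=> [E H] E' H'; split; first by rewrite E' E size_rcons.
move=> i; rewrite size_rcons ltnS H' E nth_rcons leq_eqVlt => /orP[/eqP->|Hi].
  by rewrite eqxx ltnn.
by rewrite Hi ltn_eqF // H.
Qed.

Lemma visit_ok D pre z y Q AL s k :
  explored D pre Q AL s -> reg s rZ = z -> z \in Q -> edge z y -> y \notin pre ->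
  exists Q' AL', explored D (rcons pre y) (Q ++ Q') AL'
    (den (visit T1) (set_reg (set_reg s rY y) rP k)).
Proof.
move=> X Hz zQ zy ypre.
case: (X) => Hlev Hc Hq Hal uQ xQ HC Hcid Hs0 Hs Hso uAL Hatt Hcnt Hseen Hcl Hclp.
have Cz := HC _ zQ.
rewrite /visit /= /upd /= Hlev Hcid Hc.
have Hpre w : w != y -> (w \in rcons pre y) = (w \in pre).
  by move=> Hw; rewrite mem_rcons inE (negbTE Hw).
case Ay: (arr s0 aLev y == 0).
- have yAL : y \notin AL by rewrite Hatt (eqP Ay) eq_sym gtn_eqF.
  have Hatt' w : (w \in AL) =
      (arr s0 aLev w == T1) && (0 < count (edge w) D + (w \in rcons pre y)).
    rewrite Hatt; case: (eqVneq w y) => [->|Hw]; last by rewrite Hpre.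
    by rewrite (eqP Ay) eq_sym gtn_eqF.
  have Hcnt' w : w \in AL -> arr s aSeen w = c /\
      arr s aCnt w = count (edge w) D + (w \in rcons pre y).
    move=> Hw; rewrite Hpre; first exact: Hcnt.
    by apply: contraNneq yAL => <-.
  have Cy : conn edge A x y.
    apply: (conn_trans Cz); apply: conn_step => //; exact: conn_memr Cz.
  case yQ: (y \in Q).
    rewrite eqxx; exists [::], AL; rewrite cats0.
    split=> //= w; rewrite mem_rcons inE => /orP[/eqP->//|]; exact: Hclp.
  rewrite (ltn_eqF (cid_lt y)).
  have {}yQ : y \notin Q by rewrite yQ.
  have Hside chi : two_coloring chi ->
     (arr s aSide (reg s rZ) == 0) = (chi y != chi x).
    move=> Hchi; rewrite Hz (Hs _ Hchi) //.
    by have := Hchi z y Cz Cy zy; case: (chi z) (chi y) (chi x) => [|] [|] [|].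
  have yx : (x == y) = false by apply: contraNF yQ => /eqP <-.
  have mQ w : (w \in Q ++ [:: y]) = (w == y) || (w \in Q).
    by rewrite mem_cat inE orbC.
  exists [:: y], AL; rewrite set_arr_if; split=> //=.
  + by rewrite cats1; apply: (repr_list_rcons Hq).
  + by rewrite cats1 rcons_uniq yQ.
  + by rewrite mQ xQ orbT.
  + by move=> w; rewrite mQ => /orP[/eqP->|/HC].
  + by move=> w; rewrite mQ /upd /=; case: (w == y); rewrite //= Hcid.
  + by rewrite /upd /= yx.
  + move=> chi Hchi w; rewrite mQ (Hside _ Hchi) /upd /=; case: eqVneq => [->|Nw] //=.
    exact: Hs.
  + move=> w; rewrite mQ negb_or /upd /= => /andP[/negbTE -> wQ]; exact: Hso.
  + by move=> z' w Hz' Hw Aw; rewrite mQ (Hcl _ _ Hz' Hw Aw) orbT.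
  + by move=> w; rewrite mem_rcons inE mQ => /orP[->//|/Hclp H /H ->]; rewrite orbT.
- have Hclp' w : w \in rcons pre y -> A w -> w \in Q.
    rewrite mem_rcons inE => /orP[/eqP->|/Hclp //].
    by rewrite /A Ay.
  case Ty: (arr s0 aLev y == T1).
    have cnt_y : (y \in rcons pre y) = true by rewrite mem_rcons mem_head.
    have cnt_y' : (y \in pre) = false by apply/negbTE.
    have Hatt' w : (w \in AL) || (w == y) =
      (arr s0 aLev w == T1) && (0 < count (edge w) D + (w \in rcons pre y)).
      rewrite Hatt; case: (eqVneq w y) => [->|Hw]; last by rewrite Hpre // orbF.
      by rewrite Ty cnt_y addn1 orbT.
    case yAL: (y \in AL).
      have [-> Cy] := Hcnt _ yAL; rewrite eqxx; exists [::], AL; rewrite cats0.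
      split=> //=.
      + by move=> w; rewrite -Hatt'; case: eqVneq => [->|]; rewrite ?yAL ?orbF.
      + move=> w Hw; have [E1 E] := Hcnt _ Hw; split; first exact: E1.
        rewrite /upd /=.
        case: (eqVneq w y) => [->|Nw]; last by rewrite E Hpre.
        by rewrite Cy cnt_y cnt_y' addn0 addn1.
    have yAL' : y \notin AL by rewrite yAL.
    rewrite (Hseen _ yAL') (ltn_eqF (seen_lt y)).
    have D0 : count (edge y) D = 0.
      by apply/eqP; rewrite -leqn0 leqNgt; move: yAL'; rewrite Hatt Ty cnt_y' addn0.
    exists [::], (rcons AL y); rewrite cats0; split=> //=.
    + by apply: (repr_list_rcons Hal) => //= i; rewrite /upd /=.
    + by rewrite rcons_uniq yAL.
    + by move=> w; rewrite mem_rcons inE -Hatt' orbC.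
    + move=> w; rewrite mem_rcons inE /upd /=; case: (eqVneq w y) => [-> _|Nw] /=.
        by rewrite D0 cnt_y.
      by rewrite Hpre //; apply: Hcnt.
    + move=> w; rewrite mem_rcons inE /upd /= negb_or => /andP[/negbTE -> wAL] /=.
      exact: Hseen.
  exists [::], AL; rewrite cats0; split=> //=.
  + move=> w; rewrite Hatt; case: (eqVneq w y) => [->|Nw]; last by rewrite Hpre.
    by rewrite Ty.
  + move=> w Hw; rewrite Hpre; first exact: Hcnt.
    by apply: contraTneq Hw => ->; rewrite Hatt Ty.
Qed.

End Explore.

Lemma vol_bound D : uniq D -> (forall z, z \in D -> z < n) -> vol D <= vol (iota 0 n).
Proof. by move=> uD H; apply: vol_sub => // z /H; rewrite mem_iota. Qed.

Lemma conn_edge_lt (W : pred nat) x y : x < n -> conn edge W x y -> y < n.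
Proof.
move=> Hx; apply: (conn_ind (P := fun y => y < n)) => // a b _ _ _.
by move=> /nb_lt /andP[].
Qed.

Lemma explore_ok T1 xr x s :
  xr \notin modr (explore T1 xr) -> 0 < T1 -> repr_graph n nb s ->
  reg s xr = x -> x < n -> arr s aLev x = 0 ->
  (forall y, arr s aCid y <= reg s rC) -> (forall y, arr s aSeen y <= reg s rC) ->
  wp (explore T1 xr) s (fun s' k => exists Q AL,
    explored T1 x (reg s rC).+1 s Q [::] Q AL s' /\ k <= 80 * vol Q + 80).
Proof.
move=> Nxr T1_gt0 Hg Hx ltx Ax cid_le seen_le.
set c := (reg s rC).+1.
have cid_lt y : arr s aCid y < c by rewrite ltnS.
have seen_lt y : arr s aSeen y < c by rewrite ltnS.
have Cx : conn edge (fun y => arr s aLev y == 0) x x by apply: conn_refl; rewrite Ax.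
have xr9 : xr == 9 = false by apply: contraNF Nxr => /eqP ->.
apply: (@wp_seq _ _ _ (fun s1 k1 => [/\ explored T1 x c s [::] [::] [:: x] [::] s1,
    reg s1 rQh = 0 & k1 <= 40])).
  apply: wp_den => // k Hk; split; [|by []|by apply: leq_trans Hk _].
  have Ex : reg (set_reg s rC (reg s rC).+1) xr = x by rewrite /= /upd /= xr9.
  rewrite /= /upd /= xr9 Hx.
  split=> //=.
  - by split=> // -[|i].
  - by rewrite inE.
  - by move=> y; rewrite inE => /eqP->.
  - by move=> y; rewrite inE.
  - by rewrite /upd /= eqxx.
  - by move=> chi _ y; rewrite inE /upd /= => /eqP->; rewrite !eqxx.
  - by move=> y; rewrite inE /upd /= => /negbTE ->.
  - by move=> w; rewrite andbF.
move=> s1 k1 S1 [X1 Qh1 Hk1].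
pose J (s2 : state) u := exists D M AL, [/\ explored T1 x c s D [::] (D ++ M) AL s2,
   reg s2 rQh = size D, repr_graph n nb s2 & u <= 80 * vol D].
have g1 : repr_graph n nb s1 by apply: repr_graph_same S1 Hg.
have ltQ D pre Q AL s2 : explored T1 x c s D pre Q AL s2 -> forall z, z \in Q -> z < n.
  by move=> X z /(ex_conn X); apply: conn_edge_lt.
apply: (@wp_while J (80 * vol (iota 0 n))).
- move=> s2 u _ [D [M [AL [X _ _ Hu]]]]; apply: leq_trans Hu _.
  rewrite leq_mul2l vol_bound //.
    by move: (ex_uniq X); rewrite cat_uniq => /andP[].
  by move=> z Hz; apply: (ltQ _ _ _ _ _ X); rewrite mem_cat Hz.
- move=> s2 u S2 [D [M [AL [X Hqh g2 Hu]]]] /=.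
  have [Hqt Hq] := ex_q X; rewrite Hqh Hqt size_cat.
  case: M X Hqt Hq => [|z M] X Hqt Hq; first by rewrite addn0 ltnn.
  move=> _.
  have Ez : arr s2 aQ (size D) = z.
    by rewrite Hq ?nth_cat ?ltnn ?subnn // size_cat /= addnS ltnS leq_addr.
  apply: (@wp_seq _ _ _ (fun s3 k3 => s3 = set_reg (set_reg s2 rZ z) rQh (size D).+1 /\ k3 <= 10)).
    apply: wp_den => // k Hk; split; last by apply: leq_trans Hk _.
    by rewrite /= /upd /= Hqh Ez.
  move=> s3 k3 _ [-> Hk3].
  have zQ : z \in D ++ z :: M by rewrite mem_cat mem_head orbT.
  apply: (wp_cons (Q := fun s' k => (exists Q' AL',
     explored T1 x c s D (nb z) ((D ++ z :: M) ++ Q') AL' s') /\ k <= 72 * (size (nb z)) + 9)).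
    set s4 := set_reg _ _ _.
    have X4 : explored T1 x c s D [::] (D ++ z :: M) AL s4 by case: X; split.
    suff: wpb (for_nbr rZ rP rY (visit T1)) s4 (72 * (size (nb z)) + 9)
       (fun s' => exists Q' AL', explored T1 x c s D (nb z) ((D ++ z :: M) ++ Q') AL' s').
      by case=> k [s' [E [Hk HX]]]; exists k, s'.
    apply: (@wpb_for_nbr n nb (fun pre s' => exists Q' AL',
      explored T1 x c s D pre ((D ++ z :: M) ++ Q') AL' s') 60) => //.
    + exact: (ltQ _ _ _ _ _ X).
    + by move=> k; exists [::], AL; rewrite cats0; case: X4; split.
    + move=> pre y post s5 k Enb S5 [Q' [AL' X5]].
      apply: wpb_den => //.
      have [||||Q2 [AL2 X6]] := visit_ok T1_gt0 cid_lt seen_lt (z := z) (y := y) k X5.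
      * by case: S5 => -> .
      * by rewrite mem_cat zQ.
      * by rewrite /edge Enb mem_cat mem_head orbT.
      * have := nb_uniq z; rewrite Enb cat_uniq /= negb_or.
        by move=> /and3P[_ /andP[]].
      * by exists (Q' ++ Q2), AL2; rewrite catA.
  move=> s5 k5 S5 [[Q' [AL' X5]] Hk5].
  exists (rcons D z), (M ++ Q'), AL'; split.
  + rewrite cat_rcons -catA -cat_cons in X5 *; case: X5 => H1 H2 H3 H4 H5 H6 H7 H8 H9 H10 H11 H12 H13 H14 H15 H16 H17.
    have Ec w : count (edge w) (rcons D z) + (w \in [::]) = count (edge w) D + (w \in nb z).
      by rewrite -cats1 count_cat /= addn0 addn0 [edge w z]edge_sym.
    split=> //.
    * by move=> w; rewrite H13 Ec.
    * by move=> w /H14; rewrite Ec.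
    * move=> z' w; rewrite mem_rcons inE => /orP[/eqP->|]; last exact: H16.
      exact: H17.
  + by case: S5 => -> //=; rewrite size_rcons.
  + by apply: repr_graph_same S5 _ => //; apply: repr_graph_eq g2.
  + rewrite vol_rcons /=; lia.
- move=> s2 u _ [D [M [AL [X Hqh g2 Hu]]]] /=.
  have [Hqt Hq] := ex_q X; rewrite Hqh Hqt size_cat.
  case: M X Hqt Hq => [|z M] X Hqt Hq; last by rewrite /= addnS ltnS leq_addr.
  move=> _; rewrite cats0 in X; exists D, AL; split=> //; lia.
- by exists [::], [:: x], [::]; split.
Qed.

End Graph.


(** * Peeling one level off one component *)

Definition select : cmd :=
  Assign rW (Read aAl (Const 0)) ;;
  for_list aAl rJ rNa rY
    (If (Lt (rd aCnt rY) (rd aCnt rW)) (Assign rW (Reg rY)) Skip).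

(* The colors reserved for level [T]; the last level is split by the parity
   [b], and its odd part shares the colors of the level before. *)
Definition colors (h T : nat) (b : bool) : nat * nat :=
  if T.+1 < h then (T.*2.+1, T.*2.+2)
  else if ~~ b then (4, 4)
  else if h == 3 then (5, 5) else (T.*2.-1, T.*2).

(** [T] is a constant of the program text. Only at level 2 the number of the component is stored in
    [aTop]: failure, undoing and picking concern components at that stage, whatever happens inside
    them later. *)
Definition label (h T : nat) : cmd :=
  for_list aQ rJ rQt rZ
    (If (Eq (Const T) (Const 2)) (Write aTop (Reg rZ) (Reg rC)) Skip ;;
     for_nbr rZ rP rY
       (If (Eq (Reg rY) (Reg rW))
          (Write aLev (Reg rZ) (Const T) ;;
           Write aPar (Reg rZ) (Reg rW) ;;
           If (Eq (rd aSide rZ) (Const 0))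
             (Write aL0 (Reg rZ) (Const (colors h T false).1) ;;
              Write aL1 (Reg rZ) (Const (colors h T false).2))
             (Write aL0 (Reg rZ) (Const (colors h T true).1) ;;
              Write aL1 (Reg rZ) (Const (colors h T true).2)))
          Skip)).

Definition process (h T : nat) : cmd :=
  explore T.-1 rX ;;
  select ;;
  If (Eq (Const T) (Const 2))
    (Write aAtt (Reg rC) (Reg rW) ;; Write aAcnt (Reg rC) (Reg rNa)) Skip ;;
  label h T.

(** A component number above [rBase] marks a vertex already searched in this sweep, so a vertex left
    over in a finished component is not searched twice. *)
Definition peel (h T : nat) : cmd :=
  Assign rBase (Reg rC) ;;
  for_list aHL rI rHN rX
    (If (And (Eq (rd aLev rX) (Const 0)) (Not (Lt (Reg rBase) (rd aCid rX))))
       (process h T) Skip).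

Section Graph.

Variables (n : nat) (nb : nat -> seq nat).
Hypothesis nb_lt : forall x y, y \in nb x -> (x < n) && (y < n).
Hypothesis nb_sym : forall x y, (y \in nb x) = (x \in nb y).
Hypothesis nb_irr : forall x, x \notin nb x.
Hypothesis nb_uniq : forall x, uniq (nb x).

Notation eg := (edge nb).
Notation vl := (vol nb).

Lemma sum_cost K l :
  \sum_(z <- l) (K * (size (nb z)).+1 + 10) <= (K + 10) * vl l.
Proof.
rewrite /vol big_distrr /=; apply: leq_sum => z _.
by rewrite mulnDl leq_add2l -{1}[10]muln1 leq_mul2l ltn0Sn orbT.
Qed.

Lemma select_ok s AL :
  repr_list aAl rNa s AL -> 0 < size AL ->
  wpb select s (30 * size AL + 20) (fun s' => reg s' rW \in AL /\
    forall w, w \in AL -> arr s aCnt (reg s' rW) <= arr s aCnt w).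
Proof.
move=> Hal AL0; apply: (@wpb_seq _ _ _ 5 (30 * size AL + 10)
   _ (fun s1 => s1 = set_reg s rW (arr s aAl 0))); last 1 first.
- lia.
- exact: wpb_den.
move=> s1 _ ->; set s1' := set_reg _ _ _.
have W0 : arr s aAl 0 \in AL by case: Hal => _ ->; rewrite ?mem_nth.
apply: (@wpb_for_list (fun pre s' => reg s' rW \in AL /\
  forall w, w \in pre -> arr s aCnt (reg s' rW) <= arr s aCnt w) (fun=> 15) _ _ _ _ _ _ AL) => //.
- move=> pre z post s2 k E S [Win Hmin]; apply: wpb_den => //.
  have E8 : arr s2 8 = arr s 8 by case: S => _ ->.
  rewrite /= /upd /= E8; case: ltnP => Hz /=; split=> //.
  + by rewrite /= /upd /= E mem_cat mem_head orbT.
  + move=> w; rewrite mem_rcons inE /= /upd /= => /orP[/eqP->|/Hmin] //.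
    by move=> Hw; apply: leq_trans Hw; apply: ltnW.
  + by move=> w; rewrite mem_rcons inE => /orP[/eqP->|/Hmin].
- rewrite big_const_seq count_predT iter_addn_0; lia.
Qed.

Lemma label_ok h T s Q w :
  repr_graph n nb s -> repr_list aQ rQt s Q -> uniq Q -> (forall z, z \in Q -> z < n) ->
  reg s rW = w ->
  wpb (label h T) s (100 * vl Q + 100) (fun s' =>
    [/\ forall y, arr s' aLev y = if (y \in Q) && eg y w then T else arr s aLev y,
        forall y, arr s' aPar y = if (y \in Q) && eg y w then w else arr s aPar y,
        forall y, arr s' aL0 y = if (y \in Q) && eg y w
           then (colors h T (arr s aSide y != 0)).1 else arr s aL0 y,
        forall y, arr s' aL1 y = if (y \in Q) && eg y w
           then (colors h T (arr s aSide y != 0)).2 else arr s aL1 y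
      & forall y, arr s' aTop y = if (T == 2) && (y \in Q) then reg s rC
           else arr s aTop y]).
Proof.
move=> Hg HQ uQ ltQ Hw.
pose I (D pre : seq nat) (z : nat) (s' : state) := [/\ forall y, arr s' aLev y =
     if (y \in D) && eg y w || (y == z) && (w \in pre) then T else arr s aLev y,
        forall y, arr s' aPar y = if (y \in D) && eg y w || (y == z) && (w \in pre)
           then w else arr s aPar y,
        forall y, arr s' aL0 y = if (y \in D) && eg y w || (y == z) && (w \in pre)
           then (colors h T (arr s aSide y != 0)).1 else arr s aL0 y
        & forall y, arr s' aL1 y = if (y \in D) && eg y w || (y == z) && (w \in pre)
           then (colors h T (arr s aSide y != 0)).2 else arr s aL1 y].
have I0 (D : seq nat) z z' s' : I D [::] z s' -> I D [::] z' s'.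
  by case=> H1 H2 H3 H4; split=> y; rewrite ?H1 ?H2 ?H3 ?H4 !andbF.
apply: (@wpb_for_list (fun D s' => I D [::] 0 s' /\
   forall y, arr s' aTop y = if (T == 2) && (y \in D) then reg s rC
           else arr s aTop y) (fun z => 80 * (size (nb z)).+1) _ _ _ _ _ _ Q) => //.
- by move=> k; split; [split=> y; rewrite ?andbF|move=> y; rewrite andbF].
- move=> D z M s1 k EQ S1 [I1 Top1].
  have zn : z < n by apply: ltQ; rewrite EQ mem_cat mem_head orbT.
  have g1 : repr_graph n nb s1 by apply: repr_graph_same S1 Hg.
  set s2 := set_reg _ _ _.
  apply: (@wpb_seq _ _ _ 10 (70 * (size (nb z)).+1) _ (fun s3 =>
      [/\ I D [::] z s3, reg s3 rZ = z, reg s3 rW = w, repr_graph n nb s3 &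
      forall y, arr s3 aTop y = if (T == 2) && (y \in rcons D z) then reg s rC
           else arr s aTop y])); last 1 first.
  + lia.
  + apply: wpb_den => //; rewrite /=.
    have Hw1 : reg s1 rW = w by case: S1 => ->.
    have HC1 : reg s1 rC = reg s rC by case: S1 => ->.
    case: eqP => ET; split=> //=.
    * by apply: (I0 _ 0); case: I1.
    * move=> y; rewrite mem_rcons inE /upd /= HC1; case: (y == z) => //=.
      by rewrite Top1 ET.
    * by apply: (I0 _ 0); case: I1.
    * by move=> y; rewrite Top1; case: eqP.
  move=> s3 S3 [I3 Z3 W3 g3 Top3].
  have Side3 : arr s3 aSide = arr s aSide.
    by case: S3 => _ -> //; case: S1 => _ ->.
  apply: (@wpb_for_nbr n nb (fun pre s' => I D pre z s' /\ arr s' aTop = arr s3 aTop)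
     40 _ _ _ _ _ z) => //.
  + move=> pre y post s4 k4 Enb S4 [I4 T4].
    have Z4 : reg s4 rZ = z by case: S4 => ->.
    have W4 : reg s4 rW = w by case: S4 => ->.
    have Side4 : arr s4 aSide = arr s aSide by case: S4 => _ ->.
    apply: wpb_den => //; rewrite /= /upd /= W4 Z4.
    case: (eqVneq y w) => [->|Nyw]; last first.
      case: I4 => H1 H2 H3 H4; split=> //; split=> x /=;
      rewrite ?H1 ?H2 ?H3 ?H4 !mem_rcons !inE [w == y]eq_sym (negbTE Nyw) //=.
    rewrite Side4; case: I4 => H1 H2 H3 H4.
    split; last by case: ifP.
    split=> x; rewrite !mem_rcons mem_head ?andbT.
    * by case: ifP => _ /=; rewrite /upd /= H1; case: (x == z); rewrite ?orbT //= ?orbF.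
    * by case: ifP => _ /=; rewrite /upd /= H2; case: (x == z); rewrite ?orbT //= ?orbF.
    * case: ifP => Hs /=; rewrite /upd /= H3; case: (eqVneq x z) => [->|]; rewrite ?orbT //= ?orbF //.
        by rewrite Hs.
      by rewrite Hs.
    * case: ifP => Hs /=; rewrite /upd /= H4; case: (eqVneq x z) => [->|]; rewrite ?orbT //= ?orbF //.
        by rewrite Hs.
      by rewrite Hs.
  + move=> s4 _ [[H1 H2 H3 H4] T4]; split; last by move=> y; rewrite T4 Top3.
    have E y : (y \in D) && eg y w || (y == z) && (w \in nb z) =
        (y \in rcons D z) && eg y w || (y == 0) && (w \in [::]).
      rewrite andbF orbF mem_rcons inE; case: (eqVneq y z) => [->|] //=.
        by rewrite /edge; case: (w \in nb z); rewrite ?andbT ?andbF ?orbT.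
      by rewrite orbF.
    by split=> y; rewrite ?H1 ?H2 ?H3 ?H4 E.
  + lia.
- move=> s1 _ [[H1 H2 H3 H4] T1].
  have E y : (y \in Q) && eg y w || (y == 0) && (w \in [::]) = (y \in Q) && eg y w.
    by rewrite andbF orbF.
  by split=> // y; rewrite ?H1 ?H2 ?H3 ?H4 E.
- apply: leq_trans (leq_add (sum_cost _ _) (leqnn _)) _; lia.
Qed.

Record processed (h T x : nat) (s : state) (Q : seq nat) (w : nat) (AL : seq nat)
    (s' : state) : Prop := Processed {
  pr_uniq : uniq Q;
  pr_Q : forall y, y \in Q <-> conn eg (fun z => arr s aLev z == 0) x y;
  pr_c : reg s' rC = (reg s rC).+1;
  pr_cid : forall y, arr s' aCid y = if y \in Q then (reg s rC).+1 else arr s aCid y;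
  pr_seen : forall y, arr s' aSeen y <= (reg s rC).+1;
  pr_aluniq : uniq AL;
  pr_al : forall v, (v \in AL) = (arr s aLev v == T.-1) && has (eg v) Q;
  pr_w : w \in AL;
  pr_min : all (eg w) Q -> forall v, v \in AL -> all (eg v) Q;
  pr_lev : forall y, arr s' aLev y = if (y \in Q) && eg y w then T else arr s aLev y;
  pr_par : forall y, arr s' aPar y = if (y \in Q) && eg y w then w else arr s aPar y;
  pr_l0 : forall y, arr s' aL0 y = if (y \in Q) && eg y w
           then (colors h T (arr s' aSide y != 0)).1 else arr s aL0 y;
  pr_l1 : forall y, arr s' aL1 y = if (y \in Q) && eg y w
           then (colors h T (arr s' aSide y != 0)).2 else arr s aL1 y;
  pr_top : forall y, arr s' aTop y = if (T == 2) && (y \in Q) then (reg s rC).+1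
           else arr s aTop y;
  pr_side0 : arr s' aSide x = 0;
  pr_side : forall chi, two_coloring nb x s chi ->
    forall y, y \in Q -> arr s' aSide y = (chi y != chi x);
  pr_side_out : forall y, y \notin Q -> arr s' aSide y = arr s aSide y;
  pr_att : forall c, arr s' aAtt c = if (T == 2) && (c == (reg s rC).+1) then w
           else arr s aAtt c;
  pr_acnt : forall c, arr s' aAcnt c = if (T == 2) && (c == (reg s rC).+1) then size AL
           else arr s aAcnt c
}.

Lemma attached_le_vol (Q AL : seq nat) :
  uniq AL -> (forall v, v \in AL -> has (eg v) Q) -> size AL <= vl Q.
Proof.
move=> uAL H; have sub : {subset AL <= flatten [seq nb z | z <- Q]}.
  move=> v /H /hasP[z zQ vz]; apply/flattenP; exists (nb z).
    by apply/mapP; exists z.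
  by rewrite nb_sym.
apply: leq_trans (uniq_leq_size uAL sub) _.
rewrite size_flatten /vol /shape -map_comp sumnE big_map.
by apply: leq_sum => z _ /=.
Qed.

Lemma process_ok h T x s :
  1 < T -> repr_graph n nb s -> reg s rX = x -> x < n -> arr s aLev x = 0 ->
  (forall y, arr s aCid y <= reg s rC) -> (forall y, arr s aSeen y <= reg s rC) ->
  (exists v z, [/\ arr s aLev v = T.-1, conn eg (fun z => arr s aLev z == 0) x z & eg v z]) ->
  wp (process h T) s (fun s' k => exists Q w AL,
    processed h T x s Q w AL s' /\ k <= 500 * vl Q).
Proof.
move=> T2 Hg Hx ltx Ax cid_le seen_le Hatt.
have T1 : 0 < T.-1 by lia.
have NX : rX \notin modr (explore T.-1 rX) by [].
have W := explore_ok nb_lt nb_sym nb_uniq NX T1 Hg Hx ltx Ax cid_le seen_le.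
apply: (wp_seq W).
move=> s1 k1 S1 [Q [AL [X Hk1]]].
have HQ y : y \in Q <-> conn eg (fun z => arr s aLev z == 0) x y.
  split; first exact: (ex_conn X).
  apply: (conn_ind (P := fun b => b \in Q)); first exact: (ex_x X).
  by move=> a b _ Ha Ab ab; apply: (ex_closed X) ab Ab.
have al v : (v \in AL) = (arr s aLev v == T.-1) && has (eg v) Q.
  by rewrite (ex_att X) in_nil addn0 has_count.
have AL0 : 0 < size AL.
  have [v [z [Lv Cz vz]]] := Hatt.
  have : v \in AL by rewrite al Lv eqxx; apply/hasP; exists z => //; apply/HQ.
  by case: (AL).
have vol0 : 0 < vl Q.
  have := ex_x X; case: (Q) => // a l _; rewrite /vol big_cons addSn; lia.
have szAL : size AL <= vl Q.
  by apply: attached_le_vol (ex_aluniq X) _ => v; rewrite al => /andP[].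
have [k2 [s2 [E2 [Hk2 [Win Hmin]]]]] := select_ok (ex_al X) AL0.
apply: (wp_seq (Q1 := fun s3 k => s3 = s2 /\ k = k2)); first by exists k2, s2.
move=> s3 k3 S2' [-> ->].
have {S2'} S2 := exec_same E2.
have [k4 [s4 [E4 [Hk4 Es4]]]] := @wpb_den (If (Eq (Const T) (Const 2))
    (Write aAtt (Reg rC) (Reg rW) ;; Write aAcnt (Reg rC) (Reg rNa)) Skip) s2 15
    (fun s4 => s4 = den (If (Eq (Const T) (Const 2))
    (Write aAtt (Reg rC) (Reg rW) ;; Write aAcnt (Reg rC) (Reg rNa)) Skip) s2) isT isT
    (erefl _).
apply: (wp_seq (Q1 := fun s3 k => s3 = s4 /\ k = k4)); first by exists k4, s4.
move=> s5 k5 _ [-> ->].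
have C2 : reg s2 rC = (reg s rC).+1 by case: S2 => -> //; rewrite (ex_c X).
have Na2 : reg s2 rNa = size AL by case: S2 => -> //; case: (ex_al X).
set w := reg s2 rW in Win Hmin.
have F4 : [/\ reg s4 = reg s2, forall a, a != aAtt -> a != aAcnt -> arr s4 a = arr s2 a,
   forall c, arr s4 aAtt c = if (T == 2) && (c == (reg s rC).+1) then w else arr s2 aAtt c &
   forall c, arr s4 aAcnt c = if (T == 2) && (c == (reg s rC).+1) then size AL else arr s2 aAcnt c].
  rewrite {}Es4 /=; case: ifP => _; split=> //.
  - by move=> a H1 H2; rewrite /= /upd /= (negbTE H1) (negbTE H2).
  - by move=> c; rewrite /= /upd /= C2.
  - by move=> c; rewrite /= /upd /= C2 Na2.
case: F4 => R4 A4 Att4 Acnt4.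
have Q4 : repr_list aQ rQt s4 Q.
  rewrite /repr_list R4 A4 //; case: S2 => -> // ->//; exact: (ex_q X).
have g4 : repr_graph n nb s4.
  apply: (@repr_graph_eq n nb s1); rewrite ?A4 //; try by case: S2 => _ ->.
  exact: repr_graph_same S1 Hg.
have ltQ z : z \in Q -> z < n by move/HQ; apply: conn_edge_lt.
have [|k6 [s6 [E6 [Hk6 [L6 P6 L06 L16 T6]]]]] := label_ok h T g4 Q4 (ex_uniq X) ltQ (w := w).
  by rewrite R4.
have S6 := exec_same E6.
exists k6, s6; split=> //; exists Q, w, AL.
have lev4 : arr s4 aLev = arr s aLev by rewrite A4 //; case: S2 => _ -> //; rewrite (ex_lev X).
have ar a : a \notin [:: 4; 5; 7; 8; 9; 12; 13; 17] -> arr s4 a = arr s a.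
  move=> H; have N := H; rewrite !inE !negb_or in N.
  case/and5P: N => N1 N2 N3 N4 /and4P[N5 N6 N7 N8].
  rewrite A4 //; case: S2 => _ -> //; case: S1 => _ -> //.
  by rewrite !mem_cat !inE !negb_or N1 N2 N3 N4 N5 N8.
have ar1 a : a \notin [:: 2; 3; 6; 10; 11; 12; 13] -> arr s6 a = arr s1 a.
  move=> H; have N := H; rewrite !inE !negb_or in N.
  case/and5P: N => N1 N2 N3 N4 /and3P[N5 N6 N7].
  case: S6 => _ ->; last by rewrite /= !inE !negb_or N1 N2 N3 N4 N5.
  by rewrite A4 //; case: S2 => _ ->.
split; last by lia.
have side4 : arr s4 aSide = arr s1 aSide by rewrite A4 //; case: S2 => _ ->.
have side6 : arr s6 aSide = arr s1 aSide by rewrite ar1.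
have C4 : reg s4 rC = (reg s rC).+1 by rewrite R4.
split=> //.
- exact: (ex_uniq X).
- by case: S6 => ->.
- by move=> y; rewrite ar1 // (ex_cid X).
- move=> y; rewrite ar1 //; case yAL: (y \in AL); first by case: (ex_cnt X yAL) => ->.
  by rewrite (ex_seen X) ?yAL //; apply: leq_trans (seen_le y) _.
- exact: (ex_aluniq X).
(* [w] has the fewest neighbors in [Q] among the attachers; if it sees all of [Q], so does every
   attacher. *)
- move=> /allP Hall v Hv; rewrite all_count eqn_leq count_size /=.
  have [_ cw] := ex_cnt X Win; have [_ cv] := ex_cnt X Hv.
  have := Hmin _ Hv; have S1cnt : arr s1 aCnt = arr s1 aCnt by [].
  rewrite cw cv !in_nil !addn0; apply: leq_trans.
  by rewrite -(eqP (_ : count (eg w) Q == size Q)) // -all_count; apply/allP.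
- by move=> y; rewrite L6 lev4.
- by move=> y; rewrite P6 ar.
- by move=> y; rewrite L06 (ar aL0) // side4 side6.
- by move=> y; rewrite L16 (ar aL1) // side4 side6.
- by move=> y; rewrite T6 C4 ar.
- by rewrite side6 (ex_side0 X).
- by move=> chi Hchi y Hy; rewrite side6 (ex_side X Hchi).
- by move=> y Hy; rewrite side6 (ex_side_out X).
- move=> c; case: S6 => _ -> //; rewrite Att4.
  by case: S2 => _ -> //; case: S1 => _ ->.
- move=> c; case: S6 => _ -> //; rewrite Acnt4.
  by case: S2 => _ -> //; case: S1 => _ ->.
Qed.

End Graph.


(** * Sweeping over all components at one level *)

Section Graph.

Variables (n : nat) (nb : nat -> seq nat).
Hypothesis nb_lt : forall x y, y \in nb x -> (x < n) && (y < n).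
Hypothesis nb_sym : forall x y, (y \in nb x) = (x \in nb y).
Hypothesis nb_irr : forall x, x \notin nb x.
Hypothesis nb_uniq : forall x, uniq (nb x).

Notation eg := (edge nb).
Notation vl := (vol nb).
Let eg_sym := edge_sym nb_sym.

Definition level (s : state) (T : nat) : pred nat := fun y => arr s aLev y == T.

(* [Q] is a component of the vertices alive in [s0], with number [c], attacher
   [w] and list of possible attachers [AL]. *)
Record peeled (h T : nat) (s0 s : state) (Q : seq nat) (w : nat) (AL : seq nat)
    (root c : nat) : Prop := Peeled {
  pe_c : reg s0 rC < c <= reg s rC;
  pe_uniq : uniq Q;
  pe_Q : forall y z, y \in Q -> (z \in Q <-> conn eg (level s0 0) y z);
  pe_cid : forall z, (arr s aCid z == c) = (z \in Q);
  pe_aluniq : uniq AL;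
  pe_al : forall v, (v \in AL) = level s0 T.-1 v && has (eg v) Q;
  pe_w : w \in AL;
  pe_min : all (eg w) Q -> forall v, v \in AL -> all (eg v) Q;
  pe_lev : forall z, z \in Q -> arr s aLev z = if eg z w then T else 0;
  pe_par : forall z, z \in Q -> eg z w -> arr s aPar z = w;
  pe_l0 : forall z, z \in Q -> eg z w ->
     arr s aL0 z = (colors h T (arr s aSide z != 0)).1;
  pe_l1 : forall z, z \in Q -> eg z w ->
     arr s aL1 z = (colors h T (arr s aSide z != 0)).2;
  pe_top : forall z, z \in Q ->
     arr s aTop z = if T == 2 then c else arr s0 aTop z;
  pe_root : root \in Q;
  pe_side0 : arr s aSide root = 0;
  pe_side : forall chi : nat -> bool,
    (forall a b, a \in Q -> b \in Q -> eg a b -> chi a != chi b) ->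
    forall z, z \in Q -> arr s aSide z = (chi z != chi root);
  pe_att : T = 2 -> arr s aAtt c = w /\ arr s aAcnt c = size AL
}.

Lemma pe_conn h T s0 s Q w AL root c y z : peeled h T s0 s Q w AL root c ->
  y \in Q -> z \in Q -> conn eg (level s0 0) y z.
Proof. by case=> _ _ H *; apply/H. Qed.

Lemma pe_closed h T s0 s Q w AL root c y z : peeled h T s0 s Q w AL root c ->
  y \in Q -> conn eg (level s0 0) y z -> z \in Q.
Proof. by case=> _ _ H *; apply/(H y). Qed.

Definition unpeeled (s0 s : state) (y : nat) : Prop :=
  [/\ arr s aLev y = arr s0 aLev y, arr s aPar y = arr s0 aPar y,
      arr s aL0 y = arr s0 aL0 y, arr s aL1 y = arr s0 aL1 y
    & arr s aTop y = arr s0 aTop y /\ arr s aSide y = arr s0 aSide y].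

Record peel_inv (h T : nat) (s0 s : state) : Prop := PeelInv {
  pi_c : reg s0 rC <= reg s rC;
  pi_cid : forall y, arr s aCid y <= reg s rC;
  pi_seen : forall y, arr s aSeen y <= reg s rC;
  pi_new : forall y, reg s0 rC < arr s aCid y -> exists Q w AL root c,
    peeled h T s0 s Q w AL root c /\ y \in Q;
  pi_old : forall y, arr s aCid y <= reg s0 rC -> unpeeled s0 s y;
  pi_att : T != 2 -> forall c,
    arr s aAtt c = arr s0 aAtt c /\ arr s aAcnt c = arr s0 aAcnt c
}.

Lemma peel_inv_reg h T s0 s s' :
  reg s' rC = reg s rC -> arr s' = arr s -> peel_inv h T s0 s -> peel_inv h T s0 s'.
Proof.
move=> Er Ea [H1 H2 H3 H4 H5 H6]; split; rewrite ?Er ?Ea //; last first.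
  by move=> y /H5; rewrite /unpeeled Ea.
move=> y Hy; have [Q [w [AL [root [c [P yQ]]]]]] := H4 y Hy.
exists Q, w, AL, root, c; split=> //.
by case: P => *; split; rewrite ?Ea ?Er.
Qed.

(** The components already handled in the sweep are whole components of the vertices alive in [s0],
    so labeling them does not change the component of a vertex not yet reached. *)
Lemma peel_inv_alive h T s0 s x : 1 < T -> peel_inv h T s0 s ->
  arr s aCid x <= reg s0 rC ->
  forall z, conn eg (level s 0) x z <-> conn eg (level s0 0) x z.
Proof.
move=> T1 I Hx z; split.
  apply: conn_sub => {}z /eqP Lz; apply/eqP.
  case: (leqP (arr s aCid z) (reg s0 rC)) => [/(pi_old I)[<- //]|Hz].
  have [Q [w [AL [root [c [P zQ]]]]]] := pi_new I Hz.
  by apply/eqP; apply: conn_memr (pe_conn P zQ zQ).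
move=> Cz; have Lx := conn_meml Cz.
refine (conn_ind (P := fun b => conn eg (level s 0) x b) _ _ Cz).
  by apply: conn_refl; rewrite /level; case: (pi_old I Hx) => ->.
move=> a b Ca Ca' Lb ab; apply: (conn_trans Ca'); apply: conn_step => //.
  exact: conn_memr Ca'.
rewrite /level; case: (leqP (arr s aCid b) (reg s0 rC)) => [/(pi_old I)[-> //]|Hb].
have [Q [w [AL [root [c [P bQ]]]]]] := pi_new I Hb.
have Cbx : conn eg (level s0 0) b x.
  apply: conn_sym => //; apply: (conn_trans Ca); apply: conn_step => //.
  exact: conn_memr Ca.
have xQ : x \in Q := pe_closed P bQ Cbx.
have := pe_c P; have := pe_cid P x; rewrite xQ => /eqP Ex; lia.
Qed.

Lemma peel_inv_level h T s0 s : 1 < T -> peel_inv h T s0 s ->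
  forall v, level s T.-1 v = level s0 T.-1 v.
Proof.
move=> T1 I v; rewrite /level.
case: (leqP (arr s aCid v) (reg s0 rC)) => [/(pi_old I)[-> //]|Hv].
have [Q [w [AL [root [c [P vQ]]]]]] := pi_new I Hv.
have Lv : level s0 0 v := conn_memr (pe_conn P vQ vQ).
rewrite (eqP Lv) (pe_lev P vQ); case: ifP => _ //; lia.
Qed.

Lemma peel_inv_step h T s0 s x s' Q w AL : 1 < T ->
  peel_inv h T s0 s -> arr s aCid x <= reg s0 rC -> arr s aLev x = 0 ->
  processed nb h T x s Q w AL s' ->
  peel_inv h T s0 s' /\ reg s0 rC < arr s' aCid x.
Proof.
move=> T1 I Hx Lx P.
have xQ : x \in Q by apply/(pr_Q P); apply: conn_refl; rewrite /= Lx.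
have Qconn z : z \in Q <-> conn eg (level s0 0) x z.
  by rewrite (pr_Q P); apply: (peel_inv_alive T1 I Hx).
have cidQ z : z \in Q -> arr s aCid z <= reg s0 rC.
  move=> zQ; rewrite leqNgt; apply/negP => Hz.
  have [Q' [w' [AL' [root [c [P' zQ']]]]]] := pi_new I Hz.
  have xQ' : x \in Q' by apply: (pe_closed P' zQ'); apply: conn_sym => //; apply/Qconn.
  have := pe_c P'; have := pe_cid P' x; rewrite xQ' => /eqP Ex; lia.
have Hc := pi_c I.
split; last by rewrite (pr_cid P) xQ; lia.
split.
- rewrite (pr_c P); lia.
- move=> y; rewrite (pr_cid P) (pr_c P); case: ifP => // _.
  by apply: leq_trans (pi_cid I y) _.
- by move=> y; rewrite (pr_c P); apply: (pr_seen P).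
- move=> y; rewrite (pr_cid P); case: ifP => [yQ _|yQ Hy].
    exists Q, w, AL, x, (reg s rC).+1; split=> //.
    have lev0 z : z \in Q -> arr s aLev z = 0 by move/(pr_Q P)/conn_memr/eqP.
    split.
    + rewrite (pr_c P); lia.
    + exact: (pr_uniq P).
    + move=> a b /Qconn Ha; rewrite Qconn; split=> Hb.
        by apply: (conn_trans (y := x)) => //; apply: conn_sym.
      exact: conn_trans Hb.
    + move=> z; rewrite (pr_cid P); case: ifP => [_|_]; first by rewrite eqxx.
      by rewrite ltn_eqF // ltnS (pi_cid I).
    + exact: (pr_aluniq P).
    + by move=> v; rewrite (pr_al P) -(peel_inv_level T1 I).
    + exact: (pr_w P).
    + exact: (pr_min P).
    + by move=> z zQ; rewrite (pr_lev P) zQ /= lev0.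
    + by move=> z zQ zw; rewrite (pr_par P) zQ zw.
    + by move=> z zQ zw; rewrite (pr_l0 P) zQ zw.
    + by move=> z zQ zw; rewrite (pr_l1 P) zQ zw.
    + move=> z zQ; rewrite (pr_top P) zQ andbT; case: ifP => // _.
      by case: (pi_old I (cidQ _ zQ)) => _ _ _ _ [].
    + exact: xQ.
    + exact: (pr_side0 P).
    + move=> chi Hchi; apply: (pr_side P) => a b Ha Hb; apply: Hchi; exact/(pr_Q P).
    + by move=> E; rewrite (pr_att P) (pr_acnt P) E !eqxx.
  have [Q' [w' [AL' [root [c [P' yQ']]]]]] := pi_new I Hy.
  exists Q', w', AL', root, c; split=> //.
  have dis z : z \in Q' -> (z \in Q) = false.
    move=> zQ'; apply/negP => /cidQ; have := pe_c P'; have := pe_cid P' z.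
    rewrite zQ' => /eqP ->; lia.
  have cn : (c == (reg s rC).+1) = false.
    by have := pe_c P'; move=> /andP[_ H]; rewrite ltn_eqF.
  case: P' => H1 H2 H3 H4 H5 H6 H7 H8 H9 H10 H11 H12 H13 H14 H15 H16 H17.
  split=> //.
  + rewrite (pr_c P); lia.
  + move=> z; rewrite (pr_cid P); case zQ: (z \in Q); last exact: H4.
    by rewrite eq_sym cn; apply/esym/negP => /dis; rewrite zQ.
  + by move=> z zQ; rewrite (pr_lev P) dis //= H9.
  + by move=> z zQ zw; rewrite (pr_par P) dis //= H10.
  + by move=> z zQ zw; rewrite (pr_l0 P) (pr_side_out P) dis //= H11.
  + by move=> z zQ zw; rewrite (pr_l1 P) (pr_side_out P) dis //= H12.
  + by move=> z zQ; rewrite (pr_top P) dis // andbF H13.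
  + by rewrite (pr_side_out P) // dis.
  + by move=> chi Hchi z zQ; rewrite (pr_side_out P) ?dis // (H16 _ Hchi).
  + by move=> E; rewrite (pr_att P) (pr_acnt P) cn !andbF; apply: H17.
- move=> y; rewrite (pr_cid P); case: ifP => [_ |yQ Hy]; first by lia.
  have [H1 H2 H3 H4 [H5 H6]] := pi_old I Hy.
  rewrite /unpeeled (pr_lev P) (pr_par P) (pr_l0 P) (pr_l1 P) (pr_top P).
  by rewrite (pr_side_out P) ?yQ // andbF.
- move=> NT c; rewrite (pr_att P) (pr_acnt P) (negbTE NT); exact: (pi_att I).
Qed.

Lemma peel_ok h T s HL :
  1 < T -> repr_graph n nb s -> repr_list aHL rHN s HL -> uniq HL ->
  (forall x, x \in HL -> x < n) -> (forall x y, x \in HL -> eg x y -> y \in HL) ->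
  (forall y, arr s aCid y <= reg s rC) -> (forall y, arr s aSeen y <= reg s rC) ->
  (forall x, x \in HL -> level s 0 x -> exists v z,
     [/\ level s T.-1 v, conn eg (level s 0) x z & eg v z]) ->
  wpb (peel h T) s (600 * vl HL + 20) (fun s' => [/\ peel_inv h T s s',
    forall x, x \in HL -> level s 0 x -> reg s rC < arr s' aCid x
    & forall x, reg s rC < arr s' aCid x -> x \in HL]).
Proof.
move=> T1 Hg HHL uHL ltHL clHL cid_le seen_le Hatt.
apply: (wp_seq (Q1 := fun s1 k => s1 = set_reg s rBase (reg s rC) /\ k <= 2)).
  by apply: wp_den => // k Hk; split.
move=> s1 k1 _ [-> Hk1]; set s1' := set_reg _ _ _.
(* The potential of the sweep: the volume of the vertices searched so far. Distinct searches have
   disjoint components, so the total cost is linear. *)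
pose done s2 := filter (fun y => reg s rC < arr s2 aCid y) HL.
pose J pre s2 u := [/\ peel_inv h T s s2, repr_graph n nb s2, reg s2 rBase = reg s rC,
   (forall x, x \in pre -> level s 0 x -> reg s rC < arr s2 aCid x) /\
   (forall x, reg s rC < arr s2 aCid x -> x \in HL)
   & u <= 30 * size pre + 500 * vl (done s2) /\ size pre <= size HL].
have szHL : size HL <= vl HL.
  by rewrite /vol -sum1_size; apply: leq_sum.
apply: (@wp_for_list J (600 * vl HL) _ _ _ _ _ _ HL) => //.
- move=> pre s2 u [_ _ _ _ [Hu Hs]]; apply: leq_trans Hu _.
  have : vl (done s2) <= vl HL.
    by apply: vol_sub; rewrite ?filter_uniq // => z; rewrite mem_filter => /andP[].
  lia.
- move=> k; split=> //; last by split=> // x; rewrite ltnNge cid_le.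
  by split=> //= y; rewrite ltnNge cid_le.
- move=> pre x post s2 u k EHL S2 [I g2 B2 [Hdone Hin] [Hu Hsz]].
  have xHL : x \in HL by rewrite EHL mem_cat mem_head orbT.
  have Hsz' : size (rcons pre x) <= size HL.
    by rewrite EHL size_cat size_rcons /=; lia.
  apply: wp_if; rewrite /= /upd /= B2.
    move=> /andP[/eqP Lx]; rewrite -leqNgt => Cx.
    have Lx0 : level s 0 x by rewrite /level; case: (pi_old I Cx) => <-; rewrite Lx.
    set s3 := set_reg _ _ _.
    have I3 : peel_inv h T s s3 by apply: peel_inv_reg I.
    have := process_ok nb_lt nb_sym nb_uniq h (x := x) (s := s3) T1.
    case=> //.
    + exact: ltHL.
    + exact: (pi_cid I).
    + exact: (pi_seen I).
    + have [v [z [Lv Cz vz]]] := Hatt _ xHL Lx0; exists v, z; split=> //.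
        by apply/eqP; have := peel_inv_level T1 I v; rewrite Lv.
      by apply/(peel_inv_alive T1 I Cx).
    move=> k3 [s4 [E4 [Q [w [AL [P Hk3]]]]]].
    have S4 := exec_same E4.
    exists k3, s4; split=> //.
    have [I4 Cx4] := peel_inv_step T1 I3 Cx Lx P.
    have QHL z : z \in Q -> z \in HL.
      move=> zQ; apply: (conn_ind (P := fun b => b \in HL) _ _ (proj1 (pr_Q P z) zQ)) => //.
      by move=> a b _ Ha _; apply: clHL.
    have mono y : reg s rC < arr s2 aCid y -> reg s rC < arr s4 aCid y.
      move=> Hy; rewrite (pr_cid P); case: ifP => // _; rewrite ltnS; exact: (pi_c I).
    split=> //.
    + by apply: repr_graph_same S4 _.
    + by case: S4 => ->.
    + split=> y; first rewrite mem_rcons inE => /orP[/eqP-> //|Hy Ly].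
        exact/mono/Hdone.
      by rewrite (pr_cid P); case: ifP => [/QHL //|_ /Hin].
    + split=> //; rewrite size_rcons.
      have : vl (done s2) + vl Q <= vl (done s4).
        rewrite /vol -big_cat /=; apply: vol_sub.
          rewrite cat_uniq filter_uniq // (pr_uniq P) andbT /=.
          apply/hasPn => z zQ; rewrite mem_filter negb_and -leqNgt.
          apply/orP; left; rewrite leqNgt; apply/negP => Hz.
          have [Q' [w' [AL' [root [c [P' zQ']]]]]] := pi_new I Hz.
          have xQ' : x \in Q'.
            apply: (pe_closed P' zQ'); apply: conn_sym => //.
            by apply/(peel_inv_alive T1 I Cx); apply/(pr_Q P).
          have := pe_c P'; have := pe_cid P' x; rewrite xQ' => /eqP Ex; lia.
        move=> z; rewrite mem_cat !mem_filter => /orP[/andP[/mono -> //]|zQ].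
        by rewrite (pr_cid P) zQ /= QHL // andbT ltnS; apply: (pi_c I).
      lia.
  move=> Hx; apply: wp_den => // k3 Hk3; split=> //.
  + by apply: peel_inv_reg I.
  + split=> // y; rewrite mem_rcons inE => /orP[/eqP-> Lx|Hy Ly]; last exact: Hdone.
    move: Hx; rewrite /= ; case: (leqP (arr s2 aCid x) (reg s rC)) => // Cx.
    by case: (pi_old I Cx) => ->; rewrite (eqP Lx).
  + by split=> //; rewrite size_rcons; move: Hu Hk3 => /=; rewrite /done /=; lia.
- move=> s2 u S2 [I g2 B2 [Hdone Hin] [Hu Hsz]]; split; last by split.
  have : vl (done s2) <= vl HL.
    by apply: vol_sub; rewrite ?filter_uniq // => z; rewrite mem_filter => /andP[].
  lia.
Qed.

End Graph.


(** * Descending through the levels 2, ..., h-1 *)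

Fixpoint peels (h k : nat) : cmd :=
  if k is k'.+1 then Seq (peels h k') (peel h k'.+3) else peel h 2.

Lemma peels_same h k s s' : same (modr (peels h k)) (moda (peels h k)) s s' ->
  same (modr (peel h 2)) (moda (peel h 2)) s s'.
Proof.
apply: same_sub; elim: k => [|k IH] //= a; rewrite mem_cat => /orP[/IH|] //.
Qed.

Section Graph.

Variables (n : nat) (nb : nat -> seq nat).
Hypothesis nb_lt : forall x y, y \in nb x -> (x < n) && (y < n).
Hypothesis nb_sym : forall x y, (y \in nb x) = (x \in nb y).
Hypothesis nb_irr : forall x, x \notin nb x.
Hypothesis nb_uniq : forall x, uniq (nb x).

Notation eg := (edge nb).
Notation vl := (vol nb).
Let eg_sym := edge_sym nb_sym.

Section Component.

Variables (h : nat) (HL : seq nat).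
Hypothesis uHL : uniq HL.
Hypothesis ltHL : forall x, x \in HL -> x < n.
Hypothesis clHL : forall x y, x \in HL -> eg x y -> y \in HL.

Lemma conn_HL (W : pred nat) x y : x \in HL -> conn eg W x y -> y \in HL.
Proof.
by move=> Hx; apply: (conn_ind (P := fun y => y \in HL)) => // a b _ Ha _; apply: clHL.
Qed.

Definition active (p : state) : pred nat := fun y => (y \in HL) && level p 0 y.

Lemma active_conn p x y : active p x -> conn eg (level p 0) x y -> active p y.
Proof. by move=> /andP[Hx _] C; rewrite /active (conn_HL Hx C) (conn_memr C). Qed.

Lemma active_step p x y : active p x -> active p y -> eg x y -> conn eg (level p 0) x y.
Proof. by move=> /andP[_ Lx] /andP[_ Ly] xy; apply: conn_step. Qed.

(* What holds after the levels [2], ..., [T] have been peeled off, starting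
   from the state [p]. *)
Record leveled (p : state) (T : nat) (s : state) : Prop := Leveled {
  lv_c : reg p rC <= reg s rC;
  lv_cid : forall y, arr s aCid y <= reg s rC;
  lv_seen : forall y, arr s aSeen y <= reg s rC;
  lv_lev : forall y, active p y -> arr s aLev y = 0 \/ 1 < arr s aLev y <= T;
  lv_out : forall y, ~~ active p y -> unpeeled p s y;
  lv_top : forall y, active p y -> reg p rC < arr s aTop y <= reg s rC;
  lv_conn : forall y z, active p y -> active p z ->
     (arr s aTop y = arr s aTop z <-> conn eg (level p 0) y z);
  lv_att : forall y, active p y -> exists AL, [/\ uniq AL,
     arr s aAcnt (arr s aTop y) = size AL, arr s aAtt (arr s aTop y) \in AL
     & forall v, v \in AL <->
         level p 1 v /\ exists z, conn eg (level p 0) y z /\ eg v z];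
  lv_par : forall y, active p y -> 1 < arr s aLev y ->
     eg y (arr s aPar y) /\ arr s aLev (arr s aPar y) = (arr s aLev y).-1;
  lv_same : forall y z, active p y -> 1 < arr s aLev y -> eg y z ->
     arr s aLev z = arr s aLev y -> arr s aPar z = arr s aPar y;
  lv_common : forall y z z', active p y -> eg z y -> eg z' y ->
     1 < arr s aLev z <= T -> arr s aLev z' = arr s aLev z ->
     arr s aLev y = 0 \/ arr s aLev z <= arr s aLev y ->
     arr s aPar z' = arr s aPar z;
  lv_lists : forall y, active p y -> 1 < arr s aLev y ->
     (arr s aL0 y, arr s aL1 y) = colors h (arr s aLev y) (arr s aSide y != 0);
  lv_chain : forall x, active p x -> arr s aLev x = 0 ->
     chain eg (arr s aAtt (arr s aTop x))
       (fun y => active p y && (arr s aTop y == arr s aTop x))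
       (level s 0) (level s T) x T.-2
}.

(** Active vertices do not touch the levels of earlier passes, so levels of different passes never
    meet. *)
Definition separated (p : state) : Prop :=
  forall y z, active p y -> eg y z -> ~~ (1 < arr p aLev z < h).

Lemma peel_inv_out p T s y : peel_inv nb h T p s ->
  (forall x, reg p rC < arr s aCid x -> x \in HL) ->
  ~~ active p y -> unpeeled p s y.
Proof.
move=> I Hin Ny; apply: (pi_old I); rewrite leqNgt; apply/negP => Hy.
have [Q [w [AL [root [c [P yQ]]]]]] := pi_new I Hy.
have Ly : level p 0 y := conn_memr (pe_conn P yQ yQ).
by case/negP: Ny; rewrite /active (Hin _ Hy) Ly.
Qed.

(* The component that an active vertex was in when level [T] was peeled off. *)
Lemma peel_inv_comp p T s y : peel_inv nb h T p s ->
  (forall x, x \in HL -> level p 0 x -> reg p rC < arr s aCid x) ->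
  active p y -> exists Q w AL root c, peeled nb h T p s Q w AL root c /\ y \in Q.
Proof. by move=> I Hall /andP[Hy Ly]; apply: (pi_new I); apply: Hall. Qed.

Lemma leveled_base p s : 2 < h -> separated p -> peel_inv nb h 2 p s ->
  (forall x, x \in HL -> level p 0 x -> reg p rC < arr s aCid x) ->
  (forall x, reg p rC < arr s aCid x -> x \in HL) ->
  leveled p 2 s.
Proof.
move=> h3 sep I Hall Hin.
have comp := peel_inv_comp I Hall; have out := peel_inv_out I Hin.
have lab y : active p y -> arr s aLev y = 0 \/ arr s aLev y = 2.
  move=> /comp[Q [w [AL [root [c [P yQ]]]]]].
  by rewrite (pe_lev P yQ); case: ifP; [right|left].
have topE Q w AL root c y : peeled nb h 2 p s Q w AL root c -> active p y ->
    (arr s aTop y == c) = (y \in Q).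
  move=> P Ay; case yQ: (y \in Q); first by rewrite (pe_top P yQ) /= eqxx.
  apply/negbTE/eqP => Ey; have [Q' [w' [AL' [root' [c' [P' yQ']]]]]] := comp _ Ay.
  have := pe_cid P y; rewrite yQ -Ey (pe_top P' yQ') /=.
  by rewrite (pe_cid P') yQ'.
(* A labeled neighbor of an active vertex is active. *)
have nbact y z : active p y -> eg y z -> arr s aLev z = 2 -> active p z.
  move=> Ay yz Lz; apply/negPn/negP => Nz.
  by have := sep _ _ Ay yz; have [<- _ _ _ _] := out _ Nz; rewrite Lz /= h3.
have inQ Q w AL root c y z : peeled nb h 2 p s Q w AL root c -> y \in Q ->
    active p y -> active p z -> eg y z -> z \in Q.
  by move=> P yQ Ay Az yz; apply: (pe_closed P yQ); apply: active_step.
split.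
- exact: (pi_c I).
- exact: (pi_cid I).
- exact: (pi_seen I).
- by move=> y /lab[->|->]; [left|right].
- exact: out.
- move=> y /comp[Q [w [AL [root [c [P yQ]]]]]].
  rewrite (pe_top P yQ) /=; exact: (pe_c P).
- move=> y z Ay Az; have [Q [w [AL [root [c [P yQ]]]]]] := comp _ Ay.
  rewrite (pe_top P yQ) /=; split=> [/esym/eqP|C].
    by rewrite (topE _ _ _ _ _ _ P Az); apply: pe_conn P yQ.
  by apply/esym/eqP; rewrite (topE _ _ _ _ _ _ P Az); apply: pe_closed P yQ C.
- move=> y Ay; have [Q [w [AL [root [c [P yQ]]]]]] := comp _ Ay.
  rewrite (pe_top P yQ) /=; have [-> ->] := pe_att P (erefl _).
  exists AL; split; rewrite ?(pe_aluniq P) ?(pe_w P) // => v.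
  rewrite (pe_al P); split=> [/andP[-> /hasP[z zQ vz]]|[-> [z [C vz]]]].
    by split=> //; exists z; split=> //; apply: pe_conn P yQ zQ.
  by apply/hasP; exists z => //; apply: pe_closed P yQ C.
- move=> y Ay Ly; have [Q [w [AL [root [c [P yQ]]]]]] := comp _ Ay.
  have := pe_lev P yQ; case: ifP => [yw ->|_ L0]; last by rewrite L0 in Ly.
  rewrite (pe_par P yQ yw); split=> //.
  have := pe_w P; rewrite (pe_al P) => /andP[/eqP Lw _].
  have Nw : ~~ active p w by rewrite /active /level Lw andbF.
  by have [-> _ _ _ _] := out _ Nw; rewrite Lw.
- move=> y z Ay Ly yz Lz; have [Q [w [AL [root [c [P yQ]]]]]] := comp _ Ay.
  have L2 : arr s aLev y = 2 by case: (lab _ Ay) => // E; rewrite E in Ly.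
  have Az : active p z by apply: nbact yz _ => //; rewrite Lz.
  have zQ := inQ _ _ _ _ _ _ _ P yQ Ay Az yz.
  have := pe_lev P yQ; rewrite L2; case: ifP => // yw _.
  have := pe_lev P zQ; rewrite Lz L2; case: ifP => // zw _.
  by rewrite !(pe_par P).
- move=> y z z' Ay; rewrite eg_sym [eg z' y]eg_sym => yz yz' Lz Lz' _.
  have [Q [w [AL [root [c [P yQ]]]]]] := comp _ Ay.
  have L2 : arr s aLev z = 2 by lia.
  have Az : active p z by apply: (nbact _ _ Ay yz).
  have Az' : active p z' by apply: (nbact _ _ Ay yz'); rewrite Lz'.
  have zQ := inQ _ _ _ _ _ _ _ P yQ Ay Az yz.
  have z'Q := inQ _ _ _ _ _ _ _ P yQ Ay Az' yz'.
  have := pe_lev P zQ; rewrite L2; case: ifP => // zw _.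
  have := pe_lev P z'Q; rewrite Lz' L2; case: ifP => // z'w _.
  by rewrite !(pe_par P).
- move=> y Ay Ly; have [Q [w [AL [root [c [P yQ]]]]]] := comp _ Ay.
  have := pe_lev P yQ; case: ifP => [yw ->|_ L0]; last by rewrite L0 in Ly.
  by rewrite (pe_l0 P yQ yw) (pe_l1 P yQ yw); case: (colors _ _ _).
- move=> x Ax Lx; have [Q [w [AL [root [c [P xQ]]]]]] := comp _ Ax.
  have -> : arr s aAtt (arr s aTop x) = w.
    by rewrite (pe_top P xQ) /=; case: (pe_att P (erefl _)).
  have sub y : level s 0 y -> level p 0 y.
    move=> Ly; case Ay: (active p y); first by case/andP: Ay.
    by have [E _ _ _ _] := out _ (negbT Ay); rewrite /level -E.
  apply: (@chain_init _ eg eg_sym _ (level p 0) (level p 1)) => //.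
  + move=> v y Lv C vy; have Ay := active_conn Ax (conn_sub sub C).
    suff /andP[] : active p v by [].
    by apply: (nbact _ _ Ay _ (eqP Lv)); rewrite eg_sym.
  + by move=> y /eqP E; rewrite /level E.
  + move=> y C; have Ay := active_conn Ax C; rewrite Ay /=.
    by apply/eqP; apply/(_ : arr s aTop y = arr s aTop x); 
       rewrite (pe_top P (pe_closed P xQ C)) (pe_top P xQ).
  + by rewrite /level Lx.
  + have := pe_w P; rewrite (pe_al P) => /andP[Lw /hasP[z zQ wz]].
    split; [exact: Lw|by exists z; split=> //; apply: pe_conn P xQ zQ|].
    move=> y C; have yQ := pe_closed P xQ C.
    by rewrite /level (pe_lev P yQ) [eg w y]eg_sym; case: ifP.
Qed.

Lemma active_sub p T s y : leveled p T s -> active s y -> active p y.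
Proof.
move=> V /andP[Hy Ly]; apply/negPn/negP => Ny.
have [E _ _ _ _] := lv_out V Ny.
by case/negP: Ny; rewrite /active Hy /level -E.
Qed.

(** Vertices with a level are no longer active and keep their data. Conversely, a neighbor of an
    active vertex that shows level [T.+1] must have received it in this sweep, because separation
    excludes older labels; this gives it the same component and hence the same parent. *)
Lemma leveled_next p T s s' : 1 < T -> T.+1 < h -> separated p -> leveled p T s ->
  peel_inv nb h T.+1 s s' ->
  (forall x, x \in HL -> level s 0 x -> reg s rC < arr s' aCid x) ->
  (forall x, reg s rC < arr s' aCid x -> x \in HL) ->
  leveled p T.+1 s'.
Proof.
move=> T1 Th sep V I Hall Hin.
have comp y := @peel_inv_comp _ _ _ y I Hall.
have out y := @peel_inv_out _ _ _ y I Hin.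
have sub y := @active_sub _ _ _ y V.
have T2 : (T.+1 == 2) = false by rewrite eqSS gtn_eqF.
have lab y : active s y -> arr s' aLev y = 0 \/ arr s' aLev y = T.+1.
  move=> /comp[Q [w [AL [root [c [P yQ]]]]]].
  by rewrite (pe_lev P yQ); case: ifP; [right|left].
have topE y : arr s' aTop y = arr s aTop y.
  case Ay: (active s y); last by case: (out _ (negbT Ay)) => _ _ _ _ [].
  have [Q [w [AL [root [c [P yQ]]]]]] := comp _ Ay.
  by rewrite (pe_top P yQ) T2.
have attE := pi_att I (negbT T2).
have newact z : active p z -> arr s' aLev z = T.+1 -> active s z.
  move=> Az Lz; apply/negPn/negP => Nz; have [E _ _ _ _] := out _ Nz.
  by have := lv_lev V Az; rewrite -E Lz; lia.
have nbact y z : active p y -> eg y z -> arr s' aLev z = T.+1 -> active s z.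
  move=> Ay yz Lz; apply: newact => //; apply/negPn/negP => Nz.
  have Nz' : ~~ active s z by apply: contra Nz; apply: sub.
  have := sep _ _ Ay yz; have [<- _ _ _ _] := lv_out V Nz.
  by have [<- _ _ _ _] := out _ Nz'; rewrite Lz; lia.
have inQ Q w AL root c y z : peeled nb h T.+1 s s' Q w AL root c -> y \in Q ->
    active s y -> active s z -> eg y z -> z \in Q.
  by move=> P yQ Ay Az yz; apply: (pe_closed P yQ); apply: active_step.
have low z : 1 < arr s' aLev z <= T -> unpeeled s s' z.
  move=> Lz; apply: out; apply/negP => /lab; lia.
have keep y : arr s' aLev y = 0 \/ arr s' aLev y = T.+1 -> active p y -> active s y.
  move=> H Ay; apply/negPn/negP => Ny; have [E _ _ _ _] := out _ Ny.
  case: H => H; last by case/negP: Ny; apply: newact.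
  by case/negP: Ny; case/andP: Ay => Hy _; rewrite /active Hy /level -E H.
split.
- exact: leq_trans (lv_c V) (pi_c I).
- exact: (pi_cid I).
- exact: (pi_seen I).
- move=> y Ay; case Sy: (active s y); first by case: (lab _ Sy) => ->; lia.
  have [-> _ _ _ _] := out _ (negbT Sy); have := lv_lev V Ay; lia.
- move=> y Ny; have Ny' : ~~ active s y by apply: contra Ny; apply: sub.
  have [H1 H2 H3 H4 [H5 H6]] := lv_out V Ny.
  by have [E1 E2 E3 E4 [E5 E6]] := out _ Ny'; rewrite /unpeeled E1 E2 E3 E4 E5 E6.
- move=> y Ay; rewrite topE; have := lv_top V Ay; have := pi_c I; clear; lia.
- by move=> y z Ay Az; rewrite !topE; apply: (lv_conn V).
- move=> y Ay; rewrite topE; have [-> ->] := attE (arr s aTop y); exact: (lv_att V).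
- move=> y Ay Ly; case Sy: (active s y).
    have [Q [w [AL [root [c [P yQ]]]]]] := comp _ Sy.
    have := pe_lev P yQ; case: ifP => [yw ->|_ L0]; last by rewrite L0 in Ly.
    rewrite (pe_par P yQ yw); split=> //.
    have := pe_w P; rewrite (pe_al P) => /andP[/eqP Lw _].
    have Nw : ~~ active s w by rewrite /active /level Lw gtn_eqF ?andbF //=; lia.
    by have [-> _ _ _ _] := out _ Nw; rewrite Lw.
  have [E1 E2 _ _ _] := out _ (negbT Sy); rewrite E1 in Ly *; rewrite E2.
  have [H1 H2] := lv_par V Ay Ly; split=> //.
  have Nw : ~~ active s (arr s aPar y).
    by rewrite /active /level H2 gtn_eqF ?andbF //; clear -Ly; lia.
  by have [-> _ _ _ _] := out _ Nw.
- move=> y z Ay Ly yz Lz; case Sy: (active s y).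
    have [Q [w [AL [root [c [P yQ]]]]]] := comp _ Sy.
    have L2 : arr s' aLev y = T.+1 by case: (lab _ Sy) => // E; rewrite E in Ly.
    have Sz : active s z by apply: (nbact _ _ Ay yz); rewrite Lz.
    have zQ := inQ _ _ _ _ _ _ _ P yQ Sy Sz yz.
    have := pe_lev P yQ; rewrite L2; case: ifP => // yw _.
    have := pe_lev P zQ; rewrite Lz L2; case: ifP => // zw _.
    by rewrite !(pe_par P).
  have [E1 E2 _ _ _] := out _ (negbT Sy).
  have LT : 1 < arr s' aLev y <= T by rewrite E1 in Ly *; have := lv_lev V Ay; clear -Ly; lia.
  have [E3 E4 _ _ _] : unpeeled s s' z by apply: low; rewrite Lz.
  rewrite E2 E4; apply: (lv_same V) => //; last by rewrite -E1 -E3.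
  by rewrite -E1.
- move=> y z z' Ay zy z'y Lz Lz' Hy; case: (ltngtP (arr s' aLev z) T.+1) => HT; last 1 first.
  + rewrite eg_sym in zy; rewrite eg_sym in z'y.
    have Sz : active s z by apply: (nbact _ _ Ay zy).
    have Sz' : active s z' by apply: (nbact _ _ Ay z'y); rewrite Lz'.
    have Sy : active s y.
      apply: keep => //; case: Hy => Hy; [by left|right].
      have : arr s' aLev y <= T.+1.
        case Sy: (active s y); first by case: (lab _ Sy) => ->.
        have [-> _ _ _ _] := out _ (negbT Sy); have := lv_lev V Ay; clear; lia.
      by move: Hy; rewrite HT; clear; lia.
    have [Q [w [AL [root [c [P yQ]]]]]] := comp _ Sy.
    have zQ := inQ _ _ _ _ _ _ _ P yQ Sy Sz zy.
    have z'Q := inQ _ _ _ _ _ _ _ P yQ Sy Sz' z'y.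
    have := pe_lev P zQ; rewrite HT; case: ifP => // zw _.
    have := pe_lev P z'Q; rewrite Lz' HT; case: ifP => // z'w _.
    by rewrite !(pe_par P).
  + have LT : 1 < arr s' aLev z <= T by move: Lz HT; clear; lia.
    have [E1 E2 _ _ _] := low _ LT.
    have [E3 E4 _ _ _] : unpeeled s s' z' by apply: low; rewrite Lz'.
    rewrite E2 E4; apply: (lv_common V Ay zy z'y).
    * by rewrite -E1.
    * by rewrite -E1 -E3.
    * case Sy: (active s y); first by left; case/andP: Sy => _ /eqP.
      by have [<- _ _ _ _] := out _ (negbT Sy); rewrite -E1.
  + by move: Lz HT; clear; lia.
- move=> y Ay Ly; case Sy: (active s y).
    have [Q [w [AL [root [c [P yQ]]]]]] := comp _ Sy.
    have := pe_lev P yQ; case: ifP => [yw ->|_ L0]; last by rewrite L0 in Ly.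
    by rewrite (pe_l0 P yQ yw) (pe_l1 P yQ yw); case: (colors _ _ _).
  have [E1 _ E3 E4 [_ E6]] := out _ (negbT Sy).
  by rewrite E3 E4 E6 E1; apply: (lv_lists V); rewrite -?E1.
- move=> x Ax Lx; have Sx : active s x by apply: keep => //; left.
  have [Q [w [AL [root [c [P xQ]]]]]] := comp _ Sx.
  rewrite !topE; have [-> _] := attE (arr s aTop x).
  have sub0 y : level s' 0 y -> level s 0 y.
    move=> Ly; case Ay: (active s y); first by case/andP: Ay.
    by have [E _ _ _ _] := out _ (negbT Ay); rewrite /level -E.
  apply: (@chain_sub _ eg (fun y => active p y && (arr s aTop y == arr s aTop x))).
    by move=> y; rewrite topE.
  rewrite (_ : T.+1.-2 = T.-2.+1); last by lia.
  apply: (@chain_step _ eg eg_sym _ (level s 0) (level s T) _ _ _ _ _ w) => //.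
  + move=> v y Lv C vy; have Sy := active_conn Sx (conn_sub sub0 C).
    suff /andP[] : active s v by [].
    by apply: (nbact y) (eqP Lv); [apply: sub|rewrite eg_sym].
  + by move=> y /eqP E; rewrite /level E gtn_eqF //; lia.
  + by rewrite /level Lx.
  + by apply: (lv_chain V) => //; case/andP: Sx => _ /eqP.
  + have := pe_w P; rewrite (pe_al P) => /andP[Lw /hasP[z zQ wz]].
    split; [exact: Lw|by exists z; split=> //; apply: pe_conn P xQ zQ|].
    move=> y C; have yQ := pe_closed P xQ C.
    rewrite /level (pe_lev P yQ) [eg w y]eg_sym; case: ifP => _ //.
    by rewrite eqxx.
Qed.

Variable c3 : nat -> nat.
Hypothesis c3_range : forall x, 0 < c3 x <= 3.
Hypothesis c3_proper : forall x y, eg x y -> c3 x != c3 y.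

(** Two of the three colors remain for the neighbors of a vertex of color [c]; comparing with
    [next3 c] tells them apart. *)
Definition next3 (c : nat) := if c == 3 then 1 else c.+1.

Lemma next3_neq a b c : 0 < a <= 3 -> 0 < b <= 3 -> 0 < c <= 3 ->
  a != c -> b != c -> a != b -> (a == next3 c) != (b == next3 c).
Proof.
by case: a => [|[|[|[|a]]]] //; case: b => [|[|[|[|b]]]] //;
   case: c => [|[|[|[|c]]]].
Qed.

(** What allows the last level to borrow colors from the level before: correct sides, an edge at
    every odd vertex, and attachers that see both ends of each edge. All of it requires that nothing
    of the component is left at level 0. *)
Definition last_ok (p s : state) (T : nat) : Prop :=
  forall y, active p y -> arr s aLev y = T ->
    (forall z, conn eg (level p 0) y z -> arr s aLev z <> 0) ->
  [/\ forall z, eg y z -> arr s aLev z = T ->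
        (arr s aSide y != 0) != (arr s aSide z != 0),
      arr s aSide y <> 0 -> exists z, eg y z /\ arr s aLev z = T
    & 2 < T -> forall v, arr s aLev v = T.-1 -> eg v y ->
        forall y', eg y y' -> arr s aLev y' = T -> eg v y'].

Lemma last_ok_peel p s0 s T : 1 < T ->
  peel_inv nb h T s0 s ->
  (forall x, x \in HL -> level s0 0 x -> reg s0 rC < arr s aCid x) ->
  (forall x, reg s0 rC < arr s aCid x -> x \in HL) ->
  (forall y, active s0 y -> active p y) ->
  (forall y z, active p y -> eg y z -> arr s aLev z = T -> active s0 z) ->
  (forall y, active p y -> arr s aLev y = T -> active s0 y) ->
  last_ok p s T.
Proof.
move=> T1 I Hall Hin sub nbact act y Ay Ly Hcomp.
have Sy := act _ Ay Ly.
have out z := @peel_inv_out _ _ _ z I Hin.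
have [Q [w [AL [root [c [P yQ]]]]]] := peel_inv_comp I Hall Sy.
have QA z : z \in Q -> active s0 z.
  by move=> zQ; apply: (active_conn Sy); apply: pe_conn P yQ zQ.
(* A vertex of [Q] that does not see [w] would still have level 0, although it lies in the component
   of [y]. *)
have Qw z : z \in Q -> eg z w.
  move=> zQ; have := pe_lev P zQ; case: ifP => // _ L0.
  have [] := Hcomp z _ L0; have Cyz := pe_conn P yQ zQ.
  apply: (conn_ind (P := fun b => conn eg (level p 0) y b) _ _ Cyz).
    by apply: conn_refl; case/andP: Ay.
  move=> a b Ca Ca' Lb ab; apply: (conn_trans Ca'); apply: conn_step => //.
    exact: conn_memr Ca'.
  suff /sub/andP[] : active s0 b by [].
  apply: (active_conn Sy); apply: (conn_trans Ca); apply: conn_step => //.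
  exact: conn_memr Ca.
have nbQ z : eg y z -> arr s aLev z = T -> z \in Q.
  move=> yz Lz; apply: (pe_closed P yQ); apply: active_step => //.
  exact: nbact Ay yz Lz.
(* [Q] lies in the neighborhood of [w], so the 3-coloring uses two colors on it and yields a
   bipartition. *)
have Hchi a b : a \in Q -> b \in Q -> eg a b ->
    (c3 a == next3 (c3 w)) != (c3 b == next3 (c3 w)).
  by move=> /Qw aw /Qw bw ab; apply: next3_neq; rewrite ?c3_proper.
have Hside := pe_side P (chi := fun z => c3 z == next3 (c3 w)) Hchi.
split.
- move=> z yz Lz; have zQ := nbQ _ yz Lz.
  rewrite !Hside //; have := Hchi _ _ yQ zQ yz.
  by case: (c3 y == _) (c3 z == _) (c3 root == _) => [] [] [].
(* The root of the search is even. Another vertex has a neighbor in [Q] on its way to the root, and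
   that neighbor is in level [T] too. *)
- move=> Sy0; have Ny : y != root.
    by apply/eqP => E; apply: Sy0; rewrite E (pe_side0 P).
  have [q [Hq Wq El]] := pe_conn P yQ (pe_root P).
  case: q Hq Wq El => [|z q] /=; first by move=> _ _ E; rewrite E eqxx in Ny.
  move=> /andP[yz Hq] /and3P[Wy Wz Wq] _; exists z; split=> //.
  have zQ : z \in Q by apply: (pe_closed P yQ); apply: conn_step.
  by rewrite (pe_lev P zQ) Qw.
- move=> T3 v Lv vy y' yy' Ly'; have y'Q := nbQ _ yy' Ly'.
  have Lv0 : level s0 T.-1 v.
    case Av: (active s0 v).
      have [Q' [w' [AL' [root' [c' [P' vQ']]]]]] := peel_inv_comp I Hall Av.
      by move: Lv; rewrite (pe_lev P' vQ'); case: ifP => _; clear -T3; lia.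
    by have [E _ _ _ _] := out _ (negbT Av); rewrite /level -E Lv.
  have vAL : v \in AL by rewrite (pe_al P) Lv0; apply/hasP; exists y.
  have allw : all (eg w) Q by apply/allP => z /Qw; rewrite eg_sym.
  exact: (allP (pe_min P allw vAL)).
Qed.

Lemma leveled_active p T s y z : separated p -> leveled p T s -> T < h ->
  active p y -> eg y z -> 1 < arr s aLev z <= T -> active p z.
Proof.
move=> sep V Th Ay yz Lz; apply/negPn/negP => Nz.
have := sep _ _ Ay yz; have [<- _ _ _ _] := lv_out V Nz.
by move: Lz; clear -Th; lia.
Qed.

Lemma leveled_attacher p T s x : leveled p T s -> active s x ->
  exists v z, [/\ level s T v, conn eg (level s 0) x z & eg v z].
Proof.
move=> V Sx; have Ax := active_sub V Sx; case/andP: Sx => _ /eqP Lx.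
by have [z [q [_ _ _ [u [y [Hu Hy uy]]]]]] := lv_chain V Ax Lx; exists u, y.
Qed.

Definition attached (p : state) : Prop := forall x, active p x ->
  exists v z, [/\ level p 1 v, conn eg (level p 0) x z & eg v z].

Lemma peels_ok p k : k.+2 < h -> repr_graph n nb p -> repr_list aHL rHN p HL ->
  (forall y, arr p aCid y <= reg p rC) -> (forall y, arr p aSeen y <= reg p rC) ->
  separated p -> attached p ->
  wpb (peels h k) p (k.+1 * (600 * vl HL + 20)) (fun s =>
    leveled p k.+2 s /\ last_ok p s k.+2).
Proof.
elim: k => [|k IH] kh Hg HHL cid_le seen_le sep att.
  rewrite mul1n; apply: wpb_cons (leqnn _) _.
    apply: (peel_ok nb_lt nb_sym nb_uniq h (T := 2) (HL := HL)) => //.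
    by move=> x Hx Lx; apply: att; rewrite /active Hx.
  move=> s S [I Hall Hin].
  have V : leveled p 2 s by apply: leveled_base.
  split=> //; apply: (@last_ok_peel p p) => //.
    by move=> y z Ay yz Lz; apply: (leveled_active sep V kh Ay yz); rewrite Lz.
apply: (wpb_seq (IH _ Hg HHL cid_le seen_le sep att)); first by lia.
  move=> s1 S1 [V1 _].
  apply: wpb_cons (leqnn _) _.
    apply: (peel_ok nb_lt nb_sym nb_uniq h (T := k.+3) (HL := HL)) => //.
    - by apply: repr_graph_same (peels_same S1) Hg.
    - have [R A] := peels_same S1; case: HHL => H1 H2.
      by split=> [|i Hi]; [rewrite R|rewrite A ?H2].
    - exact: (lv_cid V1).
    - exact: (lv_seen V1).
    - by move=> x Hx Lx; apply: (leveled_attacher V1); rewrite /active Hx.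
  move=> s S [I Hall Hin].
  have V : leveled p k.+3 s by apply: (leveled_next _ _ sep V1 I).
  have act y : active p y -> arr s aLev y = k.+3 -> active s1 y.
    move=> Ay Ly; apply/negPn/negP => Ny.
    have [E _ _ _ _] := peel_inv_out I Hin Ny.
    by have := lv_lev V1 Ay; rewrite -E Ly; clear; lia.
  split=> //; apply: (@last_ok_peel p s1) => //.
  - by move=> y; apply: (active_sub V1).
  - move=> y z Ay yz Lz; apply: act; last by [].
    by apply: (leveled_active sep V kh Ay yz); rewrite Lz leqnn.
lia.
Qed.

End Component.
End Graph.


(** * One pass: peel, undo the failures, pick a vertex *)

Definition for_HL (body : cmd) : cmd := for_list aHL rI rHN rX body.

Definition mark_failed : cmd :=
  for_HL (If (Eq (rd aLev rX) (Const 0)) (Write aFail (rd aTop rX) (Const 1)) Skip).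

Definition unlabel (h : nat) : cmd :=
  for_HL (If (And (And (Lt (Const 1) (rd aLev rX)) (Lt (rd aLev rX) (Const h)))
                (Eq (Read aFail (rd aTop rX)) (Const 1)))
            (Write aLev (Reg rX) (Const 0)) Skip).

(** Component numbers start at 1, so 0 in [rBest] stands for no failing component. That the number
    of attachers is minimal is essential in [progress_pick]. *)
Definition choose_best : cmd :=
  Assign rBest (Const 0) ;;
  for_HL (If (Eq (rd aLev rX) (Const 0))
            (If (And (Lt (Const 0) (Reg rBest))
                   (Not (Lt (Read aAcnt (rd aTop rX)) (rd aAcnt rBest))))
               Skip (Assign rBest (rd aTop rX)))
            Skip).

(** The attachers of the selected component join the dominated vertices, level [h.+1], at once; so
    no later pick of the same round sees that component. *)
Definition forbid (h : nat) : cmd :=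
  for_HL (If (And (Eq (rd aLev rX) (Const 0)) (Eq (rd aTop rX) (Reg rBest)))
            (for_nbr rX rP rY
               (If (Eq (rd aLev rY) (Const 1)) (Write aLev (Reg rY) (Const h.+1)) Skip))
            Skip).

Definition mark_hit : cmd :=
  for_nbr rA rP rY
    (If (Eq (rd aLev rY) (Const 0)) (Write aPark (rd aTop rY) (Const 1)) Skip).

(** Level [h], which no peeled vertex receives, parks the components seen by the new pick until the
    next round. *)
Definition set_aside (h : nat) : cmd :=
  for_HL (If (And (Eq (rd aLev rX) (Const 0)) (Eq (Read aPark (rd aTop rX)) (Const 1)))
            (Write aLev (Reg rX) (Const h)) Skip).

Definition pick (h : nat) : cmd :=
  (Assign rA (rd aAtt rBest) ;;
   Write aS (Reg rSn) (Reg rA) ;;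
   Assign rSn (Incr (Reg rSn)) ;;
   Write aPar (Reg rA) (Reg rA)) ;;
  forbid h ;; mark_hit ;; set_aside h.

Definition pass (h : nat) : cmd :=
  peels h (h - 3) ;; mark_failed ;; unlabel h ;; choose_best ;;
  If (Lt (Const 0) (Reg rBest)) (pick h) Skip.

Section Graph.

Variables (n : nat) (nb : nat -> seq nat).
Hypothesis nb_lt : forall x y, y \in nb x -> (x < n) && (y < n).
Hypothesis nb_sym : forall x y, (y \in nb x) = (x \in nb y).
Hypothesis nb_irr : forall x, x \notin nb x.
Hypothesis nb_uniq : forall x, uniq (nb x).

Notation eg := (edge nb).
Notation vl := (vol nb).
Let eg_sym := edge_sym nb_sym.

Section Component.

Variables (h : nat) (HL : seq nat).
Hypothesis uHL : uniq HL.
Hypothesis ltHL : forall x, x \in HL -> x < n.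
Hypothesis clHL : forall x y, x \in HL -> eg x y -> y \in HL.

Lemma wpb_for_HL (I : seq nat -> state -> Prop) K body s b (P : state -> Prop) :
  repr_list aHL rHN s HL ->
  [&& rI \notin modr body, rHN \notin modr body & aHL \notin moda body] ->
  (forall k, I [::] (set_reg s rI k)) ->
  (forall pre z post s1 k, HL = pre ++ z :: post ->
     same (modr (for_HL body)) (moda body) s s1 ->
     I pre s1 -> wpb body (set_reg (set_reg s1 rX z) rI k)
       (K * (size (nb z)).+1) (I (rcons pre z))) ->
  (forall s1, same (modr (for_HL body)) (moda body) s s1 -> I HL s1 -> P s1) ->
  (K + 10) * vl HL + 6 <= b ->
  wpb (for_HL body) s b P.
Proof.
move=> HHL /and3P[H1 H2 H3] I0 IS IP Hb.
apply: (@wpb_for_list I (fun z => K * (size (nb z)).+1) _ _ _ _ _ _ HL) => //.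
by apply: leq_trans Hb; rewrite leq_add2r; apply: sum_cost.
Qed.

Lemma mark_failed_ok s : repr_list aHL rHN s HL ->
  wpb mark_failed s (40 * vl HL + 6) (fun s' => forall c, arr s' aFail c =
    if has (fun x => (arr s aLev x == 0) && (arr s aTop x == c)) HL then 1
    else arr s aFail c).
Proof.
move=> HHL; apply: (@wpb_for_HL (fun pre s' => forall c, arr s' aFail c =
    if has (fun x => (arr s aLev x == 0) && (arr s aTop x == c)) pre then 1
    else arr s aFail c) 30) => //.
move=> pre z post s1 k E S HI; apply: wpb_den => //.
  by rewrite /=; lia.
move=> c; rewrite has_rcons /= /upd /=.
have [L T] : arr s1 aLev = arr s aLev /\ arr s1 aTop = arr s aTop.
  by case: S => _ A; split; apply: A.
rewrite L; case: (arr s aLev z == 0) => //=; rewrite /upd /= T.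
by rewrite HI [c == _]eq_sym; case: (_ == c).
Qed.

Lemma unlabel_ok s : repr_list aHL rHN s HL ->
  wpb (unlabel h) s (40 * vl HL + 6) (fun s' => forall y, arr s' aLev y =
    if [&& y \in HL, 1 < arr s aLev y < h & arr s aFail (arr s aTop y) == 1] then 0
    else arr s aLev y).
Proof.
move=> HHL; apply: (@wpb_for_HL (fun pre s' => forall y, arr s' aLev y =
    if [&& y \in pre, 1 < arr s aLev y < h & arr s aFail (arr s aTop y) == 1] then 0
    else arr s aLev y) 30) => //.
move=> pre z post s1 k E S HI; apply: wpb_den => //.
  by rewrite /=; lia.
have zpre : z \notin pre by move: uHL; rewrite E cat_uniq /= negb_or => /and3P[_ /andP[]].
have [F T] : arr s1 aFail = arr s aFail /\ arr s1 aTop = arr s aTop.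
  by case: S => _ A; split; apply: A.
move=> y; rewrite /= /upd /= F T HI (negbTE zpre) mem_rcons inE /=.
case C: ((1 < arr s aLev z) && (arr s aLev z < h) && (arr s aFail (arr s aTop z) == 1)).
  by rewrite /= /upd /= HI; case: (eqVneq y z) => [->|] //=; rewrite C.
by rewrite HI; case: (eqVneq y z) => [->|] //=; rewrite C (negbTE zpre).
Qed.

Lemma choose_best_ok s : repr_list aHL rHN s HL ->
  (forall x, x \in HL -> arr s aLev x = 0 -> 0 < arr s aTop x) ->
  wpb choose_best s (50 * vl HL + 10) (fun s' =>
    (reg s' rBest = 0 /\ forall x, x \in HL -> arr s aLev x != 0) \/
    exists d, [/\ d \in HL, arr s aLev d = 0, reg s' rBest = arr s aTop d,
      0 < arr s aTop d
      & forall x, x \in HL -> arr s aLev x = 0 ->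
         arr s aAcnt (arr s aTop d) <= arr s aAcnt (arr s aTop x)]).
Proof.
move=> HHL Ht.
apply: (@wpb_seq _ _ _ 2 (50 * vl HL + 8) _ (fun s1 => s1 = set_reg s rBest 0)); last 1 first.
- lia.
- exact: wpb_den.
move=> s1 _ ->; set s1' := set_reg _ _ _.
apply: (@wpb_for_HL (fun pre s' =>
    (reg s' rBest = 0 /\ forall x, x \in pre -> arr s aLev x != 0) \/
    exists d, [/\ d \in HL, arr s aLev d = 0, reg s' rBest = arr s aTop d,
      0 < arr s aTop d
      & forall x, x \in pre -> arr s aLev x = 0 ->
         arr s aAcnt (arr s aTop d) <= arr s aAcnt (arr s aTop x)]) 40) => //.
- by move=> k; left.
- move=> pre z post s2 k E S HI; apply: wpb_den => //.
    by rewrite /=; lia.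
  have zHL : z \in HL by rewrite E mem_cat mem_head orbT.
  have [L T A] : [/\ arr s2 aLev = arr s aLev, arr s2 aTop = arr s aTop &
      arr s2 aAcnt = arr s aAcnt].
    by case: S => _ A; split; apply: A.
  rewrite /= /upd /= L T A; case: (eqVneq (arr s aLev z) 0) => Lz /=; last first.
    case: HI => [[H1 H2]|[d [H1 H2 H3 H4 H5]]]; [left|right].
      by split=> // x; rewrite mem_rcons inE => /orP[/eqP->|/H2].
    exists d; split=> // x; rewrite mem_rcons inE => /orP[/eqP->|/H5 //].
    by move=> L0; rewrite L0 in Lz.
  right; case: HI => [[H1 H2]|[d [H1 H2 H3 H4 H5]]].
    rewrite H1 /=; exists z; split=> //; first exact: Ht.
    move=> x; rewrite mem_rcons inE => /orP[/eqP-> //|/H2 H] L0.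
    by rewrite L0 in H.
  rewrite H3 H4 /=; case: ltnP => Hz /=.
    exists z; split=> //; first exact: Ht.
    move=> x; rewrite mem_rcons inE => /orP[/eqP-> //|/H5 H] L0.
    exact: leq_trans (ltnW Hz) (H L0).
  exists d; split=> // x; rewrite mem_rcons inE => /orP[/eqP-> //|]; exact: H5.
- by rewrite leq_add2l.
Qed.

Lemma forbid_ok s best : repr_graph n nb s -> repr_list aHL rHN s HL ->
  reg s rBest = best ->
  wpb (forbid h) s (80 * vl HL + 6) (fun s' => forall y, arr s' aLev y =
    if (arr s aLev y == 1) &&
       has (fun x => [&& arr s aLev x == 0, arr s aTop x == best & eg x y]) HL
    then h.+1 else arr s aLev y).
Proof.
move=> Hg HHL Hb.
pose I pre s' := forall y, arr s' aLev y =
    if (arr s aLev y == 1) &&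
       has (fun x => [&& arr s aLev x == 0, arr s aTop x == best & eg x y]) pre
    then h.+1 else arr s aLev y.
have I0 pre s' z : I pre s' -> (arr s' aLev z == 0) = (arr s aLev z == 0).
  by move=> ->; case: ifP => // /andP[/eqP->].
apply: (@wpb_for_HL I 70) => //.
- by move=> k y; rewrite andbF.
- move=> pre z post s1 k E S HI.
  have zHL : z \in HL by rewrite E mem_cat mem_head orbT.
  have T : arr s1 aTop = arr s aTop by case: S => _ ->.
  have B : reg s1 rBest = best by case: S => ->.
  apply: (@wpb_if _ _ _ _ (55 * (size (nb z)).+1)) => /=; last by lia.
    rewrite /upd /= T B (I0 _ _ _ HI) => /andP[/eqP Lz /eqP Tz].
    apply: (@wpb_for_nbr n nb (fun pr s' => forall y, arr s' aLev y =
      if (arr s aLev y == 1) && ((y \in pr) ||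
       has (fun x => [&& arr s aLev x == 0, arr s aTop x == best & eg x y]) pre)
      then h.+1 else arr s aLev y) 30 _ _ _ _ _ z) => //.
    + by apply: repr_graph_same S Hg.
    + exact: ltHL.
    + move=> pr y post' s2 k2 Enb S2 H2; apply: wpb_den => // x.
      rewrite mem_rcons inE /= /upd /=; case C: (arr s2 aLev y == 1).
        have L1 : arr s aLev y == 1 by move: C; rewrite H2; case: ifP => [/andP[]|].
        by rewrite /= /upd /= H2; case: (eqVneq x y) => [->|] //=; rewrite L1.
      rewrite H2; case: (eqVneq x y) => [->|] //=; move: C; rewrite H2 !andbT.
      by case: (arr s aLev y =P 1) => //= L1; case: ifP => //; rewrite L1.
    + move=> s2 S2 H2 y; rewrite H2 has_rcons Lz Tz !eqxx /=.
      by rewrite /edge.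
    + lia.
  rewrite /upd /= T B (I0 _ _ _ HI) => C; apply: wpb_den => //.
  by move=> y; rewrite /= HI has_rcons; move: C; case: (_ == 0); case: (_ == best).
Qed.

Lemma mark_hit_ok s a : repr_graph n nb s -> reg s rA = a -> a < n ->
  wpb mark_hit s (40 * (size (nb a)).+1) (fun s' => forall c, arr s' aPark c =
    if has (fun x => (arr s aLev x == 0) && (arr s aTop x == c)) (nb a) then 1
    else arr s aPark c).
Proof.
move=> Hg Ha an; apply: (@wpb_for_nbr n nb (fun pre s' => forall c, arr s' aPark c =
    if has (fun x => (arr s aLev x == 0) && (arr s aTop x == c)) pre then 1
    else arr s aPark c) 20 _ _ _ _ _ a) => //; last by lia.
move=> pre z post s1 k E S HI; apply: wpb_den => //.
move=> c; rewrite has_rcons /= /upd /=.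
have [L T] : arr s1 aLev = arr s aLev /\ arr s1 aTop = arr s aTop.
  by case: S => _ A; split; apply: A.
rewrite L; case: (arr s aLev z == 0) => //=; rewrite /upd /= T.
by rewrite HI [c == _]eq_sym; case: (_ == c).
Qed.

Lemma set_aside_ok s : repr_list aHL rHN s HL ->
  wpb (set_aside h) s (40 * vl HL + 6) (fun s' => forall y, arr s' aLev y =
    if [&& y \in HL, arr s aLev y == 0 & arr s aPark (arr s aTop y) == 1] then h
    else arr s aLev y).
Proof.
move=> HHL; apply: (@wpb_for_HL (fun pre s' => forall y, arr s' aLev y =
    if [&& y \in pre, arr s aLev y == 0 & arr s aPark (arr s aTop y) == 1] then h
    else arr s aLev y) 30) => //.
move=> pre z post s1 k E S HI; apply: wpb_den => //.
  by rewrite /=; lia.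
have zpre : z \notin pre by move: uHL; rewrite E cat_uniq /= negb_or => /and3P[_ /andP[]].
have [F T] : arr s1 aPark = arr s aPark /\ arr s1 aTop = arr s aTop.
  by case: S => _ A; split; apply: A.
move=> y; rewrite /= /upd /= F T HI (negbTE zpre) mem_rcons inE /=.
case C: ((arr s aLev z == 0) && (arr s aPark (arr s aTop z) == 1)).
  by rewrite /= /upd /= HI; case: (eqVneq y z) => [->|] //=; rewrite C.
by rewrite HI; case: (eqVneq y z) => [->|] //=; rewrite C (negbTE zpre).
Qed.

Variable c3 : nat -> nat.
Hypothesis c3_range : forall x, 0 < c3 x <= 3.
Hypothesis c3_proper : forall x y, eg x y -> c3 x != c3 y.
Hypothesis h_gt2 : 2 < h.

Notation active := (active HL).

(* What the final coloring needs to know around a vertex that got a level. *)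
Record settled (s : state) (y : nat) : Prop := Settled {
  se_par : eg y (arr s aPar y);
  se_same : forall z, eg y z -> arr s aLev z = arr s aLev y ->
    arr s aPar z = arr s aPar y;
  se_lists : (arr s aL0 y, arr s aL1 y) = colors h (arr s aLev y) (arr s aSide y != 0);
  se_side : forall z, eg y z -> arr s aLev y = h.-1 -> arr s aLev z = h.-1 ->
    (arr s aSide y != 0) != (arr s aSide z != 0);
  se_odd : arr s aLev y = h.-1 -> arr s aSide y <> 0 ->
    exists z, eg y z /\ arr s aLev z = h.-1;
  se_above : 3 < h -> arr s aLev y = h.-1 -> arr s aLev (arr s aPar y) = h.-2 /\
    forall z, eg z y -> arr s aLev z = h.-2 ->
      arr s aPar z = arr s aPar (arr s aPar y) /\
      forall y', eg y y' -> arr s aLev y' = h.-1 -> eg z y'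
}.

(** The outcome of a pass before the pick: relative to its start [p], each component is either
    settled or entirely back at level 0 with a failing path to show for it. *)
Record sifted (p u : state) : Prop := Sifted {
  si_c : reg p rC <= reg u rC;
  si_cid : forall y, arr u aCid y <= reg u rC;
  si_seen : forall y, arr u aSeen y <= reg u rC;
  si_out : forall y, ~~ active p y -> unpeeled p u y;
  si_lev : forall y, active p y -> arr u aLev y = 0 \/ 1 < arr u aLev y < h;
  si_closed : forall y z, active p y -> arr u aLev y = 0 ->
    conn eg (level p 0) y z -> arr u aLev z = 0;
  si_top : forall y, active p y -> reg p rC < arr u aTop y <= reg u rC;
  si_conn : forall y z, active p y -> active p z ->
     (arr u aTop y = arr u aTop z <-> conn eg (level p 0) y z);
  si_att : forall y, active p y -> exists AL, [/\ uniq AL,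
     arr u aAcnt (arr u aTop y) = size AL, arr u aAtt (arr u aTop y) \in AL
     & forall v, v \in AL <->
         level p 1 v /\ exists z, conn eg (level p 0) y z /\ eg v z];
  si_fail : forall y, active p y -> arr u aLev y = 0 -> exists R,
     fail_path eg h (arr u aAtt (arr u aTop y))
       (fun z => (active p z && (arr u aLev z == 0)) && (arr u aTop z == arr u aTop y)) R;
  si_settled : forall y, active p y -> 1 < arr u aLev y -> settled u y;
  si_failed : forall c, reg u rC < c -> arr u aFail c = 0;
  si_failed_top : forall y, y \in HL -> 1 < arr u aLev y < h ->
    arr u aFail (arr u aTop y) = 0
}.

(** Failure [fl] depends only on the component at level 2, because [aTop] identifies these
    components. So undoing labels removes whole components and leaves the settled ones, and the
    older levels, intact. *)
Lemma sifted_intro p s u :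
  separated nb h HL p -> leveled nb h HL p h.-1 s -> last_ok nb HL p s h.-1 ->
  (forall c, reg p rC < c -> arr s aFail c = 0) ->
  (forall y, y \in HL -> 1 < arr p aLev y < h ->
     arr s aFail (arr p aTop y) = 0 /\ arr p aTop y <= reg p rC) ->
  (forall c, arr u aFail c =
    if has (fun x => (arr s aLev x == 0) && (arr s aTop x == c)) HL then 1
    else arr s aFail c) ->
  (forall y, arr u aLev y =
    if [&& y \in HL, 1 < arr s aLev y < h & arr u aFail (arr s aTop y) == 1] then 0
    else arr s aLev y) ->
  reg u rC = reg s rC ->
  (forall a, a != aFail -> a != aLev -> arr u a = arr s a) ->
  sifted p u.
Proof.
move=> sep V Last fail0 ftop failE levE regE arrE.
have topE y : arr u aTop y = arr s aTop y by rewrite arrE.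
pose fl y := has (fun x => (arr s aLev x == 0) && (arr s aTop x == arr s aTop y)) HL.
have sub x : x \in HL -> arr s aLev x = 0 -> active p x.
  by move=> Hx Lx; apply: (active_sub V); rewrite /active Hx /level Lx.
have failT y : active p y -> (arr u aFail (arr s aTop y) == 1) = fl y.
  by move=> Ay; rewrite failE -/(fl y); case: (fl y); rewrite // fail0 //;
     case/andP: (lv_top V Ay).
have levT y : active p y -> arr u aLev y =
    if fl y then 0 else arr s aLev y.
  move=> Ay; rewrite levE failT //; have /andP[-> _] := Ay; rewrite /=.
  have := lv_lev V Ay; case: (fl y); rewrite ?andbT ?andbF //.
  by case: ifP => // + [->|] //; clear -h_gt2; lia.
have levN y : ~~ active p y -> arr u aLev y = arr s aLev y.
  move=> Ny; rewrite levE; case: ifP => // /and3P[Hy Ly].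
  have [L _ _ _ [T _]] := lv_out V Ny; rewrite L in Ly; rewrite T.
  have [F Tle] := ftop _ Hy Ly; rewrite failE; case: ifP; last by rewrite F.
  case/hasP=> x Hx /andP[/eqP Lx /eqP Tx].
  by have /andP[] := lv_top V (sub _ Hx Lx); rewrite Tx ltnNge Tle.
have lev_pos y : 0 < arr u aLev y -> arr s aLev y = arr u aLev y.
  case Ay: (active p y); last by rewrite levN ?Ay.
  by rewrite levT //; case: ifP.
have fl_conn y z : active p y -> conn eg (level p 0) y z -> fl y = fl z.
  move=> Ay C; have Az := active_conn clHL Ay C.
  by rewrite /fl; have -> : arr s aTop y = arr s aTop z by apply/(lv_conn V Ay Az).
have fl0 y : active p y -> arr s aLev y = 0 -> fl y.
  by move=> /andP[Hy _] Ly; apply/hasP; exists y; rewrite // Ly !eqxx.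
have flE y : active p y -> (arr u aLev y == 0) = fl y.
  move=> Ay; rewrite levT //; case Fy: (fl y) => //.
  by apply/negbTE/negP => /eqP /(fl0 _ Ay); rewrite Fy.
split.
- by rewrite regE; apply: (lv_c V).
- by move=> y; rewrite regE arrE //; apply: (lv_cid V).
- by move=> y; rewrite regE arrE //; apply: (lv_seen V).
- move=> y Ny; have [H1 H2 H3 H4 [H5 H6]] := lv_out V Ny.
  by rewrite /unpeeled levN // !arrE.
- move=> y Ay; rewrite levT //; case: ifP => _; first by left.
  by have := lv_lev V Ay; clear -h_gt2; lia.
- move=> y z Ay /eqP; rewrite flE // => Fy C; apply/eqP; rewrite flE.
    by rewrite -(fl_conn y).
  exact: (active_conn clHL Ay C).
- by move=> y Ay; rewrite topE regE; apply: (lv_top V).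
- by move=> y z Ay Az; rewrite !topE; apply: (lv_conn V).
- by move=> y Ay; rewrite topE !arrE //; apply: (lv_att V).
- move=> y Ay /eqP; rewrite flE // => /hasP[x Hx /andP[/eqP Lx /eqP Tx]].
  have Ax := sub _ Hx Lx.
  (* A vertex still at level 0 after level h-1 ends a chain, which is completed to a failing
     path. *)
  have [|R HR] := chain_fail eg_sym _ (lv_chain V Ax Lx).
    by move=> v /eqP E; rewrite /level E; clear -h_gt2; lia.
  exists R; rewrite topE arrE // -Tx; move: HR; rewrite (_ : _.+3 = h); last first.
    by clear -h_gt2; lia.
  move=> /and3P[H1 H2 H3]; apply/and3P; split=> //.
  apply: sub_all H3 => z /andP[Az Tz]; rewrite Az topE Tz flE //= andbT.
  by apply/hasP; exists x => //; rewrite Lx eq_sym Tz.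
- move=> y Ay Ly; have Ls : arr s aLev y = arr u aLev y by apply: lev_pos; clear -Ly; lia.
  have Ly' : 1 < arr s aLev y by rewrite Ls.
  have Fy : ~~ fl y by rewrite -flE //; clear -Ly; lia.
  have hh : h.-1 < h by clear -h_gt2; lia.
  have Hcomp z : conn eg (level p 0) y z -> arr s aLev z <> 0.
    move=> C Lz; have Az := active_conn clHL Ay C.
    by case/negP: Fy; rewrite (fl_conn _ _ Ay C); apply: fl0.
  have [H1 H2] := lv_par V Ay Ly'.
  have lastE z : arr u aLev z = h.-1 -> arr s aLev z = h.-1.
    by move=> Lz; rewrite lev_pos // Lz; clear -h_gt2; lia.
  split; rewrite ?(arrE aPar) ?(arrE aSide) ?(arrE aL0) ?(arrE aL1) //.
  + move=> z yz Lz; apply: (lv_same V Ay Ly' yz).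
    by rewrite Ls -Lz; apply: lev_pos; rewrite Lz; clear -Ly; lia.
  + by rewrite -Ls; apply: (lv_lists V).
  + move=> z yz /lastE L1 /lastE L2; have [+ _ _] := Last _ Ay L1 Hcomp; exact.
  + move=> /lastE L1 Sy; have [_ Hz _] := Last _ Ay L1 Hcomp.
    have [z [yz Lz]] := Hz Sy; exists z; split=> //.
    have Az : active p z.
      by apply: (leveled_active sep V hh Ay yz); rewrite Lz; clear -h_gt2; lia.
    have Cz := active_step Ay Az yz.
    by rewrite levT // -(fl_conn _ _ Ay Cz) (negbTE Fy).
  + move=> h4 /lastE L1; have Lp : arr s aLev (arr s aPar y) = h.-2 by rewrite H2 L1.
    have [_ _ Ha] := Last _ Ay L1 Hcomp.
    have Ap : active p (arr s aPar y).
      by apply: (leveled_active sep V hh Ay H1); rewrite Lp; clear -h4; lia.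
    have Cp := active_step Ay Ap H1.
    split; first by rewrite levT // -(fl_conn _ _ Ay Cp) (negbTE Fy).
    move=> z zy Lz.
    have Lz' : arr s aLev z = h.-2 by rewrite lev_pos // Lz; clear -h4; lia.
    split; first apply: (lv_common V (y := y) Ay) => //.
    * by rewrite eg_sym.
    * by rewrite Lp; clear -h4; lia.
    * by rewrite Lp.
    * by right; rewrite Lp L1; clear -h4; lia.
    * move=> y' yy' /lastE Ly1; apply: Ha yy' Ly1 => //.
      by clear -h4; lia.
- move=> c; rewrite regE => Hc; rewrite failE fail0; last first.
    by have := lv_c V; move: Hc; clear; lia.
  case: ifP => // /hasP[x Hx /andP[/eqP Lx /eqP Tx]].
  have := lv_top V (sub _ Hx Lx); rewrite Tx; move: Hc; clear; lia.
- move=> y Hy Ly; rewrite topE; case Ay: (active p y).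
    have Fy : ~~ fl y by rewrite -flE //; move: Ly; clear; lia.
    rewrite failE -/(fl y) (negbTE Fy) fail0 //; by case/andP: (lv_top V Ay).
  rewrite levN ?Ay // in Ly; have [L _ _ _ [T _]] := lv_out V (negbT Ay).
  rewrite T; rewrite L in Ly; have [F Tle] := ftop _ Hy Ly; rewrite failE F.
  case: ifP => // /hasP[x Hx /andP[/eqP Lx /eqP Tx]].
  by have /andP[] := lv_top V (sub _ Hx Lx); rewrite Tx ltnNge Tle.
Qed.

End Component.
End Graph.


(** * The picks inside a round *)

Section Graph.

Variables (n : nat) (nb : nat -> seq nat).
Hypothesis nb_lt : forall x y, y \in nb x -> (x < n) && (y < n).
Hypothesis nb_sym : forall x y, (y \in nb x) = (x \in nb y).
Hypothesis nb_irr : forall x, x \notin nb x.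
Hypothesis nb_uniq : forall x, uniq (nb x).

Notation eg := (edge nb).
Notation vl := (vol nb).
Let eg_sym := edge_sym nb_sym.

Section Component.

Variables (h : nat) (HL : seq nat).
Hypothesis uHL : uniq HL.
Hypothesis ltHL : forall x, x \in HL -> x < n.
Hypothesis clHL : forall x y, x \in HL -> eg x y -> y \in HL.
Variable c3 : nat -> nat.
Hypothesis c3_range : forall x, 0 < c3 x <= 3.
Hypothesis c3_proper : forall x y, eg x y -> c3 x != c3 y.
Hypothesis h_gt2 : 2 < h.

Notation active := (active HL).
Definition parked (s : state) : pred nat := fun y => (y \in HL) && level s h y.

(** The invariant restored by every pass and every round. Through [zo_sep], unfinished vertices
    never touch a finished level, so equal levels of different passes may share their colors. *)
Record zone (S : seq nat) (s : state) : Prop := Zone {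
  zo_graph : repr_graph n nb s;
  zo_HL : repr_list aHL rHN s HL;
  zo_S : repr_list aS rSn s S;
  zo_cid : forall y, arr s aCid y <= reg s rC;
  zo_seen : forall y, arr s aSeen y <= reg s rC;
  zo_fail : forall c, reg s rC < c -> arr s aFail c = 0;
  zo_park : forall c, reg s rC < c -> arr s aPark c = 0;
  zo_failtop : forall y, y \in HL -> 1 < arr s aLev y < h ->
    arr s aFail (arr s aTop y) = 0 /\ arr s aTop y <= reg s rC;
  zo_lev : forall y, y \in HL -> arr s aLev y <= h.+1;
  zo_sep : forall y z, y \in HL -> arr s aLev y = 0 \/ arr s aLev y = h -> eg y z ->
    ~~ (1 < arr s aLev z < h);
  zo_settled : forall y, y \in HL -> 1 < arr s aLev y < h -> settled nb h s y;
  zo_old : forall y, y \in HL -> arr s aLev y = 1 \/ arr s aLev y = h.+1 ->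
    arr s aPar y \in S /\ if y \in S then arr s aPar y = y else eg y (arr s aPar y);
  zo_pick : forall v, v \in S -> v \in HL /\ arr s aLev v = h.+1
}.

(* The vertices [Kp] have been picked so far in a round that started with the
   set [U] and with the vertices [K] of the round before. *)
Record progress (U : pred nat) (K Kp : seq nat) (R : nat -> seq nat) (s : state) :
    Prop := Progress {
  pg_act : forall y, active s y -> rest eg U K y;
  pg_park : forall y, parked s y -> rest eg U K y;
  pg_actcl : forall y z, active s y -> conn eg (rest eg U K) y z -> active s z;
  pg_parkcl : forall y z, parked s y -> conn eg (rest eg U K) y z -> parked s z;
  pg_cur : forall v, v \in HL -> arr s aLev v = 1 -> layer eg U K v /\
    forall b, b \in Kp -> forall x y, x \in R b -> conn eg (rest eg U K) x y ->
      ~~ eg v y;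
  pg_uniq : uniq Kp;
  pg_pick : forall b, b \in Kp -> layer eg U K b /\
    fail_path eg h b (parked s) (R b);
  pg_mut : forall b b', b \in Kp -> b' \in Kp -> b != b' ->
    forall x y, x \in R b -> conn eg (rest eg U K) x y -> ~~ eg b' y;
  pg_hit : forall x, parked s x -> exists b y,
    [/\ b \in Kp, conn eg (rest eg U K) x y & eg b y];
  pg_nohit : forall y b, active s y -> b \in Kp -> ~~ eg b y;
  pg_att : attached nb HL s
}.

(** Being settled depends only on the data of the vertex and of its neighbors in the levels 2, ...,
    h-1; it survives every change elsewhere ([settled_stable]). *)
Definition stable (s s' : state) (z : nat) : Prop :=
  1 < arr s aLev z < h \/ 1 < arr s' aLev z < h ->
  [/\ arr s' aLev z = arr s aLev z, arr s' aPar z = arr s aPar z,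
      arr s' aL0 z = arr s aL0 z, arr s' aL1 z = arr s aL1 z
    & arr s' aSide z = arr s aSide z].

Lemma settled_stable s s' y : 1 < arr s aLev y < h -> stable s s' y ->
  (forall z, eg y z -> stable s s' z) -> settled nb h s y -> settled nb h s' y.
Proof.
move=> Ly Sy Sz [H1 H2 H3 H4 H5 H6].
have [E1 E2 E3 E4 E5] := Sy (or_introl Ly).
have st z : eg y z -> 1 < arr s' aLev z < h -> 
    [/\ arr s' aLev z = arr s aLev z, arr s' aPar z = arr s aPar z
      & arr s' aSide z = arr s aSide z].
  by move=> yz Lz; have [-> -> _ _ ->] := Sz z yz (or_intror Lz).
have st' z : eg y z -> 1 < arr s aLev z < h -> 
    [/\ arr s' aLev z = arr s aLev z, arr s' aPar z = arr s aPar z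
      & arr s' aSide z = arr s aSide z].
  by move=> yz Lz; have [-> -> _ _ ->] := Sz z yz (or_introl Lz).
have h1 : 1 < h.-1 < h by clear -h_gt2; lia.
split; rewrite ?E1 ?E2 ?E3 ?E4 ?E5 //.
- move=> z yz Lz; have [|L P _] := st z yz; first by rewrite Lz.
  by rewrite P; apply: H2; rewrite -?L.
- move=> z yz Ly1 Lz; have [|L _ Sd] := st z yz; first by rewrite Lz.
  by rewrite Sd; apply: H4; rewrite -?L.
- move=> Ly1 Sd; have [z [yz Lz]] := H5 Ly1 Sd; exists z; split=> //.
  by have [|-> _ _] := st' z yz; rewrite Lz.
- move=> h4 Ly1; have [Lp Hz] := H6 h4 Ly1.
  have h2 : 1 < h.-2 < h by clear -h4; lia.
  have [|Lp' Pp _] := st' _ H1; first by rewrite Lp.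
  rewrite Lp' Lp Pp; split=> // z zy Lz.
  have [||L P _] := st z; [by rewrite eg_sym|by rewrite Lz|].
  have [|Pz Hy'] := Hz z zy; first by rewrite -L.
  rewrite P Pz; split=> // y' yy' Ly'; apply: (Hy' _ yy').
  by have [|<- _ _] := st y' yy'; rewrite Ly'.
Qed.

Lemma active_conn_rest U K Kp R s y z : progress U K Kp R s -> active s y ->
  (conn eg (level s 0) y z <-> conn eg (rest eg U K) y z).
Proof.
move=> P Ay; split=> C.
  apply: (conn_ind (P := fun b => conn eg (rest eg U K) y b) _ _ C).
    by apply: conn_refl; apply: (pg_act P).
  move=> a b Ca Ca' Lb ab; apply: (conn_trans Ca'); apply: conn_step => //.
    exact: conn_memr Ca'.
  have Aa := active_conn clHL Ay Ca.
  by apply: (pg_act P); rewrite /active (clHL _ ab) //; case/andP: Aa.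
apply: (conn_ind (P := fun b => conn eg (level s 0) y b) _ _ C).
  by apply: conn_refl; case/andP: Ay.
move=> a b Ca Ca' Lb ab; apply: (conn_trans Ca'); apply: conn_step => //.
  exact: conn_memr Ca'.
suff /andP[] : active s b by [].
apply: (pg_actcl P Ay); apply: (conn_trans Ca); apply: conn_step => //.
exact: conn_memr Ca.
Qed.

(* The state after [sift] and [choose_best] has no failing component. *)
Lemma progress_done S U K Kp R p u : zone S p -> progress U K Kp R p ->
  sifted nb h HL p u -> (forall x, x \in HL -> arr u aLev x != 0) ->
  progress U K Kp R u /\ forall y, ~~ active u y.
Proof.
move=> Z P Si N0.
have Nact y : ~~ active u y.
  by apply/negP => /andP[Hy Ly]; have := N0 _ Hy; rewrite -/(level u 0 y) Ly.
have parkE y : parked u y = parked p y.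
  rewrite /parked; case Hy: (y \in HL) => //=; rewrite /level.
  case Ay: (active p y); last by have [-> _ _ _ _] := si_out Si (negbT Ay).
  have /andP[_ /eqP ->] := Ay; have := si_lev Si Ay.
  by case=> [->//|]; case: eqP; case: eqP => //; clear -h_gt2; lia.
split=> //; split.
- by move=> y Ay; have := Nact y; rewrite Ay.
- by move=> y; rewrite parkE; apply: (pg_park P).
- by move=> y z Ay; have := Nact y; rewrite Ay.
- by move=> y z; rewrite !parkE; apply: (pg_parkcl P).
- move=> v Hv Lv; apply: (pg_cur P) => //; case Av: (active p v).
    by have := si_lev Si Av; rewrite Lv; clear; lia.
  by have [<- _ _ _ _] := si_out Si (negbT Av).
- exact: (pg_uniq P).
- move=> b /(pg_pick P)[H1 /and3P[H2 H3 H4]]; split=> //; apply/and3P; split=> //.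
  by apply: sub_all H4 => z; rewrite parkE.
- exact: (pg_mut P).
- by move=> x; rewrite parkE; apply: (pg_hit P).
- by move=> y b Ay; have := Nact y; rewrite Ay.
- by move=> y Ay; have := Nact y; rewrite Ay.
Qed.

Lemma zone_sifted S U K Kp R p u : zone S p -> progress U K Kp R p ->
  sifted nb h HL p u ->
  repr_graph n nb u -> repr_list aHL rHN u HL -> repr_list aS rSn u S ->
  arr u aPark = arr p aPark -> zone S u.
Proof.
move=> Z P Si Hg HHL HS EP.
have nbr y z : active p y -> eg y z -> ~~ (1 < arr p aLev z < h).
  move=> /andP[Hy /eqP Ly] yz; apply: (zo_sep Z Hy _ yz); by left.
have nolab y z : y \in HL -> 1 < arr p aLev y < h -> eg y z -> ~~ active p z.
  move=> Hy Ly; rewrite eg_sym => zy; apply/negP => Az.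
  by have := nbr z y Az zy; rewrite Ly.
split=> //.
- exact: (si_cid Si).
- exact: (si_seen Si).
- exact: (si_failed Si).
- by move=> c Hc; rewrite EP; apply: (zo_park Z); apply: leq_ltn_trans Hc; apply: (si_c Si).
- move=> y Hy Ly; split; first exact: (si_failed_top Si).
  case Ay: (active p y); first by case/andP: (si_top Si Ay).
  have [L _ _ _ [-> _]] := si_out Si (negbT Ay); rewrite L in Ly.
  by have [_ H] := zo_failtop Z Hy Ly; apply: leq_trans H (si_c Si).
- move=> y Hy; case Ay: (active p y); last first.
    by have [-> _ _ _ _] := si_out Si (negbT Ay); apply: (zo_lev Z).
  by have := si_lev Si Ay; clear; lia.
- move=> y z Hy Ly yz; case Az: (active p z); last first.
    have [-> _ _ _ _] := si_out Si (negbT Az).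
    case Ay: (active p y); first exact: nbr Ay yz.
    by have [L _ _ _ _] := si_out Si (negbT Ay); rewrite L in Ly; apply: (zo_sep Z Hy Ly).
  case Ay: (active p y).
    have L0 : arr u aLev y = 0 by have := si_lev Si Ay; move: Ly; clear; lia.
    by rewrite (si_closed Si Ay L0 (active_step Ay Az yz)).
  have [L _ _ _ _] := si_out Si (negbT Ay); rewrite L in Ly.
  case: Ly => Ly; first by move: Ay; rewrite /active Hy /level Ly.
  have Py : parked p y by rewrite /parked Hy /level Ly eqxx.
  have : parked p z.
    apply: (pg_parkcl P Py); apply: conn_step => //; first exact: (pg_park P).
    exact: (pg_act P).
  case/andP: Az => _ /eqP Lz; rewrite /parked /level Lz => /andP[_ /eqP].
  by clear -h_gt2; lia.
- move=> y Hy Ly; case Ay: (active p y).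
    by apply: (si_settled Si) => //; case/andP: Ly.
  have O := si_out Si (negbT Ay); have [L _ _ _ _] := O; rewrite L in Ly.
  have st z : ~~ active p z -> stable p u z.
    by move=> Nz _; have [? ? ? ? [? ?]] := si_out Si Nz; split.
  apply: (settled_stable Ly) (zo_settled Z Hy Ly); first by apply: st; rewrite Ay.
  by move=> z yz; apply: st; apply: nolab yz.
- move=> y Hy Ly; case Ay: (active p y).
    by have := si_lev Si Ay; move: Ly; clear -h_gt2; lia.
  have [L Pa _ _ _] := si_out Si (negbT Ay); rewrite Pa; apply: (zo_old Z) => //.
  by rewrite -L.
- move=> v /(zo_pick Z)[Hv Lv]; split=> //; case Av: (active p v).
    by case/andP: Av => _ /eqP; rewrite Lv.
  by have [-> _ _ _ _] := si_out Si (negbT Av).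
Qed.

Definition hits (u : state) (a y : nat) : bool :=
  has (fun x => (arr u aLev x == 0) && (arr u aTop x == arr u aTop y)) (nb a).

Definition faces (u : state) (d y : nat) : bool :=
  has (fun x => [&& arr u aLev x == 0, arr u aTop x == arr u aTop d & eg x y]) HL.

Record picked (S : seq nat) (u : state) (d a : nat) (s : state) : Prop := Picked {
  pk_graph : repr_graph n nb s;
  pk_HL : repr_list aHL rHN s HL;
  pk_S : repr_list aS rSn s (rcons S a);
  pk_c : reg s rC = reg u rC;
  pk_arr : forall b, b \notin [:: aLev; aPar; aS; aPark] -> arr s b = arr u b;
  pk_par : forall y, arr s aPar y = if y == a then a else arr u aPar y;
  pk_park : forall c, reg u rC < c -> arr s aPark c = 0;
  pk_lev : forall y, arr s aLev y =
    if active u y then (if hits u a y then h else 0)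
    else if (arr u aLev y == 1) && faces u d y then h.+1 else arr u aLev y
}.

Lemma pick_ok S u d a : zone S u -> reg u rBest = arr u aTop d ->
  arr u aAtt (arr u aTop d) = a -> a \in HL ->
  (forall y, y \in HL -> arr u aLev y = 0 -> arr u aTop y <= reg u rC /\
     arr u aPark (arr u aTop y) = 0) ->
  wpb (pick h) u (300 * vl HL) (picked S u d a).
Proof.
move=> Z Hb Ha aHL0 Hp.
have szv : (size (nb a)).+1 <= vl HL.
  rewrite /vol (perm_big _ (perm_to_rem aHL0)) big_cons; apply: leq_addr.
apply: (@wpb_seq _ _ _ 30 (300 * vl HL - 30) _ (fun s1 =>
   [/\ repr_graph n nb s1, repr_list aHL rHN s1 HL & repr_list aS rSn s1 (rcons S a)] /\
   [/\ reg s1 rA = a, reg s1 rBest = arr u aTop d, reg s1 rC = reg u rC,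
      forall b, b \notin [:: aPar; aS] -> arr s1 b = arr u b
    & forall y, arr s1 aPar y = if y == a then a else arr u aPar y])); last 1 first.
- move: szv; clear; lia.
- apply: wpb_den => //; rewrite /= /upd /= Hb Ha; split=> //.
    split; [exact: repr_graph_eq (zo_graph Z)|exact: (zo_HL Z)|].
    by apply: (repr_list_rcons (zo_S Z)).
  split=> // b0; rewrite !inE !negb_or /= => /andP[/negbTE H1 /negbTE H2].
  by rewrite /upd H1 H2.
move=> s1 _ [[g1 HL1 S1] [A1 B1 C1 E1 P1]].
have L1 : arr s1 aLev = arr u aLev by apply: E1.
have T1 : arr s1 aTop = arr u aTop by apply: E1.
apply: (wpb_seq (b2 := 120 * vl HL) (forbid_ok h uHL ltHL g1 HL1 B1)); last first.
  by move: szv; clear; lia.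
move=> s2 S2 L2; rewrite /= in S2.
have A2 : reg s2 rA = a by case: S2 => ->.
have arr2 b0 : b0 != aLev -> arr s2 b0 = arr s1 b0.
  by case: S2 => _ H Hb0; apply: H; rewrite inE.
have g2 : repr_graph n nb s2 by apply: repr_graph_same S2 g1.
have lev2 x : (arr s2 aLev x == 0) = (arr u aLev x == 0).
  by rewrite L2 L1; case: ifP => // /andP[/eqP ->].
apply: (wpb_seq (b2 := 40 * vl HL + 6) (mark_hit_ok uHL g2 A2 (ltHL aHL0))); last first.
  by move: szv; clear; lia.
move=> s3 S3 Pk3; rewrite /= in S3.
have arr3 b0 : b0 != aPark -> arr s3 b0 = arr s2 b0.
  by case: S3 => _ H Hb0; apply: H; rewrite inE.
have HL3 : repr_list aHL rHN s3 HL.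
  case: HL1 => H1 H2; split=> [|i Hi]; first by case: S3 => -> //; case: S2 => ->.
  by rewrite arr3 // arr2 // H2.
apply: (wpb_cons (set_aside_ok nb h uHL HL3) (leqnn _)).
move=> s4 S4 L4; rewrite /= in S4.
have arr4 b0 : b0 != aLev -> arr s4 b0 = arr s3 b0.
  by case: S4 => _ H Hb0; apply: H; rewrite inE.
have T3 : arr s3 aTop = arr u aTop by rewrite arr3 // arr2 // T1.
have lev3 x : arr s3 aLev x = arr s2 aLev x by rewrite arr3.
have T2 : arr s2 aTop = arr u aTop by rewrite arr2.
have Pk2 : arr s2 aPark = arr u aPark by rewrite arr2 // E1.
split.
- by apply: (@repr_graph_eq n nb s1); rewrite ?arr4 ?arr3 ?arr2.
- by case: HL3 => H1 H2; split=> [|i Hi]; [case: S4 => ->|rewrite arr4 ?H2].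
- case: S1 => H1 H2; split=> [|i Hi]; last by rewrite arr4 // arr3 // arr2 // H2.
  by case: S4 => -> //; case: S3 => -> //; case: S2 => ->.
- by case: S4 => -> //; case: S3 => -> //; case: S2 => ->.
- move=> b0; rewrite !inE !negb_or => /and4P[H1 H2 H3 H4].
  by rewrite arr4 // arr3 // arr2 // E1 // !inE negb_or H2 H3.
- by move=> y; rewrite arr4 // arr3 // arr2 // P1.
- move=> c Hc; rewrite arr4 // Pk3 Pk2; case: ifP => [|_]; last exact: (zo_park Z).
  case/hasP => x xa /andP[]; rewrite lev2 T2 => /eqP Lx /eqP Tx.
  have xHL : x \in HL by apply: clHL aHL0 xa.
  by have [] := Hp x xHL Lx; rewrite Tx leqNgt Hc.
- move=> y; rewrite L4 lev3 T3 lev2 /active /level.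
  case yHL: (y \in HL) => /=; last by rewrite L2 L1 /faces T1.
  case: (eqVneq (arr u aLev y) 0) => Ly /=; last by rewrite L2 L1 /faces T1.
  have [_ Hpk] := Hp y yHL Ly; rewrite Pk3 Pk2 Hpk.
  rewrite (_ : has _ _ = hits u a y); last by apply: eq_has => x; rewrite lev2 T2.
  by case: (hits u a y) => //=; rewrite L2 L1 Ly.
Qed.

Section Pick.

Variables (U : pred nat) (K Kp S : seq nat) (R : nat -> seq nat).
Variables (p u s : state) (d a : nat) (Ra : seq nat).
Hypothesis Zp : zone S p.
Hypothesis Pp : progress U K Kp R p.
Hypothesis Si : sifted nb h HL p u.
Hypothesis Zu : zone S u.
Hypothesis dHL : d \in HL.
Hypothesis Ld : arr u aLev d = 0.
Hypothesis Hmin : forall x, x \in HL -> arr u aLev x = 0 ->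
  arr u aAcnt (arr u aTop d) <= arr u aAcnt (arr u aTop x).
Hypothesis Ha : arr u aAtt (arr u aTop d) = a.
Hypothesis Pk : picked S u d a s.

Let act0 y : y \in HL -> arr u aLev y = 0 -> active p y.
Proof.
move=> Hy Ly; apply/negPn/negP => Ny; have [L _ _ _ _] := si_out Si Ny.
by case/negP: Ny; rewrite /active Hy /level -L Ly.
Qed.

Let actE y : active u y -> active p y.
Proof. by case/andP=> Hy /eqP Ly; apply: act0. Qed.

Let connE y z : active p y ->
  (conn eg (level p 0) y z <-> conn eg (rest eg U K) y z).
Proof. exact: active_conn_rest Pp. Qed.

Let topE y z : active p y -> active p z ->
  (arr u aTop y == arr u aTop z) <-> conn eg (rest eg U K) y z.
Proof.
move=> Ay Az; rewrite -connE // -(si_conn Si Ay Az); split; first by move/eqP.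
by move=> ->.
Qed.

Let act_conn y z : active u y -> conn eg (rest eg U K) y z -> active u z.
Proof.
move=> Uy C; have Ay := actE Uy; case/andP: (Uy) => Hy /eqP Ly.
have C' : conn eg (level p 0) y z by apply/connE.
have Az := active_conn clHL Ay C'.
by case/andP: Az => Hz _; rewrite /active Hz /level (si_closed Si Ay Ly C').
Qed.

Let Ud : active u d. Proof. by rewrite /active dHL /level Ld. Qed.

Let att_d : exists AL, [/\ uniq AL,
     arr u aAcnt (arr u aTop d) = size AL, a \in AL
     & forall v, v \in AL <->
         level p 1 v /\ exists z, conn eg (rest eg U K) d z /\ eg v z].
Proof.
have [AL [H1 H2 H3 H4]] := si_att Si (actE Ud); exists AL; split=> //.
  by rewrite -Ha.
move=> v; rewrite H4; split=> [[H [z [C vz]]]|[H [z [C vz]]]]; split=> //;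
  exists z; split=> //; exact/connE/C/actE.
Qed.

Let a_lev : arr p aLev a = 1.
Proof. by have [AL [_ _ /[swap] H /H[/eqP]]] := att_d. Qed.

Let a_nact : ~~ active p a.
Proof. by rewrite /active /level a_lev andbF. Qed.

Let a_levu : arr u aLev a = 1.
Proof. by have [-> _ _ _ _] := si_out Si a_nact. Qed.

Let a_adj : exists z, conn eg (rest eg U K) d z /\ eg a z.
Proof. by have [AL [_ _ /[swap] H /H[_]]] := att_d. Qed.

Lemma picked_HL : a \in HL.
Proof.
have [z [C az]] := a_adj; apply: (clHL (x := z)); last by rewrite eg_sym.
exact: (conn_HL clHL dHL C).
Qed.

Let facesP y : faces u d y <-> exists z, conn eg (rest eg U K) d z /\ eg y z.
Proof.
split=> [/hasP[x Hx /and3P[/eqP Lx /eqP Tx xy]]|[z [C yz]]].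
  exists x; rewrite eg_sym; split=> //; apply/(topE (actE Ud)); first exact: act0.
  by rewrite Tx.
have Uz := act_conn Ud C; have Tz : arr u aTop z == arr u aTop d.
  by apply/(topE (actE Uz) (actE Ud)); apply: conn_sym.
case/andP: Uz => Hz Lz; apply/hasP; exists z => //.
by rewrite Tz eg_sym yz !andbT.
Qed.

Let hitsP y : active u y -> hits u a y <-> exists z, conn eg (rest eg U K) y z /\ eg a z.
Proof.
move=> Uy; split=> [/hasP[x ax /andP[/eqP Lx Tx]]|[z [C az]]].
  have Hx : x \in HL by apply: clHL picked_HL ax.
  exists x; split=> //; apply: conn_sym => //.
  by apply/(topE (act0 Hx Lx) (actE Uy)).
have Uz := act_conn Uy C; apply/hasP; exists z => //.
case/andP: (Uz) => _ Lz; rewrite -/(level u 0 z) Lz /=.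
by apply/(topE (actE Uz) (actE Uy)); apply: conn_sym.
Qed.

Let parku y : parked p y -> parked u y.
Proof.
move=> Py; case/andP: (Py) => Hy /eqP Ly.
have Ny : ~~ active p y.
  by rewrite /active /level Ly; apply/negP => /andP[_ /eqP]; clear -h_gt2; lia.
by rewrite /parked Hy /level; have [-> _ _ _ _] := si_out Si Ny; rewrite Ly eqxx.
Qed.

Let act_s y : active s y <-> active u y /\ ~~ hits u a y.
Proof.
rewrite {1}/active /level (pk_lev Pk).
case Uy: (active u y); last first.
  split=> [/andP[Hy]|[//]]; case: ifP => // _ L0.
  by move: Uy; rewrite /active Hy /level L0.
have /andP[-> _] := Uy; rewrite /=.
case: ifP => _; split=> //; last by case.
by move=> /eqP; clear -h_gt2; lia.
Qed.

Let park_s y : parked s y <-> parked p y \/ active u y /\ hits u a y.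
Proof.
rewrite {1}/parked /level (pk_lev Pk); case Uy: (active u y).
  have /andP[Hy /eqP Ly] := Uy; rewrite Hy /=; case: ifP => Hh.
    by rewrite eqxx; split=> // _; right.
  split=> [/eqP|]; first by clear -h_gt2; lia.
  case=> [|[]//] /parku; rewrite /parked Hy /level Ly => /eqP; clear -h_gt2; lia.
split=> [/andP[Hy]|[Py|[//]]].
  case: ifP => [_ /eqP|_ Lh]; first by clear; lia.
  left; rewrite /parked Hy /level; case Ay: (active p y); last first.
    by have [<- _ _ _ _] := si_out Si (negbT Ay).
  by have := si_lev Si Ay; move/eqP: Lh; clear -h_gt2; lia.
have /andP[Hy /eqP Ly] := parku Py; rewrite Hy Ly.
have -> : (h == 1) = false by clear -h_gt2; lia.
by rewrite /= eqxx.
Qed.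

Let conn_hits y z : active u y -> conn eg (rest eg U K) y z -> hits u a y = hits u a z.
Proof.
move=> Uy C; have Uz := act_conn Uy C; apply/idP/idP => [/(hitsP Uy)|/(hitsP Uz)] [x [Cx ax]].
  by apply/(hitsP Uz); exists x; split=> //; apply: conn_trans Cx; apply: conn_sym.
by apply/(hitsP Uy); exists x; split=> //; apply: conn_trans Cx.
Qed.

Hypothesis HRa : fail_path eg h a
   (fun z => (active p z && (arr u aLev z == 0)) && (arr u aTop z == arr u aTop d)) Ra.

Let Ra_conn x : x \in Ra -> active u x /\ conn eg (rest eg U K) d x.
Proof.
case/and3P: HRa => _ _ /allP H /H /andP[/andP[Ax Lx] Tx]; split.
  by case/andP: Ax => Hx _; rewrite /active Hx.
by apply: conn_sym => //; apply/(topE Ax (actE Ud)).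
Qed.

Let a_Kp : a \notin Kp.
Proof.
apply/negP => aK; have [z [C az]] := a_adj.
by have := pg_nohit Pp (actE (act_conn Ud C)) aK; rewrite az.
Qed.

(** The failing paths of different picks stay apart in both directions: barred vertices are never
    picked later, and a component seen by an earlier pick is parked and no longer active. The
    delicate point is that each remaining component keeps an attacher of level 1. *)
Lemma progress_pick :
  progress U K (rcons Kp a) (fun b => if b == a then Ra else R b) s.
Proof.
have KpN b : b \in Kp -> (b == a) = false.
  by move=> Hb; apply/negP => /eqP E; move: a_Kp; rewrite -E Hb.
have [La Hcur] := pg_cur Pp picked_HL a_lev.
split.
- by move=> y /act_s[Uy _]; apply: (pg_act Pp); apply: actE.
- by move=> y /park_s[/(pg_park Pp)|[/actE/(pg_act Pp)]].
- move=> y z /act_s[Uy Ny] C; apply/act_s; split; first exact: act_conn Uy C.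
  by rewrite -(conn_hits Uy C).
- move=> y z /park_s[Py|[Uy Hy]] C; apply/park_s; first by left; apply: (pg_parkcl Pp Py).
  by right; split; [apply: act_conn Uy C|rewrite -(conn_hits Uy C)].
- move=> v Hv; rewrite (pk_lev Pk); case: ifP => Uv.
    by case: ifP => _; clear -h_gt2; lia.
  case: ifP => [_|Nf Lv]; first by clear -h_gt2; lia.
  have Lvp : arr p aLev v = 1.
    case Av: (active p v); first by have := si_lev Si Av; rewrite Lv; clear; lia.
    by have [<- _ _ _ _] := si_out Si (negbT Av).
  have [H1 H2] := pg_cur Pp Hv Lvp; split=> // b.
  rewrite mem_rcons inE => /orP[/eqP->|Hb]; last by rewrite KpN //; apply: H2.
  rewrite eqxx => x y /Ra_conn[Ux Cx] Cy; apply/negP => vy.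
  move: Nf; rewrite Lv /= => /negP; apply; apply/facesP; exists y; split=> //.
  exact: conn_trans Cy.
- by rewrite rcons_uniq a_Kp (pg_uniq Pp).
- move=> b; rewrite mem_rcons inE => /orP[/eqP->|Hb].
    split=> //; rewrite eqxx; case/and3P: HRa => H1 H2 H3; apply/and3P; split=> //.
    apply/allP => x /Ra_conn[Ux Cx]; apply/park_s; right; split=> //.
    apply/(hitsP Ux); have [z [Cz az]] := a_adj; exists z; split=> //.
    by apply: conn_trans Cz; apply: conn_sym.
  rewrite KpN //; have [H0 /and3P[H1 H2 H3]] := pg_pick Pp Hb.
  split=> //; apply/and3P; split=> //; apply: sub_all H3 => z Pz.
  by apply/park_s; left.
- move=> b b'; rewrite !mem_rcons !inE => /orP[/eqP->|Hb] /orP[/eqP->|Hb'].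
  + by rewrite eqxx.
  + rewrite eqxx => _ x y /Ra_conn[Ux Cx] Cy.
    by apply: (pg_nohit Pp) Hb'; apply: actE; apply: act_conn Cy.
  + by rewrite KpN // => _ x y Hx Cy; apply: (Hcur _ Hb _ _ Hx Cy).
  + by rewrite KpN //; apply: (pg_mut Pp).
- move=> x /park_s[Px|[Ux /(hitsP Ux)[z [Cz az]]]].
    have [b [y [Hb Cy by_]]] := pg_hit Pp Px; exists b, y; split=> //.
    by rewrite mem_rcons inE Hb orbT.
  by exists a, z; split=> //; rewrite mem_rcons mem_head.
- move=> y b /act_s[Uy Ny]; rewrite mem_rcons inE => /orP[/eqP->|Hb].
    apply: contra Ny => ay; apply/(hitsP Uy); exists y; split=> //.
    by apply: conn_refl; apply: (pg_act Pp); apply: actE.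
  by apply: (pg_nohit Pp) Hb; apply: actE.
- move=> y /act_s[Uy Ny]; have [ALd [ud sd ad Hd]] := att_d.
  have [ALy [uy sy _ Hy]] := si_att Si (actE Uy).
  have a_ALy : a \notin ALy.
    apply: contra Ny => /Hy[_ [z [C az]]]; apply/(hitsP Uy); exists z; split=> //.
    by apply/(connE _ (actE Uy)).
  (* The component of [d] has the fewest attachers, and [a] is one of them but does not attach to
     the component of [y]. So the attachers of the latter are not all among those of [d], and one
     escapes the barring. *)
  have [v vy vd] : exists2 v, v \in ALy & v \notin ALd.
    apply/hasP; apply/negPn/negP => /hasPn H.
    have : size (a :: ALy) <= size ALd.
      apply: uniq_leq_size; first by rewrite /= a_ALy.
      by move=> v; rewrite inE => /orP[/eqP->//|/H]; rewrite negbK.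
    by move: Uy => /andP[yHL /eqP Ly]; rewrite /= -sd -sy ltnNge Hmin.
  have [Lv [z [C vz]]] := (Hy v).1 vy; exists v, z.
  have C' : conn eg (rest eg U K) y z by apply/(connE _ (actE Uy)).
  split=> //.
    have Nv : ~~ active p v by rewrite /active /level (eqP Lv) andbF.
    have Lvu : arr u aLev v = 1 by have [-> _ _ _ _] := si_out Si Nv; apply/eqP.
    rewrite /level (pk_lev Pk) /active /level Lvu andbF /=.
    case: ifP => // /facesP[z' [Cz' vz']]; case/negP: vd; apply/Hd; split=> //.
    by exists z'.
  apply: (conn_ind (P := fun b => conn eg (level s 0) y b) _ _ C').
    have : active s y by apply/act_s.
    by case/andP => _ Ly; apply: conn_refl.
  move=> b b' Cb Cb' Wb' bb'; apply: (conn_trans Cb'); apply: conn_step => //.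
    exact: conn_memr Cb'.
  have Cyb' : conn eg (rest eg U K) y b'.
    by apply: (conn_trans Cb); apply: conn_step => //; apply: conn_memr Cb.
  suff /andP[] : active s b' by [].
  by apply/act_s; split; [apply: act_conn Cyb'|rewrite -(conn_hits Uy Cyb')].
Qed.

Lemma zone_pick : zone (rcons S a) s.
Proof.
have arrs b : b \notin [:: aLev; aPar; aS; aPark] -> arr s b = arr u b.
  by apply: (pk_arr Pk).
have levs y : 1 < arr s aLev y < h -> arr s aLev y = arr u aLev y.
  rewrite (pk_lev Pk); do 3?case: ifP => //; clear -h_gt2; lia.
have levu y : 1 < arr u aLev y < h -> arr s aLev y = arr u aLev y.
  rewrite (pk_lev Pk); case: ifP => [/andP[_ /eqP->] //|_].
  by case: ifP => // /andP[/eqP-> _]; clear; lia.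
have para y : y != a -> arr s aPar y = arr u aPar y by rewrite (pk_par Pk) => /negbTE->.
have st y : stable u s y.
  have Lq : 1 < arr u aLev y < h \/ 1 < arr s aLev y < h -> 1 < arr u aLev y < h.
    by case=> // H; rewrite -(levs _ H).
  move=> /Lq Ly; rewrite (levu _ Ly) para ?arrs //.
  by apply: contraTneq Ly => ->; rewrite a_levu.
split.
- exact: (pk_graph Pk).
- exact: (pk_HL Pk).
- exact: (pk_S Pk).
- by move=> y; rewrite arrs // (pk_c Pk); apply: (zo_cid Zu).
- by move=> y; rewrite arrs // (pk_c Pk); apply: (zo_seen Zu).
- by move=> c; rewrite arrs // (pk_c Pk); apply: (zo_fail Zu).
- by move=> c; rewrite (pk_c Pk); apply: (pk_park Pk).
- move=> y Hy Ly; rewrite !arrs // (pk_c Pk); apply: (zo_failtop Zu) => //.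
  by rewrite -levs.
- move=> y Hy; have := zo_lev Zu Hy; rewrite (pk_lev Pk).
  by do 3?case: ifP => //; clear; lia.
- move=> y z Hy Ly yz; apply/negP => Lz; have Lz' := Lz; rewrite levs // in Lz'.
  have Ly' : arr u aLev y = 0 \/ arr u aLev y = h.
    move: Ly; rewrite (pk_lev Pk); case: ifP => [/andP[_ /eqP->]|_]; first by left.
    by case: ifP => // _; clear -h_gt2; lia.
  by have := zo_sep Zu Hy Ly' yz; rewrite Lz'.
- move=> y Hy Ly; have Ly' := Ly; rewrite levs // in Ly'.
  by apply: (settled_stable Ly' _ _ (zo_settled Zu Hy Ly')).
- move=> y Hy Ly; rewrite (pk_par Pk); case: eqVneq => [->|Nya].
    by rewrite mem_rcons mem_head.
  have Ly' : arr u aLev y = 1 \/ arr u aLev y = h.+1.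
    move: Ly; rewrite (pk_lev Pk); case: ifP => _; first by case: ifP => _; clear -h_gt2; lia.
    by case: ifP => // /andP[/eqP-> _] _; left.
  have [H1 H2] := zo_old Zu Hy Ly'; rewrite !mem_rcons !inE (negbTE Nya) H1 orbT.
  by split.
- move=> v; rewrite mem_rcons inE => /orP[/eqP->|/(zo_pick Zu)[Hv Lv]].
    split; first exact: picked_HL.
    rewrite (pk_lev Pk) {1}/active /level a_levu andbF /=.
    by have /facesP-> := a_adj.
  split=> //; rewrite (pk_lev Pk) /active /level Lv andbF /=.
  by case: ifP => // /andP[/eqP].
Qed.

End Pick.

Lemma vol_gt0 : 0 < size HL -> 0 < vl HL.
Proof. by case: (HL) => // x l _; rewrite /vol big_cons addSn. Qed.

Lemma pass_ok S U K Kp R p : 0 < size HL ->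
  zone S p -> progress U K Kp R p ->
  wpb (pass h) p (1000 * h * vl HL) (fun s => exists Kn Rn,
    [/\ zone (S ++ Kn) s, progress U K (Kp ++ Kn) Rn s,
        forall y, y \notin HL -> arr s aLev y = arr p aLev y
      & (Kn = [::] /\ forall y, ~~ active s y) \/
        (size Kn = 1 /\ exists d, active p d)]).
Proof.
move=> sHL Z P; have v0 := vol_gt0 sHL.
have kh : (h - 3).+2 < h by clear -h_gt2; lia.
have hE : (h - 3).+2 = h.-1 by clear -h_gt2; lia.
have sep : separated nb h HL p.
  by move=> y z /andP[Hy /eqP Ly]; apply: (zo_sep Z Hy); left.
have cost1 : (h - 3).+1 * (600 * vl HL + 20) <= 620 * h * vl HL.
  rewrite -mulnA mulnCA leq_mul //; first by clear -h_gt2; lia.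
  by move: v0; clear; lia.
have W1 := peels_ok nb_lt nb_sym nb_uniq uHL ltHL clHL c3_range c3_proper kh
  (zo_graph Z) (zo_HL Z) (zo_cid Z) (zo_seen Z) sep (pg_att P).
rewrite hE in W1.
apply: (wpb_seq (b2 := 380 * h * vl HL) W1); last first.
  by move: cost1; rewrite -!mulnA; set X := h * vl HL; lia.
move=> s1 S1 [V Last]; have {S1} S1 := peels_same S1.
have HL1 : repr_list aHL rHN s1 HL.
  have [A B] := S1; case: (zo_HL Z) => H1 H2.
  by split=> [|i Hi]; [rewrite A|rewrite B ?H2].
apply: (wpb_seq (b2 := 350 * h * vl HL - 50) (mark_failed_ok nb uHL HL1)); last first.
  move: v0 h_gt2; set X := vl HL; clear; nia.
move=> s2 S2 F2.
have HL2 : repr_list aHL rHN s2 HL.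
  have [A B] := S2; case: HL1 => H1 H2.
  by split=> [|i Hi]; [rewrite A|rewrite B ?H2].
apply: (wpb_seq (b2 := 330 * h * vl HL - 50) (unlabel_ok nb h uHL HL2)); last first.
  move: v0 h_gt2; set X := vl HL; clear; nia.
move=> s3 S3 L3.
have HL3 : repr_list aHL rHN s3 HL.
  have [A B] := S3; case: HL2 => H1 H2.
  by split=> [|i Hi]; [rewrite A|rewrite B ?H2].
have sift u : reg u rC = reg s3 rC -> (forall b, arr u b = arr s3 b) -> sifted nb h HL p u.
  move=> Er Ea.
  have a2 b : b != aFail -> arr s2 b = arr s1 b by case: S2 => _ H Hb; apply: H; rewrite inE.
  have a3 b : b != aLev -> arr s3 b = arr s2 b by case: S3 => _ H Hb; apply: H; rewrite inE.
  have [R1 A1] := S1.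
  apply: (@sifted_intro nb nb_sym h HL clHL h_gt2 p s1 u sep V Last).
  - by move=> c Hc; rewrite A1 // (zo_fail Z).
  - by move=> y Hy Ly; rewrite A1 //; apply: (zo_failtop Z).
  - by move=> c; rewrite Ea a3 // F2.
  - by move=> y; rewrite !Ea L3 (a3 aFail) // (a2 aLev) // (a2 aTop).
  - by rewrite Er; case: S3 => -> //; case: S2 => ->.
  - by move=> b Hb1 Hb2; rewrite Ea a3 // a2.
have Si3 := sift s3 (erefl _) (fun=> erefl _).
have Ht x : x \in HL -> arr s3 aLev x = 0 -> 0 < arr s3 aTop x.
  move=> Hx Lx; have Ax : active p x.
    apply/negPn/negP => Nx; have [E _ _ _ _] := si_out Si3 Nx.
    by case/negP: Nx; rewrite /active Hx /level -E Lx.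
  by have /andP[] := si_top Si3 Ax; case: (arr s3 _ _).
apply: (wpb_seq (b2 := 300 * vl HL + 20) (choose_best_ok nb uHL HL3 Ht)); last first.
  move: v0 h_gt2; set X := vl HL; clear; nia.
move=> u Su Best; rewrite /= in Su.
have Eu b : arr u b = arr s3 b by case: Su => _ ->.
have Si : sifted nb h HL p u by apply: sift => //; case: Su => ->.
have Eb b : b \notin [:: 2; 3; 4; 5; 6; 7; 8; 9; 10; 11; 12; 13; 14; 17] -> arr u b = arr p b.
  move=> Hb; rewrite Eu; case: S3 => _ ->; last first.
    by apply: contra Hb; rewrite !inE => /eqP ->.
  case: S2 => _ ->; last by apply: contra Hb; rewrite !inE => /eqP ->; rewrite !orbT.
  case: S1 => _ -> //; apply: contra Hb; move: b.
  by have /allP : all [in [:: 2; 3; 4; 5; 6; 7; 8; 9; 10; 11; 12; 13; 14; 17]] (moda (peel h 2)).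
have HLu : repr_list aHL rHN u HL.
  case: HL3 => H1 H2; case: Su => A B.
  by split=> [|i Hi]; [rewrite A|rewrite B ?H2].
have gu : repr_graph n nb u by apply: (@repr_graph_eq n nb p) (zo_graph Z); apply: Eb.
have Su' : repr_list aS rSn u S.
  case: (zo_S Z) => H1 H2; split=> [|i Hi]; last by rewrite Eb ?H2.
  by case: Su => -> //; case: S3 => -> //; case: S2 => -> //; case: S1 => ->.
have Zu : zone S u by apply: (zone_sifted Z P Si) => //; apply: Eb.
have outu y : y \notin HL -> arr u aLev y = arr p aLev y.
  move=> Hy; have Ny : ~~ active p y by rewrite /active negb_and Hy.
  by case: (si_out Si Ny).
have act0 y : y \in HL -> arr u aLev y = 0 -> active p y.
  move=> Hy Ly; apply/negPn/negP => Ny; have [E _ _ _ _] := si_out Si Ny.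
  by case/negP: Ny; rewrite /active Hy /level -E Ly.
case: Best => [[B0 N0]|[d [dHL Ld Bd Td Hmin]]].
  apply: (@wpb_if _ _ _ _ 1); last by rewrite /=; clear; lia.
    by rewrite /= B0.
  move=> _; apply: wpb_den => //.
  have N0' x : x \in HL -> arr u aLev x != 0 by rewrite Eu; apply: N0.
  have [P' N] := progress_done Z P Si N0'.
  by exists [::], R; rewrite !cats0; split=> //; left.
rewrite -!Eu in Ld Bd Td.
apply: (@wpb_if _ _ _ _ (300 * vl HL)); last by rewrite /=; clear; lia.
  move=> _; set a := arr u aAtt (arr u aTop d).
  have Hm x : x \in HL -> arr u aLev x = 0 ->
      arr u aAcnt (arr u aTop d) <= arr u aAcnt (arr u aTop x).
    by rewrite !Eu; apply: Hmin.
  have [Ra HRa] := si_fail Si (act0 _ dHL Ld) Ld.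
  have aHL0 : a \in HL by apply: (picked_HL P Si dHL Ld (erefl _)).
  apply: (wpb_cons (pick_ok Zu Bd (erefl _) aHL0 _) (leqnn _)).
    move=> y Hy Ly; have Ay := act0 _ Hy Ly.
    have /andP[T1 T2] := si_top Si Ay; split=> //.
    by rewrite Eb // (zo_park Z).
  move=> s Ss Pk; exists [:: a], (fun b => if b == a then Ra else R b).
  rewrite !cats1; split; last by right; split=> //; exists d; apply: act0.
  - exact: (zone_pick P Si Zu dHL Ld (erefl _) Pk).
  - exact: (progress_pick P Si dHL Ld Hm (erefl _) Pk HRa).
  - move=> y Hy; rewrite (pk_lev Pk) /active (negbTE Hy) /= -outu //; case: ifP => // /andP[_].
    by case/hasP=> x xHL /and3P[_ _ /(clHL xHL)]; rewrite (negbTE Hy).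
by rewrite /= Bd Td.
Qed.

End Component.
End Graph.


(** * Rounds *)

Definition layer_step : cmd :=
  for_list aS rJ rSn rA
    (for_nbr rA rP rY
       (If (Eq (rd aLev rY) (Const 0))
          (Write aLev (Reg rY) (Const 1) ;; Write aPar (Reg rY) (Reg rA)) Skip)).

Definition conv (h : nat) : cmd :=
  for_HL (If (Eq (rd aLev rX) (Const 1)) (Write aLev (Reg rX) (Const h.+1))
            (If (Eq (rd aLev rX) (Const h)) (Write aLev (Reg rX) (Const 0)) Skip)).

(** Three passes suffice: each picks at most one vertex, a round has at most two picks, and a pass
    without a pick leaves nothing active. *)
Definition round (h : nat) : cmd :=
  layer_step ;; pass h ;; pass h ;; pass h ;; conv h.

Fixpoint rounds (h B : nat) : cmd :=
  if B is B'.+1 then Seq (rounds h B') (round h) else Skip.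

(** The storage touched does not depend on [h] or on the number of rounds, so for the concrete
    [round 0] membership is decided by computation. *)
Lemma rounds_same h B s s' : same (modr (rounds h B)) (moda (rounds h B)) s s' ->
  same (modr (round 0)) (moda (round 0)) s s'.
Proof.
have cat2 (s1 t1 s2 t2 : seq nat) : {subset s1 <= t1} -> {subset s2 <= t2} ->
    {subset s1 ++ s2 <= t1 ++ t2}.
  by move=> H1 H2 a; rewrite !mem_cat => /orP[/H1|/H2] ->; rewrite ?orbT.
have pr : {subset modr (peels h (h - 3)) <= modr (peel 0 2)}.
  by elim: (h - 3) => [|k IH] // a; rewrite [a \in _]mem_cat => /orP[/IH|].
have pa : {subset moda (peels h (h - 3)) <= moda (peel 0 2)}.
  by elim: (h - 3) => [|k IH] // a; rewrite [a \in _]mem_cat => /orP[/IH|].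
have rr : {subset modr (round h) <= modr (round 0)}.
  by apply: (cat2) => //; do 3!(apply: (cat2); first exact: (cat2 _ _ _ _ pr)).
have ra : {subset moda (round h) <= moda (round 0)}.
  by apply: (cat2) => //; do 3!(apply: (cat2); first exact: (cat2 _ _ _ _ pa)).
apply: same_sub; elim: B => [|B IH] // a; rewrite [a \in _]mem_cat => /orP[/IH //|].
  exact: rr.
exact: ra.
Qed.

Section Graph.

Variables (n : nat) (nb : nat -> seq nat).
Hypothesis nb_lt : forall x y, y \in nb x -> (x < n) && (y < n).
Hypothesis nb_sym : forall x y, (y \in nb x) = (x \in nb y).
Hypothesis nb_irr : forall x, x \notin nb x.
Hypothesis nb_uniq : forall x, uniq (nb x).

Notation eg := (edge nb).
Notation vl := (vol nb).
Let eg_sym := edge_sym nb_sym.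

Section Component.

Variables (h : nat) (HL : seq nat).
Hypothesis uHL : uniq HL.
Hypothesis ltHL : forall x, x \in HL -> x < n.
Hypothesis clHL : forall x y, x \in HL -> eg x y -> y \in HL.
Variable c3 : nat -> nat.
Hypothesis c3_range : forall x, 0 < c3 x <= 3.
Hypothesis c3_proper : forall x y, eg x y -> c3 x != c3 y.
Hypothesis h_gt2 : 2 < h.
Hypothesis size_HL : 0 < size HL.
Hypothesis short : forall p, ipath eg p -> size p <= h.*2.

Notation active := (active HL).
Notation parked := (parked h HL).
Notation zone := (zone n nb h HL).
Notation progress := (progress nb h HL).

Lemma noK4 a b c d : [&& eg a b, eg a c, eg a d, eg b c, eg b d & eg c d] = false.
Proof.
apply/negP => /and5P[ab ac ad bc /andP[bd cd]].
have := c3_range a; have := c3_range b; have := c3_range c; have := c3_range d.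
have := c3_proper ab; have := c3_proper ac; have := c3_proper ad.
have := c3_proper bc; have := c3_proper bd; have := c3_proper cd.
clear; lia.
Qed.

Record round_start (i : nat) (U : pred nat) (K S : seq nat) (s : state) : Prop :=
  RoundStart {
  rs_zone : zone S s;
  rs_U : forall y, U y = active s y;
  rs_lev : forall y, y \in HL -> arr s aLev y != 1 /\ arr s aLev y != h;
  rs_adj : forall y a, U y -> a \in S -> eg y a -> a \in K;
  rs_K : {subset K <= S};
  rs_phase : phase eg h i U K (size S);
  rs_hit : forall x, U x -> exists b y, [/\ b \in K, conn eg U x y & eg b y]
}.

Lemma layer_step_ok s S : repr_graph n nb s -> repr_list aS rSn s S ->
  (forall a, a \in S -> a < n) -> (forall a, a \in S -> size (nb a) <= vl HL) ->
  wpb layer_step s (size S * (80 * vl HL) + 10) (fun s' =>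
    (forall y, arr s' aLev y =
      if (arr s aLev y == 0) && has (eg y) S then 1 else arr s aLev y) /\
    (forall y, if (arr s aLev y == 0) && has (eg y) S
       then arr s' aPar y \in S /\ eg y (arr s' aPar y)
       else arr s' aPar y = arr s aPar y)).
Proof.
move=> Hg HS ltS szS; have v0 := vol_gt0 nb size_HL.
pose I (A pre : seq nat) (a : nat) (s' : state) :=
   (forall y, arr s' aLev y =
      if (arr s aLev y == 0) && (has (eg y) A || (y \in pre)) then 1 else arr s aLev y) /\
   (forall y, if (arr s aLev y == 0) && (has (eg y) A || (y \in pre))
       then arr s' aPar y \in rcons A a /\ eg y (arr s' aPar y)
       else arr s' aPar y = arr s aPar y).
pose J (A : seq nat) (s' : state) :=
   (forall y, arr s' aLev y =
      if (arr s aLev y == 0) && has (eg y) A then 1 else arr s aLev y) /\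
   (forall y, if (arr s aLev y == 0) && has (eg y) A
       then arr s' aPar y \in A /\ eg y (arr s' aPar y)
       else arr s' aPar y = arr s aPar y).
apply: (@wpb_for_list J (fun=> 70 * vl HL) _ _ _ _ _ _ S) => //.
- by move=> k; split=> y; rewrite andbF.
- move=> A a A' s1 k E S1 [H1 H2].
  have aS_ : a \in S by rewrite E mem_cat mem_head orbT.
  have g1 : repr_graph n nb s1 by apply: repr_graph_same S1 Hg.
  apply: (@wpb_for_nbr n nb (fun pre s' => I A pre a s') 40 _ _ _ _ _ a) => //.
  + exact: ltS.
  + move=> k'; split=> y; rewrite in_nil orbF //=; have := H2 y; case: ifP => // _ [H3 H4].
    by rewrite mem_rcons inE H3 orbT.
  + move=> pre y post s2 k2 Enb S2 [I1 I2]; apply: wpb_den => //.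
    have A2 : reg s2 rA = a by case: S2 => ->.
    have ay : eg y a by rewrite eg_sym /edge Enb mem_cat mem_head orbT.
    rewrite /= /upd /= A2 I1.
    have Hpre x : x != y -> (x \in rcons pre y) = (x \in pre).
      by move=> Nx; rewrite mem_rcons inE (negbTE Nx).
    have ypre : y \in rcons pre y by rewrite mem_rcons mem_head.
    case: (eqVneq (arr s aLev y) 0) => Ly /=; last first.
      rewrite ?(negbTE Ly); split=> x.
        by rewrite I1; case: (eqVneq x y) => [->|/Hpre->//]; rewrite (negbTE Ly).
      have := I2 x; case: (eqVneq x y) => [->|Nx]; [by rewrite (negbTE Ly)|by rewrite Hpre].
    case C: (has (eg y) A || (y \in pre)) => /=.
      split=> x.
        by rewrite I1; case: (eqVneq x y) => [->|/Hpre->//]; rewrite Ly C ypre orbT.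
      have := I2 x; case: (eqVneq x y) => [->|Nx]; [by rewrite Ly C ypre orbT|by rewrite Hpre].
    rewrite Ly /=; split=> x; rewrite /= /upd /=.
      case: (eqVneq x y) => [->|Nx]; first by rewrite Ly eqxx ypre orbT.
      by rewrite I1 Hpre.
    case: (eqVneq x y) => [->|Nx].
      by rewrite Ly ypre orbT /= mem_rcons mem_head.
    by rewrite Hpre //; apply: I2.
  + move=> s2 S2 [I1 I2].
    have Ex y : has (eg y) A || (y \in nb a) = has (eg y) (rcons A a).
      by rewrite has_rcons orbC /edge nb_sym.
    by split=> y; [rewrite I1 Ex|have := I2 y; rewrite Ex].
  + by have := szS a aS_; move: v0; clear; nia.
- rewrite big_const_seq count_predT iter_addn_0.
  by move: v0; clear; nia.
Qed.

Lemma conv_ok s : repr_list aHL rHN s HL ->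
  wpb (conv h) s (40 * vl HL + 6) (fun s' => forall y, arr s' aLev y =
    if y \in HL then (if arr s aLev y == 1 then h.+1
      else if arr s aLev y == h then 0 else arr s aLev y) else arr s aLev y).
Proof.
move=> HHL; apply: (wpb_for_HL (nb := nb) (HL := HL) (K := 30) (I := fun pre s' => forall y, arr s' aLev y =
    if y \in pre then (if arr s aLev y == 1 then h.+1
      else if arr s aLev y == h then 0 else arr s aLev y) else arr s aLev y)) => //.
move=> pre z post s1 k E S HI; apply: wpb_den => //.
  by rewrite /=; lia.
have zpre : z \notin pre by move: uHL; rewrite E cat_uniq /= negb_or => /and3P[_ /andP[]].
move=> y; rewrite /= /upd /= HI (negbTE zpre) mem_rcons inE /=.
case L1: (arr s aLev z == 1); rewrite /= /upd /=.
  by rewrite HI; case: (eqVneq y z) => [->|] //=; rewrite L1.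
case Lh: (arr s aLev z == h); rewrite /= /upd /=.
  by rewrite HI; case: (eqVneq y z) => [->|] //=; rewrite L1 Lh.
by rewrite HI; case: (eqVneq y z) => [->|] //=; rewrite L1 Lh (negbTE zpre).
Qed.

Lemma round_layer i U K S s s1 : round_start i U K S s ->
  (forall y, arr s1 aLev y =
      if (arr s aLev y == 0) && has (eg y) S then 1 else arr s aLev y) ->
  (forall y, if (arr s aLev y == 0) && has (eg y) S
       then arr s1 aPar y \in S /\ eg y (arr s1 aPar y)
       else arr s1 aPar y = arr s aPar y) ->
  (forall b, b \notin [:: aLev; aPar] -> arr s1 b = arr s b) ->
  reg s1 rC = reg s rC -> reg s1 rSn = reg s rSn -> reg s1 rHN = reg s rHN ->
  zone S s1 /\ progress U K [::] (fun=> [::]) s1.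
Proof.
move=> RS L1 P1 A1 C1 Sn1 HN1; have Z := rs_zone RS.
have lab y : 1 < arr s1 aLev y -> arr s1 aLev y = arr s aLev y.
  by rewrite L1; case: ifP.
have lab' y : 0 < arr s aLev y -> arr s1 aLev y = arr s aLev y.
  by rewrite L1; case: ifP => // /andP[/eqP->].
have st y : stable h s s1 y.
  have Lq : 1 < arr s aLev y < h \/ 1 < arr s1 aLev y < h -> 1 < arr s aLev y.
    by case=> [/andP[] //|/andP[H _]]; rewrite -lab.
  move=> /Lq Ly; rewrite lab' ?(A1 aL0) ?(A1 aL1) ?(A1 aSide) //; last by clear -Ly; lia.
  by have := P1 y; case: ifP => [/andP[/eqP L0 _]|_ ->]; rewrite ?L0 in Ly *.
have UE y : y \in HL -> (arr s aLev y == 0) = U y.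
  by move=> Hy; rewrite (rs_U RS) /active Hy.
have layE y : U y -> has (eg y) S = has (eg y) K.
  move=> Uy; apply/hasP/hasP => [] [a Ha ya]; exists a => //.
    exact: (rs_adj RS Uy Ha ya).
  exact: (rs_K RS).
split.
- split.
  + by apply: repr_graph_eq (zo_graph Z); apply: A1.
  + by case: (zo_HL Z) => H1 H2; split; [rewrite HN1|move=> k Hk; rewrite A1 ?H2].
  + by case: (zo_S Z) => H1 H2; split; [rewrite Sn1|move=> k Hk; rewrite A1 ?H2].
  + by move=> y; rewrite A1 // C1; apply: (zo_cid Z).
  + by move=> y; rewrite A1 // C1; apply: (zo_seen Z).
  + by move=> c; rewrite A1 // C1; apply: (zo_fail Z).
  + by move=> c; rewrite A1 // C1; apply: (zo_park Z).
  + move=> y Hy Ly; rewrite !A1 // C1; apply: (zo_failtop Z) => //.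
    by rewrite -lab //; case/andP: Ly.
  + by move=> y Hy; have := zo_lev Z Hy; rewrite L1; case: ifP.
  + move=> y z Hy Ly yz; apply/negP => Lz; have Lz' := Lz.
    rewrite lab in Lz'; last by case/andP: Lz.
    have Ly' : arr s aLev y = 0 \/ arr s aLev y = h.
      by move: Ly; rewrite L1; case: ifP => // _; clear -h_gt2; lia.
    by have := zo_sep Z Hy Ly' yz; rewrite Lz'.
  + move=> y Hy Ly; have Ly' := Ly; rewrite lab in Ly'; last by case/andP: Ly.
    by apply: (settled_stable nb_sym h_gt2 Ly' _ _ (zo_settled Z Hy Ly')).
  + move=> y Hy; rewrite L1; have := P1 y; case: ifP.
      move=> /andP[/eqP L0 _] [H1 H2] _; split=> //; case: ifP => // yS.
      by have [_] := zo_pick Z yS; rewrite L0.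
    move=> _ -> Ly; exact: (zo_old Z Hy Ly).
  + by move=> v Hv; have [H1 H2] := zo_pick Z Hv; split=> //; rewrite lab' H2.
have actR y : active s1 y <-> rest eg U K y.
  rewrite /active /level /rest L1; case Hy: (y \in HL) => /=; last first.
    by rewrite (rs_U RS) /active Hy.
  rewrite UE //; case Uy: (U y) => /=; last by rewrite UE // Uy.
  by rewrite layE //; case: (has (eg y) K) => //=; rewrite UE.
have parkN y : ~~ parked s1 y.
  apply/negP => /andP[Hy]; rewrite /level L1; case: ifP => _.
    by move=> /eqP; clear -h_gt2; lia.
  by have [_ /negbTE->] := rs_lev RS Hy.
split=> //.
- by move=> y /actR.
- by move=> y Py; have := parkN y; rewrite Py.
- by move=> y z _ /conn_memr /actR.
- by move=> y z Py; have := parkN y; rewrite Py.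
- move=> v Hv; rewrite L1; case: ifP => [/andP[L0 Hs] _|_ Lv]; last first.
    by have [] := rs_lev RS Hv; rewrite Lv.
  have Uv : U v by rewrite -UE.
  by split=> //; rewrite /layer Uv -layE.
- by move=> y Py; have := parkN y; rewrite Py.
- move=> x Ax; have Rx : rest eg U K x by apply/actR.
  have /andP[Ux Nx] := Rx.
  have [b [y [Hb Cy by_]]] := rs_hit RS Ux.
  (* A walk in [U] from [x] to a neighbor of [K] leaves [rest] through the new layer; the vertex
     where it does so is an attacher of level 1. *)
  have [||p [v [Cp Cv Nv pv]]] := conn_exit (P := rest eg U K) Cy.
  + exact: Rx.
  + rewrite /rest negb_and negbK; apply/orP; right; apply/hasP; exists b => //.
    by rewrite eg_sym.
  + have Uv : U v := conn_memr Cv.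
    have Lv : has (eg v) K by move: Nv; rewrite /rest Uv /= negbK.
    exists v, p; split; last by rewrite eg_sym.
      rewrite /level L1 layE // Lv andbT.
      by rewrite UE ?Uv //; move: Uv; rewrite (rs_U RS) => /andP[].
    by apply: conn_sub Cp => z /andP[_ /actR/andP[]].
Qed.

Lemma round_conv i U K S Kp R s s' : round_start i U K S s ->
  forall s1, zone (S ++ Kp) s1 -> progress U K Kp R s1 ->
  (size Kp <= 2 -> forall y, ~~ active s1 y) ->
  (forall y, arr s' aLev y =
    if y \in HL then (if arr s1 aLev y == 1 then h.+1
      else if arr s1 aLev y == h then 0 else arr s1 aLev y) else arr s1 aLev y) ->
  (forall b, b != aLev -> arr s' b = arr s1 b) ->
  reg s' rC = reg s1 rC -> reg s' rSn = reg s1 rSn -> reg s' rHN = reg s1 rHN ->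
  round_start i.+1 (parked s1) Kp (S ++ Kp) s'.
Proof.
move=> RS s1 Z P Hact L1 A1 C1 Sn1 HN1.
have picks : round_picks eg h U K (parked s1) Kp.
  split.
  - exact: (pg_uniq P).
  - by move=> b /(pg_pick P)[].
  - exists R => b Hb; have [_ H] := pg_pick P Hb; split=> // b' Hb' Nb x y.
    exact: (pg_mut P Hb Hb' Nb).
  - exact: (pg_park P).
  - exact: (pg_hit P).
have [szK ph] := phase_next eg_sym (ltnW h_gt2) short noK4 (rs_phase RS) picks.
have {}Hact := Hact szK.
have lab y : 1 < arr s1 aLev y < h -> arr s' aLev y = arr s1 aLev y.
  by rewrite L1; case: ifP => // _; do 2?case: ifP => //; clear -h_gt2; lia.
have lab' y : 1 < arr s' aLev y < h -> arr s' aLev y = arr s1 aLev y.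
  by rewrite L1; case: ifP => // _; do 2?case: ifP => //; clear -h_gt2; lia.
have st y : stable h s1 s' y.
  move=> Ly; have -> : arr s' aLev y = arr s1 aLev y by case: Ly => [/lab|/lab'].
  by rewrite !A1.
split.
- split.
  + by apply: repr_graph_eq (zo_graph Z); apply: A1.
  + by case: (zo_HL Z) => H1 H2; split; [rewrite HN1|move=> k Hk; rewrite A1 ?H2].
  + by case: (zo_S Z) => H1 H2; split; [rewrite Sn1|move=> k Hk; rewrite A1 ?H2].
  + by move=> y; rewrite A1 // C1; apply: (zo_cid Z).
  + by move=> y; rewrite A1 // C1; apply: (zo_seen Z).
  + by move=> c; rewrite A1 // C1; apply: (zo_fail Z).
  + by move=> c; rewrite A1 // C1; apply: (zo_park Z).
  + move=> y Hy Ly; rewrite !A1 // C1; apply: (zo_failtop Z) => //.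
    by rewrite -lab'.
  + by move=> y Hy; have := zo_lev Z Hy; rewrite L1 Hy; do 2?case: ifP => //.
  + move=> y z Hy Ly yz; apply/negP => Lz; have Lz' := Lz; rewrite lab' // in Lz'.
    have Ly' : arr s1 aLev y = 0 \/ arr s1 aLev y = h.
      by move: Ly; rewrite L1 Hy; do 2?case: eqP => //; clear -h_gt2; lia.
    by have := zo_sep Z Hy Ly' yz; rewrite Lz'.
  + move=> y Hy Ly; have Ly' := Ly; rewrite lab' // in Ly'.
    by apply: (settled_stable nb_sym h_gt2 Ly' _ _ (zo_settled Z Hy Ly')).
  + move=> y Hy Ly; rewrite A1 //; apply: (zo_old Z Hy).
    by move: Ly; rewrite L1 Hy; do 2?case: eqP => //; clear -h_gt2; lia.
  + move=> v Hv; have [H1 H2] := zo_pick Z Hv; split=> //; rewrite L1 H1 H2.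
    by do 2?case: ifP => //; clear -h_gt2; lia.
- move=> y; rewrite /parked /active /level L1; case Hy: (y \in HL) => //=.
  case: (eqVneq (arr s1 aLev y) 1) => [->|N1] /=; first by clear -h_gt2; lia.
  case: (eqVneq (arr s1 aLev y) h) => // Nh.
  by apply/esym/negbTE; have := Hact y; rewrite /active Hy.
- move=> y Hy; rewrite L1 Hy; case: (eqVneq (arr s1 aLev y) 1) => [_|N1] /=.
    by clear -h_gt2; split; lia.
  by case: (eqVneq (arr s1 aLev y) h) => // _; clear -h_gt2; split; lia.
- move=> y a Py; rewrite mem_cat => /orP[Ha|//] ya.
  have /andP[Uy /hasPn Ny] := pg_park P Py.
  by have := Ny _ (rs_adj RS Uy Ha ya); rewrite ya.
- by move=> y Hy; rewrite mem_cat Hy orbT.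
- by rewrite size_cat.
- move=> x Px; have [b [y [Hb Cy by_]]] := pg_hit P Px; exists b, y; split=> //.
  apply: (conn_ind (P := fun z => conn eg (parked s1) x z) _ _ Cy).
    exact: conn_refl.
  move=> z z' Cz Cz' Wz' zz'; apply: (conn_trans Cz'); apply: conn_step => //.
    exact: conn_memr Cz'.
  apply: (pg_parkcl P Px); apply: (conn_trans Cz); apply: conn_step => //.
  exact: conn_memr Cz.
Qed.

Lemma round_ok i U K S s : i < h.+3 -> round_start i U K S s ->
  wpb (round h) s (4000 * h * vl HL) (fun s' =>
    (exists U' K' S', round_start i.+1 U' K' S' s') /\
    forall y, y \notin HL -> arr s' aLev y = arr s aLev y).
Proof.
move=> ih RS; have Z := rs_zone RS; have v0 := vol_gt0 nb size_HL.
have szS : size S <= h.+4 by have := phase_size (rs_phase RS); move: ih; clear; lia.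
have SHL a : a \in S -> a \in HL by case/(zo_pick Z).
have W1 : wpb layer_step s (size S * (80 * vl HL) + 10) (fun s1 => exists R,
    [/\ zone S s1, progress U K [::] R s1
      & forall y, y \notin HL -> arr s1 aLev y = arr s aLev y]).
  apply: (wpb_cons (layer_step_ok (zo_graph Z) (zo_S Z) _ _) (leqnn _)).
  - by move=> a /SHL; apply: ltHL.
  - move=> a /SHL Ha; rewrite /vol (perm_big _ (perm_to_rem Ha)) big_cons.
    by apply: leq_trans (leq_addr _ _); apply: leqnSn.
  - move=> s1 [R1 A1] [L1 P1]; exists (fun=> [::]).
    have [Z1 Pr1] : zone S s1 /\ progress U K [::] (fun=> [::]) s1.
      by apply: (round_layer RS L1 P1); [exact: A1|exact: R1|exact: R1|exact: R1].
    split=> // y Hy; rewrite L1; case: ifP => // /andP[_] /hasP[a /SHL aHL].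
    by rewrite eg_sym => /(clHL aHL); rewrite (negbTE Hy).
apply: (wpb_seq (b2 := 3500 * h * vl HL) W1); last first.
  move: szS v0 h_gt2; set X := vl HL; clear; nia.
move=> s1 _ [R1 [Z1 P1 O1]].
apply: (wpb_seq (b2 := 2500 * h * vl HL) (pass_ok nb_lt nb_sym nb_uniq uHL ltHL clHL
   c3_range c3_proper h_gt2 size_HL Z1 P1)); last first.
  by rewrite -!mulnA; clear; lia.
move=> s2 _ [Kn2 [R2 [Z2 P2 O2 D2]]].
apply: (wpb_seq (b2 := 1500 * h * vl HL) (pass_ok nb_lt nb_sym nb_uniq uHL ltHL clHL
   c3_range c3_proper h_gt2 size_HL Z2 P2)); last first.
  by rewrite -!mulnA; clear; lia.
move=> s3 _ [Kn3 [R3 [Z3 P3 O3 D3]]].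
apply: (wpb_seq (b2 := 500 * h * vl HL) (pass_ok nb_lt nb_sym nb_uniq uHL ltHL clHL
   c3_range c3_proper h_gt2 size_HL Z3 P3)); last first.
  by rewrite -!mulnA; clear; lia.
move=> s4 _ [Kn4 [R4 [Z4 P4 O4 D4]]].
apply: (wpb_cons (conv_ok (zo_HL Z4))).
  move: v0 h_gt2; set X := vl HL; clear; nia.
move=> s5 [R5 A5] L5; rewrite -!catA cat0s in Z4 P4.
split; last by move=> y Hy; rewrite L5 (negbTE Hy) O4 // O3 // O2 // O1.
exists (parked s4), (Kn2 ++ (Kn3 ++ Kn4)), (S ++ (Kn2 ++ (Kn3 ++ Kn4))).
apply: (round_conv RS Z4 P4 _ L5); last 4 first.
- by move=> b Hb; apply: A5; rewrite /= !inE !negb_or !Hb.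
- exact: R5.
- exact: R5.
- exact: R5.
(* If the last pass picked, something was active before it; then the earlier passes picked as well,
   which makes three picks. *)
rewrite !size_cat => sz; case: D4 => [[]//|[S4 [d4 A4]]].
case: D3 => [[_ N3]|[S3 [d3 A3]]]; first by have := N3 d4; rewrite A4.
case: D2 => [[_ N2]|[S2 _]]; first by have := N2 d3; rewrite A3.
by move: sz; rewrite S2 S3 S4.
Qed.

Lemma rounds_ok U K S s B : B <= h.+3 -> round_start 0 U K S s ->
  wpb (rounds h B) s (4000 * B * h * vl HL + 1) (fun s' =>
    (exists U' K' S', round_start B U' K' S' s') /\
    forall y, y \notin HL -> arr s' aLev y = arr s aLev y).
Proof.
elim: B => [|B IH] HB RS.
  by apply: wpb_den => //; split=> //; exists U, K, S.
apply: (wpb_seq (b2 := 4000 * h * vl HL) (IH (ltnW HB) RS)); last first.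
  by rewrite -!mulnA; set X := h * _; clear; lia.
move=> s1 _ [[U' [K' [S' RS']]] O1]; apply: (wpb_cons (round_ok HB RS')) => // s2 _ [H O2].
by split=> // y Hy; rewrite O2 // O1.
Qed.

(* After all rounds every vertex either has a level or is dominated by [S]. *)
Lemma rounds_end U K S s : round_start h.+3 U K S s ->
  [/\ zone S s, size S <= h.+3.+2
    & forall y, y \in HL -> 1 < arr s aLev y < h \/ arr s aLev y = h.+1].
Proof.
move=> RS; have U0 := phase_end eg_sym (ltnW h_gt2) short (rs_phase RS).
split; [exact: (rs_zone RS)|exact: (phase_size (rs_phase RS))|].
move=> y Hy; have := U0 y; rewrite (rs_U RS) /active Hy /level /=.
have [N1 Nh] := rs_lev RS Hy; have := zo_lev (rs_zone RS) Hy.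
by move: N1 Nh; clear; lia.
Qed.

End Component.
End Graph.


(** * Coloring from lists of size two *)

(* Two propagations, numbered by booleans, start at the same vertex with its two
   colors and run in lockstep, so that the time is proportional to the work of
   the first one that finishes without a conflict. *)
Definition aV (i : bool) := if i then 22 else 21.
Definition aQu (i : bool) := if i then 24 else 23.
Definition rHd (i : bool) := if i then 30 else 26.
Definition rTl (i : bool) := if i then 31 else 27.
Definition rEp (i : bool) := if i then 32 else 28.
Definition rCf (i : bool) := if i then 33 else 29.
Notation rT1 := 34 (only parsing).
Notation rT2 := 35 (only parsing).

Definition init_thread (i : bool) : cmd :=
  Write (aQu i) (Const 0) (Reg rX) ;;
  Assign (rHd i) (Const 0) ;;
  Assign (rTl i) (Const 1) ;;
  Assign (rEp i) (Read 0 (Reg rX)) ;;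
  Write (aV i) (Reg rX) (Read (if i then aL1 else aL0) (Reg rX)) ;;
  Assign (rCf i) (Const 0).

Definition push (i : bool) (a : nat) : cmd :=
  Write (aV i) (Reg rT2) (Read a (Reg rT2)) ;;
  Write (aQu i) (Reg (rTl i)) (Reg rT2) ;;
  Assign (rTl i) (Incr (Reg (rTl i))).

Definition step_thread (i : bool) : cmd :=
  Assign rT1 (Read (aQu i) (Reg (rHd i))) ;;
  If (Lt (Reg (rEp i)) (Read 0 (Incr (Reg rT1))))
    (Assign rT2 (Read 1 (Reg (rEp i))) ;;
     Assign (rEp i) (Incr (Reg (rEp i))) ;;
     If (Eq (rd aCol rT2) (Const 0))
       (If (Eq (rd (aV i) rT2) (Const 0))
          (If (Eq (rd aL0 rT2) (rd (aV i) rT1))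
             (If (Eq (rd aL1 rT2) (rd (aV i) rT1)) (Assign (rCf i) (Const 1))
                (push i aL1))
             (If (Eq (rd aL1 rT2) (rd (aV i) rT1)) (push i aL0) Skip))
          (If (Eq (rd (aV i) rT2) (rd (aV i) rT1)) (Assign (rCf i) (Const 1)) Skip))
       Skip)
    (Assign (rHd i) (Incr (Reg (rHd i))) ;;
     If (Lt (Reg (rHd i)) (Reg (rTl i)))
       (Assign (rEp i) (Read 0 (Read (aQu i) (Reg (rHd i))))) Skip).

Definition finished (i : bool) : bexp :=
  And (Eq (Reg (rCf i)) (Const 0)) (Not (Lt (Reg (rHd i)) (Reg (rTl i)))).

Definition advance (i : bool) : cmd :=
  If (Eq (Reg (rCf i)) (Const 0)) (step_thread i) Skip.

Definition race : cmd :=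
  While (And (Not (finished false)) (And (Not (finished true))
           (Not (And (Eq (Reg (rCf false)) (Const 1)) (Eq (Reg (rCf true)) (Const 1))))))
    (advance false ;; advance true).

Definition commit (i : bool) : cmd :=
  for_list (aQu i) rJ (rTl i) rT1 (Write aCol (Reg rT1) (rd (aV i) rT1)).

Definition erase (i : bool) : cmd :=
  for_list (aQu i) rJ (rTl i) rT1 (Write (aV i) (Reg rT1) (Const 0)).

Definition propagate : cmd :=
  (init_thread false ;; init_thread true) ;;
  race ;;
  If (finished false) (commit false)
    (If (finished true) (commit true) (Assign rBad (Const 1))) ;;
  erase false ;; erase true.

Record thread := Thread {
  th_v : nat -> nat; th_q : nat -> nat;
  th_hd : nat; th_tl : nat; th_ep : nat; th_cf : nat
}.

Definition view (i : bool) (s : state) : thread :=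
  Thread (arr s (aV i)) (arr s (aQu i)) (reg s (rHd i)) (reg s (rTl i))
    (reg s (rEp i)) (reg s (rCf i)).

Definition push_th (t : thread) (y c : nat) : thread :=
  Thread (upd (th_v t) y c) (upd (th_q t) (th_tl t) y) (th_hd t) (th_tl t).+1
    (th_ep t).+1 (th_cf t).

(** One machine step of a propagation as a pure function, so that a single proof serves both copies
    ([step_view]). *)
Definition step_th (off adj col l0 l1 : nat -> nat) (t : thread) : thread :=
  let z := th_q t (th_hd t) in
  let y := adj (th_ep t) in
  let skip := Thread (th_v t) (th_q t) (th_hd t) (th_tl t) (th_ep t).+1 (th_cf t) in
  let stop := Thread (th_v t) (th_q t) (th_hd t) (th_tl t) (th_ep t).+1 1 in
  if th_ep t < off z.+1 then
    if col y == 0 then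
      if th_v t y == 0 then
        if l0 y == th_v t z then
          if l1 y == th_v t z then stop else push_th t y (l1 y)
        else if l1 y == th_v t z then push_th t y (l0 y) else skip
      else if th_v t y == th_v t z then stop else skip
    else skip
  else
    Thread (th_v t) (th_q t) (th_hd t).+1 (th_tl t)
      (if (th_hd t).+1 < th_tl t then off (th_q t (th_hd t).+1) else th_ep t) (th_cf t).

Lemma step_view i s :
  view i (den (step_thread i) s) =
  step_th (arr s 0) (arr s 1) (arr s aCol) (arr s aL0) (arr s aL1) (view i s).
Proof. by case: i; rewrite /step_th /= /upd /=; do !case: ifP => //= ?. Qed.

Lemma step_view_other i s : view (~~ i) (den (step_thread i) s) = view (~~ i) s.
Proof. by case: i; rewrite /= /upd /=; do !case: ifP => //= ?. Qed.

Section Graph.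

Variables (n : nat) (nb : nat -> seq nat).
Hypothesis nb_lt : forall x y, y \in nb x -> (x < n) && (y < n).
Hypothesis nb_sym : forall x y, (y \in nb x) = (x \in nb y).
Hypothesis nb_irr : forall x, x \notin nb x.
Hypothesis nb_uniq : forall x, uniq (nb x).

Notation eg := (edge nb).
Notation vl := (vol nb).
Let eg_sym := edge_sym nb_sym.

Section Component.

Variables (HL : seq nat).
Hypothesis uHL : uniq HL.
Hypothesis ltHL : forall x, x \in HL -> x < n.
Hypothesis clHL : forall x y, x \in HL -> eg x y -> y \in HL.

Section Thread.

Variables (off adj col l0 l1 : nat -> nat).
Hypothesis off_S : forall x, x < n -> off x.+1 = off x + size (nb x).
Hypothesis adjE : forall x i, x < n -> i < size (nb x) ->
  adj (off x + i) = nth 0 (nb x) i.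
Hypothesis l_gt0 : forall y, y \in HL -> 0 < l0 y /\ 0 < l1 y.

Definition list_coloring (f : nat -> nat) : Prop :=
  (forall y, y \in HL -> f y = l0 y \/ f y = l1 y) /\
  (forall y z, y \in HL -> eg y z -> f y != f z).

(* The color of [z] is no threat to the color of [y]. *)
Definition safe (Q : seq nat) (v : nat -> nat) (z y : nat) : bool :=
  (col y != 0) || (if y \in Q then v y != v z else (v z != l0 y) && (v z != l1 y)).

(** The part of the invariant that outlives a conflict. It is needed to erase the tentative colors,
    in time proportional to the [N] steps made. *)
Record queue (N : nat) (t : thread) (Q : seq nat) : Prop := Queue {
  qu_q : forall i, i < size Q -> th_q t i = nth 0 Q i;
  qu_tl : th_tl t = size Q;
  qu_out : forall y, y \notin Q -> th_v t y = 0;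
  qu_size : size Q <= N.+1
}.

(** [ru_forced] makes conflicts conclusive: every color in the queue is implied by color [c] at [x].
    In [ru_N] each vertex taken from the queue accounts for deg + 1 steps, the last one closing its
    list. *)
Record running (x c N : nat) (t : thread) (Q pre : seq nat) : Prop := Running {
  ru_queue : queue N t Q;
  ru_hd : th_hd t <= size Q;
  ru_uniq : uniq Q;
  ru_Q : forall y, y \in Q -> [/\ y \in HL, col y = 0, 0 < th_v t y &
     th_v t y = l0 y \/ th_v t y = l1 y];
  ru_x : x \in Q /\ th_v t x = c;
  ru_forced : forall f, list_coloring f -> f x = c -> forall y, y \in Q -> f y = th_v t y;
  ru_done : forall z y, z \in take (th_hd t) Q -> eg z y -> safe Q (th_v t) z y;
  ru_pre : forall y, y \in pre -> safe Q (th_v t) (nth 0 Q (th_hd t)) y;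
  ru_N : N = vl (take (th_hd t) Q) + size pre;
  ru_cur : if th_hd t < size Q
    then th_ep t = off (nth 0 Q (th_hd t)) + size pre /\
         exists post, nb (nth 0 Q (th_hd t)) = pre ++ post
    else pre = [::]
}.

Lemma safe_push Q v y c z w : z \in Q -> y \notin Q -> c = l0 y \/ c = l1 y ->
  safe Q v z w -> safe (rcons Q y) (upd v y c) z w.
Proof.
move=> zQ yQ Hc; rewrite /safe /upd mem_rcons inE.
have -> : (z == y) = false by apply: contraNF yQ => /eqP <-.
case: (eqVneq w y) => [->|] //=; case: (col y != 0) => //=.
by rewrite (negbTE yQ) => /andP[H0 H1]; case: Hc => ->; rewrite eq_sym.
Qed.

Lemma running_push x c N t Q pre post y cy :
  running x c N t Q pre -> th_hd t < size Q ->
  nb (nth 0 Q (th_hd t)) = pre ++ y :: post ->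
  col y = 0 -> y \notin Q -> cy = l0 y \/ cy = l1 y ->
  th_v t (nth 0 Q (th_hd t)) = l0 y /\ cy = l1 y \/
    th_v t (nth 0 Q (th_hd t)) = l1 y /\ cy = l0 y ->
  cy != th_v t (nth 0 Q (th_hd t)) ->
  running x c N.+1 (push_th t y cy) (rcons Q y) (rcons pre y).
Proof.
set z := nth 0 Q (th_hd t) => Ru hdQ Enb Cy yQ Hc Hz Ncz.
case: (Ru) => [[H1 H2 H3 H4] H5 H6 H7 [H8 H9] H10 H11 H12 H13 H14].
have zQ : z \in Q by apply: mem_nth.
have Hdq : take (th_hd t) (rcons Q y) = take (th_hd t) Q by rewrite -cats1 takel_cat.
have Enth : nth 0 (rcons Q y) (th_hd t) = z by rewrite nth_rcons hdQ.
have ny w : w \in Q -> (w == y) = false by move=> wQ; apply: contraNF yQ => /eqP <-.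
have [zHL Cz vz _] := H7 _ zQ.
have zy : eg z y by rewrite /edge Enb mem_cat mem_head orbT.
split=> /=.
- split=> /=.
  + move=> i; rewrite size_rcons ltnS nth_rcons leq_eqVlt /upd H2 => /orP[/eqP->|Hi].
      by rewrite eqxx ltnn.
    by rewrite Hi ltn_eqF // H1.
  + by rewrite size_rcons H2.
  + by move=> w; rewrite mem_rcons inE negb_or /upd => /andP[/negbTE -> /H3].
  + by rewrite size_rcons ltnS.
- by rewrite size_rcons; apply: leqW.
- by rewrite rcons_uniq yQ.
- move=> w; rewrite mem_rcons inE /upd => /orP[/eqP->|wQ].
    have yHL : y \in HL by apply: clHL zHL zy.
    by rewrite eqxx; split=> //; have [] := l_gt0 yHL; case: Hc => ->.
  by rewrite ny //; apply: H7.
- by rewrite mem_rcons inE H8 orbT /upd ny.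
- move=> f Hf fx w; rewrite mem_rcons inE /upd => /orP[/eqP->|wQ].
    rewrite eqxx; case: (Hf) => Hl Hp.
    have fz := H10 f Hf fx z zQ; have := Hp z y zHL zy; rewrite fz.
    have yHL : y \in HL by apply: clHL zHL zy.
    by case: Hz => [[-> ->]|[-> ->]]; case: (Hl y yHL) => -> //; rewrite eqxx.
  by rewrite ny //; apply: H10.
- rewrite Hdq => w u wQ wu; apply: safe_push => //; last exact: H11.
  exact: mem_take wQ.
- move=> w; rewrite Enth mem_rcons inE => /orP[/eqP->|wp]; last first.
    by apply: safe_push => //; apply: H12.
  by rewrite /safe mem_rcons mem_head /upd eqxx ny // Ncz orbT.
- by rewrite Hdq size_rcons addnS -H13.
- rewrite hdQ in H14; have [E1 _] := H14.
  rewrite size_rcons ltnS H5 Enth; split; first by rewrite E1 size_rcons addnS.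
  by exists post; rewrite cat_rcons.
Qed.

Lemma running_skip x c N t Q pre post y t' :
  running x c N t Q pre -> th_hd t < size Q ->
  nb (nth 0 Q (th_hd t)) = pre ++ y :: post ->
  safe Q (th_v t) (nth 0 Q (th_hd t)) y ->
  t' = Thread (th_v t) (th_q t) (th_hd t) (th_tl t) (th_ep t).+1 (th_cf t) ->
  running x c N.+1 t' Q (rcons pre y).
Proof.
move=> [[H1 H2 H3 H4] H5 H6 H7 H8 H10 H11 H12 H13 H14] hdQ Enb Sy ->.
split=> //=.
- by split=> //; apply: leqW.
- by move=> w; rewrite mem_rcons inE => /orP[/eqP->|/H12].
- by rewrite size_rcons addnS -H13.
- rewrite hdQ in H14 *; have [E1 _] := H14.
  by split; [rewrite E1 size_rcons addnS|exists post; rewrite cat_rcons].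
Qed.

(** A conflict arises in two ways: a neighbor whose list consists only of the color of [z], or a
    neighbor already forced to that color. Both contradict every list coloring that gives [x] the
    color [c]. *)
Lemma step_th_ok x c N t Q pre : th_cf t = 0 ->
  running x c N t Q pre -> th_hd t < size Q ->
  let t' := step_th off adj col l0 l1 t in
  (th_cf t' = 0 /\ exists Q' pre', running x c N.+1 t' Q' pre') \/
  (th_cf t' = 1 /\ (exists Q', queue N.+1 t' Q') /\
     forall f, list_coloring f -> f x <> c).
Proof.
move=> cf0 Ru hdQ.
case: (Ru) => [[H1 H2 H3 H4] H5 H6 H7 [H8 H9] H10 H11 H12 H13 H14].
rewrite hdQ in H14; have [Eep [post Enb]] := H14.
rewrite /step_th /= H1 //; set z := nth 0 Q (th_hd t) in H12 H14 Eep Enb *.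
have zQ : z \in Q by apply: mem_nth.
have [zHL Cz vz Lz] := H7 _ zQ; have zn := ltHL zHL.
rewrite off_S // Eep ltn_add2l Enb size_cat.
case: post Enb => [|y post] Enb.
  rewrite addn0 ltnn cats0 in Enb *; left; split=> //; exists Q, [::].
  have Etake : take (th_hd t).+1 Q = rcons (take (th_hd t) Q) z by rewrite (take_nth 0).
  split=> //=.
  - by split=> //; apply: leqW.
  - move=> w y; rewrite Etake mem_rcons inE => /orP[/eqP->|]; last exact: H11.
    by rewrite /edge Enb => /H12.
  - by rewrite Etake vol_rcons H13 Enb addn0 addnS.
  - rewrite H2; case: ltnP => // Hlt; rewrite H1 // addn0; split=> //.
    by exists (nb (nth 0 Q (th_hd t).+1)).
rewrite -[X in X < _]addn0 ltn_add2l /=.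
have -> : adj (off z + size pre) = y.
  by rewrite adjE ?Enb ?nth_cat ?ltnn ?subnn // size_cat /= addnS ltnS leq_addr.
have zy : eg z y by rewrite /edge Enb mem_cat mem_head orbT.
have yHL : y \in HL by apply: clHL zHL zy.
have stopped : (forall f, list_coloring f -> f x <> c) ->
    (1 = 0 /\ exists Q' pre', running x c N.+1
      (Thread (th_v t) (th_q t) (th_hd t) (th_tl t) (off z + size pre).+1 1) Q' pre') \/
    (1 = 1 /\ (exists Q', queue N.+1
      (Thread (th_v t) (th_q t) (th_hd t) (th_tl t) (off z + size pre).+1 1) Q') /\
     forall f, list_coloring f -> f x <> c).
  move=> Hf; right; split=> //; split=> //; exists Q; split=> //=; exact: leqW.
have skipped : safe Q (th_v t) z y ->
    (th_cf t = 0 /\ exists Q' pre', running x c N.+1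
      (Thread (th_v t) (th_q t) (th_hd t) (th_tl t) (off z + size pre).+1 (th_cf t)) Q' pre') \/
    (th_cf t = 1 /\ (exists Q', queue N.+1
      (Thread (th_v t) (th_q t) (th_hd t) (th_tl t) (off z + size pre).+1 (th_cf t)) Q') /\
     forall f, list_coloring f -> f x <> c).
  move=> Sy; left; split=> //; exists Q, (rcons pre y).
  by apply: (running_skip Ru hdQ Enb Sy); rewrite Eep.
case: (eqVneq (col y) 0) => [Cy|Ny]; last by apply: skipped; rewrite /safe Ny.
have pushed cy : y \notin Q -> cy = l0 y \/ cy = l1 y ->
    th_v t z = l0 y /\ cy = l1 y \/ th_v t z = l1 y /\ cy = l0 y ->
    cy != th_v t z ->
    (th_cf (push_th t y cy) = 0 /\ exists Q' pre', running x c N.+1 (push_th t y cy) Q' pre') \/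
    (th_cf (push_th t y cy) = 1 /\ (exists Q', queue N.+1 (push_th t y cy) Q') /\
     forall f, list_coloring f -> f x <> c).
  move=> yQ Hc Hz Nc; left; split=> //; exists (rcons Q y), (rcons pre y).
  exact: (running_push Ru hdQ Enb Cy yQ Hc Hz Nc).
case: (eqVneq (th_v t y) 0) => [Vy|Vy].
  have yQ : y \notin Q by apply/negP => /H7[_ _]; rewrite Vy.
  case: (eqVneq (l0 y) (th_v t z)) => [E0|N0].
    case: (eqVneq (l1 y) (th_v t z)) => [E1|N1].
      apply: stopped => f Hf fx; case: (Hf) => Hl Hp.
      have := Hp z y zHL zy; rewrite (H10 f Hf fx z zQ).
      by case: (Hl y yHL) => ->; rewrite ?E0 ?E1 eqxx.
    by apply: pushed => //; [right|left].
  case: (eqVneq (l1 y) (th_v t z)) => [E1|N1].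
    by apply: pushed => //; [left|right].
  by apply: skipped; rewrite /safe (negbTE yQ) ![th_v t z == _]eq_sym N0 N1 orbT.
have yQ : y \in Q by apply/negPn/negP => /H3 E; rewrite E in Vy.
case: (eqVneq (th_v t y) (th_v t z)) => [Eyz|Nyz].
  apply: stopped => f Hf fx; case: (Hf) => Hl Hp.
  by have := Hp z y zHL zy; rewrite (H10 f Hf fx z zQ) (H10 f Hf fx y yQ) Eyz eqxx.
by apply: skipped; rewrite /safe yQ Nyz orbT.
Qed.

End Thread.

End Component.
End Graph.


(** * Solving one list instance *)

Definition set_lists (h : nat) : cmd :=
  Write aCol (Reg rX) (Const 0) ;;
  If (Eq (rd aLev rX) (Const h.+1))
    (If (Eq (rd aPar rX) (Reg rX))
       (Write aL0 (Reg rX) (rd aG rX) ;; Write aL1 (Reg rX) (rd aG rX))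
       (If (Eq (Read aG (rd aPar rX)) (Const 1)) (Write aL0 (Reg rX) (Const 2))
          (Write aL0 (Reg rX) (Const 1)) ;;
        If (Eq (Read aG (rd aPar rX)) (Const 3)) (Write aL1 (Reg rX) (Const 2))
          (Write aL1 (Reg rX) (Const 3))))
    Skip.

Definition solve (h : nat) : cmd :=
  Assign rBad (Const 0) ;;
  for_HL (set_lists h) ;;
  for_HL (If (And (Eq (Reg rBad) (Const 0)) (Eq (rd aCol rX) (Const 0))) propagate Skip) ;;
  If (Eq (Reg rBad) (Const 0)) (Assign rDone (Const 1)) Skip.

(* Vertices of level [h.+1] are either guessed or adjacent to a guessed parent. *)
Definition list0 (h : nat) (s : state) (y : nat) : nat :=
  if arr s aLev y == h.+1 then
    if arr s aPar y == y then arr s aG y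
    else if arr s aG (arr s aPar y) == 1 then 2 else 1
  else arr s aL0 y.

Definition list1 (h : nat) (s : state) (y : nat) : nat :=
  if arr s aLev y == h.+1 then
    if arr s aPar y == y then arr s aG y
    else if arr s aG (arr s aPar y) == 3 then 2 else 3
  else arr s aL1 y.

Section Graph.

Variables (n : nat) (nb : nat -> seq nat).
Hypothesis nb_lt : forall x y, y \in nb x -> (x < n) && (y < n).
Hypothesis nb_sym : forall x y, (y \in nb x) = (x \in nb y).
Hypothesis nb_irr : forall x, x \notin nb x.
Hypothesis nb_uniq : forall x, uniq (nb x).

Notation eg := (edge nb).
Notation vl := (vol nb).
Let eg_sym := edge_sym nb_sym.

Section Component.

Variables (HL : seq nat).
Hypothesis uHL : uniq HL.
Hypothesis ltHL : forall x, x \in HL -> x < n.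
Hypothesis clHL : forall x y, x \in HL -> eg x y -> y \in HL.

Section Lists.

Variables (l0 l1 : nat -> nat).
Hypothesis l_gt0 : forall y, y \in HL -> 0 < l0 y /\ 0 < l1 y.

Notation list_coloring := (list_coloring nb HL l0 l1).

Definition list_of (i : bool) := if i then l1 else l0.

Section Race.

Variables (x : nat) (col : nat -> nat) (off : nat -> nat).
Hypothesis off_S : forall x, x < n -> off x.+1 = off x + size (nb x).
Hypothesis xHL : x \in HL.

Notation running := (running nb HL off col l0 l1).

Definition status (c N : nat) (t : thread) : Prop :=
  (th_cf t = 0 /\ exists Q pre, running x c N t Q pre) \/
  (th_cf t = 1 /\ (exists Q, queue N t Q) /\ forall f, list_coloring f -> f x <> c).

Lemma status_queue c N t : status c N t -> exists Q, queue N t Q.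
Proof. by case=> [[_ [Q [pre []]]]|[_ [? _]]] //; exists Q. Qed.

Lemma statusW c N t : th_cf t = 1 -> status c N t -> status c N.+1 t.
Proof.
move=> E [[]|]; first by rewrite E.
case=> _ [[Q [H1 H2 H3 H4]] Hf]; right; split=> //; split=> //; exists Q; split=> //.
exact: leqW.
Qed.

Lemma status_cf c N t : status c N t -> th_cf t = 0 \/ th_cf t = 1.
Proof. by case=> [[]|[]]; [left|right]. Qed.

Lemma vl_gt0 Q y : y \in Q -> 0 < vl Q.
Proof. by move=> Hy; rewrite /vol (perm_big _ (perm_to_rem Hy)) big_cons. Qed.

Lemma running_lt c N t Q pre : running x c N t Q pre -> N <= vl Q.
Proof.
case=> H1 H2 H3 H4 H5 H6 H7 H8 -> H10.
rewrite -{2}(cat_take_drop (th_hd t) Q) /vol big_cat leq_add2l.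
move: H10; case: ltnP => [Hlt|_ ->] // [_ [post E]].
rewrite (drop_nth 0) // big_cons E size_cat.
by apply: leq_trans (leq_addr _ _); rewrite -addnS leq_addr.
Qed.

Lemma running_sub c N t Q pre : running x c N t Q pre -> vl Q <= vl HL.
Proof. by move=> R; apply: vol_sub; [exact: ru_uniq R|move=> y /(ru_Q R)[]]. Qed.

(** What a finished propagation leaves behind: its colors occur in no list of an uncolored neighbor
    outside [Q], so they can be kept whatever follows. *)
Record closed_part (Q : seq nat) (v : nat -> nat) : Prop := ClosedPart {
  cp_uniq : uniq Q;
  cp_x : x \in Q;
  cp_Q : forall y, y \in Q -> [/\ y \in HL, col y = 0, 0 < v y &
     v y = l0 y \/ v y = l1 y];
  cp_closed : forall z y, z \in Q -> eg z y -> safe col l0 l1 Q v z y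
}.

Lemma running_finished c N t Q pre : running x c N t Q pre -> th_tl t <= th_hd t ->
  N = vl Q /\ closed_part Q (th_v t).
Proof.
case=> [[H1 H2 H3 H4] H5 H6 H7 [H8 H9] H10 H11 H12 H13 H14].
rewrite H2 => Hle; move: H14; rewrite ltnNge Hle /= => pre0.
by rewrite take_oversize // pre0 addn0 in H13 H11; split.
Qed.

Lemma running_start c v q : (forall y, y != x -> v y = 0) -> v x = c -> q 0 = x ->
  col x = 0 -> 0 < c -> c = l0 x \/ c = l1 x ->
  running x c 0 (Thread v q 0 1 (off x) 0) [:: x] [::].
Proof.
move=> v0 vx q0 Cx c_gt0 Hc; split=> //=.
- by split=> //= [[|]//|y]; rewrite inE => /v0.
- by move=> y; rewrite inE => /eqP->; rewrite vx.
- by rewrite mem_head.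
- by move=> f _ fx y; rewrite inE => /eqP->; rewrite vx.
- by rewrite /vol big_nil.
- by rewrite addn0; split=> //; exists (nb x).
Qed.

End Race.
End Lists.

Section Propagate.

Variables (l0 l1 : nat -> nat).
Hypothesis l_gt0 : forall y, y \in HL -> 0 < l0 y /\ 0 < l1 y.

Notation list_coloring := (list_coloring nb HL l0 l1).

Definition list_state (s : state) : Prop :=
  [/\ repr_graph n nb s, arr s aL0 = l0 & arr s aL1 = l1].

Lemma advance_den i s :
  den (advance i) s = if th_cf (view i s) == 0 then den (step_thread i) s else s.
Proof. by []. Qed.

Lemma advance_view i s : view i (den (advance i) s) = if th_cf (view i s) == 0
  then step_th (arr s 0) (arr s 1) (arr s aCol) (arr s aL0) (arr s aL1) (view i s)
  else view i s.
Proof. by rewrite advance_den; case: ifP => // _; rewrite step_view. Qed.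

Lemma advance_other i j s : j != i -> view j (den (advance i) s) = view j s.
Proof.
move=> ji; have -> : j = ~~ i by case: i j ji => [] [].
by rewrite advance_den; case: ifP => // _; rewrite step_view_other.
Qed.

Lemma advance_arr i s b : b \in [:: 0; 1; aCol; aL0; aL1] ->
  arr (den (advance i) s) b = arr s b.
Proof.
rewrite advance_den; case: ifP => // _; rewrite !inE.
by case: i => /or4P[/eqP->|/eqP->|/eqP->|/orP[]/eqP->]; rewrite /= /upd /=;
  do !case: ifP => //= ?.
Qed.

(** As long as some propagation runs without conflict, [N] is at most the volume of its queue, and
    so of the component; this bounds the race. *)
Lemma race_ok x s : list_state s -> x \in HL ->
  (forall i, status l0 l1 x (arr s aCol) (arr s 0) (list_of l0 l1 i x) 0 (view i s)) ->
  wp race s (fun s' k => exists N, [/\ k <= 400 * N + 40,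
    forall i, status l0 l1 x (arr s aCol) (arr s 0) (list_of l0 l1 i x) N (view i s')
    & N <= vl HL + 1 /\ [|| beval s' (finished false), beval s' (finished true)
       | (reg s' (rCf false) == 1) && (reg s' (rCf true) == 1)]]).
Proof.
move=> [Hg E0 E1] xHL H0; case: (Hg) => Hoff Hadj.
apply: (wp_while (Inv := fun s1 u => exists N, [/\ u <= 400 * N, N <= vl HL + 1
   & forall i, status l0 l1 x (arr s aCol) (arr s 0) (list_of l0 l1 i x) N (view i s1)])
   (bound := 400 * (vl HL + 1))).
- move=> s1 u _ [N [Hu HN _]]; apply: leq_trans Hu _; by rewrite leq_mul2l.
- move=> s1 u [_ A] [N [Hu HN St]] G.
  have arrE b : b \in [:: 0; 1; aCol; aL0; aL1] -> arr s1 b = arr s b.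
    by move=> Hb; apply: A; move: Hb; rewrite !inE => /or4P[/eqP->|/eqP->|/eqP->|/orP[]/eqP->].
  apply: wp_den => // k Hk.
  have W0 := advance_other s1 (isT : true != false).
  have W1 := advance_view true (den (advance false) s1).
  have V0 := advance_view false s1.
  have V1 := advance_other (den (advance false) s1) (isT : false != true).
  rewrite W0 !advance_arr // in W1; rewrite !arrE // E0 E1 in V0 W1.
  rewrite [den _ _]/(den (advance true) (den (advance false) s1)).
  have lt_run i : th_cf (view i s1) = 0 -> th_hd (view i s1) < th_tl (view i s1).
    move: G => /= /andP[G1 /andP[G2 _]].
    by case: i => /= E; [move: G2|move: G1]; rewrite E /= negbK.
  have St' i : th_cf (view i s1) = 0 -> N <= vl HL /\
      status l0 l1 x (arr s aCol) (arr s 0) (list_of l0 l1 i x) N.+1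
      (step_th (arr s 0) (arr s 1) (arr s aCol) l0 l1 (view i s1)).
    move=> E; have Hlt := lt_run _ E; case: (St i) => [[_ [Q [pre Ru]]]|[]]; last by rewrite E.
    have hdQ : th_hd (view i s1) < size Q by rewrite -(qu_tl (ru_queue Ru)).
    split; first exact: leq_trans (running_lt Ru) (running_sub Ru).
    exact: (step_th_ok ltHL clHL Hoff Hadj l_gt0 E Ru hdQ).
  have [i0 Ei0] : exists i, th_cf (view i s1) = 0.
    case: (status_cf (St false)) => [|F0]; first by exists false.
    case: (status_cf (St true)) => [|F1]; first by exists true.
    by move: G; rewrite /=; rewrite /= in F0 F1; rewrite F0 F1 /= ?andbF.
  exists N.+1; split.
  + have {}Hk : k <= 102 by exact: Hk. by move: Hu Hk; set m := bcost _; have -> : m = 28 by []; clear; lia.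
  + by have [HN' _] := St' _ Ei0; rewrite addn1 ltnS.
  + have C i : status l0 l1 x (arr s aCol) (arr s 0) (list_of l0 l1 i x) N.+1
        (if th_cf (view i s1) == 0
         then step_th (arr s 0) (arr s 1) (arr s aCol) l0 l1 (view i s1) else view i s1).
      case: (status_cf (St i)) => E; rewrite E /=; first by case: (St' _ E).
      exact: statusW.
    by case; [rewrite W1; apply: (C true)|rewrite V1 V0; apply: (C false)].
- move=> s1 u _ [N [Hu HN St]] G; exists N; split=> //.
    by move: Hu; rewrite /=; clear; lia.
  split=> //; move: G.
  rewrite -[beval s1 (And _ _)]/(~~ beval s1 (finished false) &&
    (~~ beval s1 (finished true) && ~~ ((reg s1 (rCf false) == 1) && (reg s1 (rCf true) == 1)))).
  move: (beval s1 (finished false)) (beval s1 (finished true)) (_ == 1) (_ == 1).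
  by do 4!case.
- by exists 0; split.
Qed.

Lemma commit_ok i s Q : repr_list (aQu i) (rTl i) s Q ->
  wpb (commit i) s (20 * size Q + 6) (fun s' => forall y, arr s' aCol y =
    if y \in Q then arr s (aV i) y else arr s aCol y).
Proof.
move=> HQ; apply: (wpb_for_list (I := fun pre s' => forall y, arr s' aCol y =
  if y \in pre then arr s (aV i) y else arr s aCol y) (cb := fun=> 10) HQ) => //.
1-3: by case: i {HQ}.
- move=> pre z post s1 k E [_ A] HI; apply: wpb_den => // y.
  have EV : arr s1 (aV i) = arr s (aV i) by apply: A; case: i {HQ E HI}.
  rewrite /= /upd /= EV mem_rcons inE HI.
  by case: (eqVneq y z) => [->|].
- by rewrite big_const_seq count_predT iter_addn; clear; lia.
Qed.

Lemma erase_ok i s Q : repr_list (aQu i) (rTl i) s Q ->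
  wpb (erase i) s (20 * size Q + 6) (fun s' => forall y, arr s' (aV i) y =
    if y \in Q then 0 else arr s (aV i) y).
Proof.
move=> HQ; apply: (wpb_for_list (I := fun pre s' => forall y, arr s' (aV i) y =
  if y \in pre then 0 else arr s (aV i) y) (cb := fun=> 10) HQ) => //.
1-3: by case: i {HQ}.
- move=> pre z post s1 k E [_ A] HI; apply: wpb_den => // y.
  rewrite /= /upd /= eqxx mem_rcons inE HI.
  by case: (eqVneq y z) => [->|].
- by rewrite big_const_seq count_predT iter_addn; clear; lia.
Qed.

Lemma init_view s i x : reg s rX = x ->
  view i (den (init_thread false ;; init_thread true) s) =
  Thread (upd (arr s (aV i)) x (list_of (arr s aL0) (arr s aL1) i x))
    (upd (arr s (aQu i)) 0 x) 0 1 (arr s 0 x) 0.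
Proof. by move=> <-; case: i. Qed.

(** When a propagation finishes, [N] is exactly the volume of its queue [Q], so the work of both is
    charged to vertices that are now colored for good. If both run into a conflict, neither color of
    [x] extends to a list coloring. *)
Lemma propagate_ok s x : list_state s -> x \in HL -> reg s rX = x ->
  arr s aCol x = 0 -> (forall i y, arr s (aV i) y = 0) ->
  wp propagate s (fun s' k => (forall i y, arr s' (aV i) y = 0) /\
    ((reg s' rBad = reg s rBad /\ exists Q v, [/\ closed_part l0 l1 x (arr s aCol) Q v,
       forall y, arr s' aCol y = if y \in Q then v y else arr s aCol y
       & k <= 1000 * vl Q]) \/
     [/\ reg s' rBad = 1, arr s' aCol = arr s aCol, forall f, ~ list_coloring f
       & k <= 1000 * vl HL + 1000])).
Proof.
move=> Ls xHL Ex Cx V0; case: (Ls) => Hg E0 E1; have [Hoff Hadj] := Hg.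
have [l0x l1x] := l_gt0 xHL.
apply: (wp_seq (Q1 := fun s1 k => k <= 40 /\ forall i, view i s1 =
    Thread (upd (arr s (aV i)) x (list_of l0 l1 i x)) (upd (arr s (aQu i)) 0 x)
      0 1 (arr s 0 x) 0)).
  apply: wp_den => // k Hk; split; first exact: leq_trans Hk _.
  move=> i.
  by rewrite (init_view i Ex) E0 E1.
move=> s1 k1 [R1 A1] [Hk1 V1].
have A1E b : b \in [:: 0; 1; aCol; aL0; aL1] -> arr s1 b = arr s b.
  by move=> Hb; apply: A1; move: Hb; rewrite !inE => /or4P[/eqP->|/eqP->|/eqP->|/orP[]/eqP->].
have Ls1 : list_state s1.
  by split; rewrite ?A1E //; apply: repr_graph_eq Hg; rewrite A1E.
have H0 i : status l0 l1 x (arr s1 aCol) (arr s1 0) (list_of l0 l1 i x) 0 (view i s1).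
  left; rewrite V1; split=> //; exists [:: x], [::]; rewrite !A1E //.
  apply: running_start; rewrite // /upd ?eqxx //.
  - by move=> y /negbTE->.
  - by case: i.
  - by case: i; [right|left].
apply: (wp_seq (race_ok Ls1 xHL H0)) => s2 k2 [R2 A2] [N [Hk2 St [HN Fin]]].
rewrite !A1E // in St.
have A2E b : b \in [:: 0; 1; aCol; aL0; aL1] -> arr s2 b = arr s b.
  by move=> Hb; rewrite -A1E //; apply: A2; move: Hb; rewrite !inE => /or4P[/eqP->|/eqP->|/eqP->|/orP[]/eqP->].
have [Q0 HQ0] := status_queue (St false).
have [Q1 HQ1] := status_queue (St true).
pose Qu i := if i then Q1 else Q0.
have HQu i : queue N (view i s2) (Qu i) by case: i.
have rQ i : repr_list (aQu i) (rTl i) s2 (Qu i).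
  by split; [exact: qu_tl (HQu i)|exact: qu_q (HQu i)].
have fin i : beval s2 (finished i) -> N = vl (Qu i) /\ closed_part l0 l1 x (arr s aCol) (Qu i) (arr s2 (aV i)).
  rewrite /= -leqNgt => /andP[/eqP cf0 Hle].
  case: (St i) => [[_ [Q [pre Ru]]]|[]]; last by rewrite /= cf0.
  have -> : Qu i = Q.
    have HQ := ru_queue Ru.
    apply: (@eq_from_nth _ 0); first by rewrite -(qu_tl (HQu i)) (qu_tl HQ).
    move=> j Hj; rewrite -(qu_q (HQu i)) //; apply: (qu_q HQ).
    by rewrite -(qu_tl HQ) (qu_tl (HQu i)).
  exact: (running_finished Ru).
pose good s' := reg s' rBad = reg s rBad /\ exists Q v,
  [/\ closed_part l0 l1 x (arr s aCol) Q v, N = vl Q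
    & forall y, arr s' aCol y = if y \in Q then v y else arr s aCol y].
pose bad s' := [/\ reg s' rBad = 1, arr s' aCol = arr s aCol
  & forall f, ~ list_coloring f].
have bad12 : reg s2 rBad = reg s rBad by rewrite R2 ?R1.
have committed i : beval s2 (finished i) -> wpb (commit i) s2 (20 * N.+1 + 6)
    (fun s' => good s' \/ bad s').
  move=> Fi; have [EN Cl] := fin i Fi.
  apply: (wpb_cons (commit_ok (rQ i))); first by have := qu_size (HQu i); clear; lia.
  move=> s' [R _] H; left; split; first by rewrite R //; case: (i).
  by exists (Qu i), (arr s2 (aV i)); split=> // y; rewrite H (A2E aCol).
have W : wpb (If (finished false) (commit false)
    (If (finished true) (commit true) (Assign rBad (Const 1)))) s2 (20 * N.+1 + 40)
    (fun s' => good s' \/ bad s').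
  apply: (wpb_if (m := 20 * N.+1 + 20)).
  - by move=> F; apply: (wpb_cons (committed _ F)) => //; clear; lia.
  - move=> F0; apply: (wpb_if (m := 20 * N.+1 + 6)).
    + exact: committed.
    + move=> F1; apply: wpb_den => //; first by rewrite /=; clear; lia.
      move: Fin; rewrite (negbTE F0) (negbTE F1) => /andP[/eqP C0 /eqP C1].
      right; split; [by []|by rewrite /= A2E|].
      case: (St false) => [[]|[_ [_ U0]]]; first by rewrite /= C0.
      case: (St true) => [[]|[_ [_ U1]]]; first by rewrite /= C1.
      move=> f Hf; case: (Hf) => /(_ x xHL) [Ef|Ef] _.
        exact: U0 f Hf Ef.
      exact: U1 f Hf Ef.
    + by rewrite /=; clear; lia.
  - by rewrite /=; clear; lia.
apply: (wp_seq W) => s3 k3 S3 [Hk3 H3].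
have A3 b : b != aCol -> arr s3 b = arr s2 b.
  by case: S3 => _ A Hb; apply: A; rewrite /= !inE (negbTE Hb).
have rQ3 i : repr_list (aQu i) (rTl i) s3 (Qu i).
  case: (rQ i) => T1 T2; split; last by move=> j Hj; rewrite A3 ?T2 //; case: (i).
  by rewrite -T1; case: S3 => R _; apply: R; case: (i).
apply: (wp_seq (erase_ok (rQ3 false))) => s4 k4 S4 [Hk4 H4].
have rQ4 : repr_list (aQu true) (rTl true) s4 (Qu true).
  case: (rQ3 true) => T1 T2; case: S4 => R A.
  split; first by rewrite -T1; apply: R.
  by move=> j Hj; rewrite -T2 // A.
apply: (wp_cons (erase_ok rQ4)) => s5 k5 S5 [Hk5 H5].
have Vz i y : (if y \in Qu i then 0 else arr s3 (aV i) y) = 0.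
  case: ifP => // /negbT Hy; rewrite A3; last by case: (i).
  exact: qu_out (HQu i) y Hy.
have [R5 A5] := S5; have [R4 A4] := S4.
have EC : arr s5 aCol = arr s3 aCol by rewrite A5 // A4.
have EB : reg s5 rBad = reg s3 rBad by rewrite R5 // R4.
have Hcost : k1 + (k2 + (k3 + (k4 + k5))) <= 500 * N + 300.
  have := qu_size (HQu false); have := qu_size (HQu true).
  by move: Hk1 Hk2 Hk3 Hk4 Hk5; clear; lia.
split.
  case=> y; last by rewrite A5 // H4 Vz.
  by rewrite H5 -[RHS](Vz true y) A4.
case: H3 => [[B [Q [v [Cl EN HC]]]]|[B HC U]]; [left|right].
  rewrite EB B; split=> //; exists Q, v; split=> //; first by rewrite EC.
  have : 0 < vl Q by apply: vl_gt0 (cp_x Cl).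
  by move: Hcost; rewrite EN; clear; lia.
by split; rewrite ?EB ?EC //; move: Hcost HN; clear; lia.
Qed.

End Propagate.
Section Sweep.

Variables (l0 l1 : nat -> nat).
Hypothesis l_gt0 : forall y, y \in HL -> 0 < l0 y /\ 0 < l1 y.

(** Colored vertices take nothing away from the lists of uncolored ones; hence there is no
    backtracking. *)
Definition partial (col : nat -> nat) : Prop := forall y, y \in HL -> col y != 0 ->
  (col y = l0 y \/ col y = l1 y) /\ forall z, eg y z ->
    if col z == 0 then col y <> l0 z /\ col y <> l1 z else col y <> col z.

Lemma partial_extend x col Q v col' : partial col -> closed_part l0 l1 x col Q v ->
  (forall y, col' y = if y \in Q then v y else col y) -> partial col'.
Proof.
move=> P [uQ _ HQ Cl] E y Hy; rewrite E; case: ifP => yQ Cy.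
  have [_ Cy0 _ Ly] := HQ y yQ; split=> // z yz; rewrite E.
  have := Cl y z yQ yz; rewrite /safe; case: ifP => zQ.
    have [_ -> vz _] := HQ z zQ; rewrite /= (gtn_eqF vz) => /eqP N E1.
    by apply: N.
  case: (eqVneq (col z) 0) => [_ /= /andP[/eqP N0 /eqP N1] //|Cz _ Eyz].
  have zHL := clHL Hy yz.
  have [_ /(_ y)] := P z zHL Cz; rewrite eg_sym Cy0 eqxx => /(_ yz) [N0 N1].
  by case: Ly => Ly; [apply: N0|apply: N1]; rewrite -Ly -Eyz.
have [Ly Hz] := P y Hy Cy; split=> // z yz; have := Hz z yz.
rewrite E; case: (boolP (z \in Q)) => // zQ.
have [_ -> vz [Lz|Lz]] := HQ z zQ; rewrite eqxx (gtn_eqF vz) => -[N0 N1].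
  by rewrite Lz.
by rewrite Lz.
Qed.

Lemma vol_extend x col Q v col' : closed_part l0 l1 x col Q v ->
  (forall y, col' y = if y \in Q then v y else col y) ->
  vl [seq y <- HL | col y != 0] + vl Q <= vl [seq y <- HL | col' y != 0].
Proof.
move=> [uQ _ HQ _] E; rewrite /vol -big_cat; apply: sum_uniq_sub.
  rewrite cat_uniq filter_uniq // uQ andbT; apply/hasPn => y /HQ[_ Cy _ _].
  by rewrite mem_filter Cy.
move=> y; rewrite mem_cat !mem_filter => /orP[/andP[Cy Hy]|yQ]; rewrite E.
  by rewrite Hy andbT; case: ifP => // /HQ[_ C0]; rewrite C0 in Cy.
by have [-> _ vy _] := HQ y yQ; rewrite yQ -lt0n vy.
Qed.

(** The successful propagations cost the volume of what they color. An unsuccessful one occurs at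
    most once, since [rBad] then switches off the rest of the sweep. *)
Lemma sweep_ok s : list_state l0 l1 s -> repr_list aHL rHN s HL ->
  (forall i y, arr s (aV i) y = 0) -> reg s rBad = 0 ->
  (forall y, y \in HL -> arr s aCol y = 0) ->
  wpb (for_HL (If (And (Eq (Reg rBad) (Const 0)) (Eq (rd aCol rX) (Const 0))) propagate Skip))
    s (2100 * vl HL + 1100) (fun s' =>
    [/\ forall i y, arr s' (aV i) y = 0, forall y, y \notin HL -> arr s' aCol y = arr s aCol y
      & (reg s' rBad = 0 /\ list_coloring nb HL l0 l1 (arr s' aCol)) \/
        (reg s' rBad = 1 /\ forall f, ~ list_coloring nb HL l0 l1 f)]).
Proof.
move=> Ls HHL V0 B0 C0.
have szHL : size HL <= vl HL by rewrite /vol -sum1_size; apply: leq_sum.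
pose I pre s1 u := [/\ forall i y, arr s1 (aV i) y = 0,
  forall y, y \notin HL -> arr s1 aCol y = arr s aCol y, size pre <= size HL
  & [/\ reg s1 rBad = 0, partial (arr s1 aCol), forall y, y \in pre -> arr s1 aCol y != 0
       & u <= 1000 * vl [seq y <- HL | arr s1 aCol y != 0] + 60 * size pre] \/
    [/\ reg s1 rBad = 1, forall f, ~ list_coloring nb HL l0 l1 f
       & u <= 2000 * vl HL + 1000 + 60 * size pre]].
have vlF col : vl [seq y <- HL | col y != 0] <= vl HL.
  by apply: vol_sub; [apply: filter_uniq|move=> y; rewrite mem_filter => /andP[]].
apply: (wp_for_list (I := I) (bound := 3000 * vl HL + 1000) HHL) => //.
- move=> pre s1 u [_ _ Hsz]; have := vlF (arr s1 aCol).
  by move: szHL Hsz => H1 H2 H3 [[_ _ _ H]|[_ _ H]]; move: H1 H2 H3 H;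
    move: (vl (filter _ _)) (vl HL); clear; lia.
- move=> k; split=> //; left; split=> //.
  by move=> y Hy; rewrite /= C0.
- move=> pre z post s1 u k E [R A] [V1 Out Hsz Hst].
  have zHL : z \in HL by rewrite E mem_cat mem_head orbT.
  have Hsz' : size (rcons pre z) <= size HL.
    by rewrite E size_rcons size_cat /=; clear; lia.
  set s1' := set_reg _ rI k.
  have Ls1 : list_state l0 l1 s1'.
    case: Ls => Hg E0 E1; split; [|by rewrite -E0; apply: A|by rewrite -E1; apply: A].
    by apply: repr_graph_eq Hg; apply: A.
  apply: wp_if => [/andP[/eqP B1 /eqP Cz]|G].
    have {}B1 : reg s1 rBad = 0 := B1.
    case: Hst => [[_ P1 Pre Hu]|[]]; last by rewrite B1.
    apply: (wp_cons (propagate_ok l_gt0 Ls1 zHL erefl Cz V1)) => s2 k2 _ [V2 H2].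
    split=> //.
      move=> y Hy; rewrite -Out //.
      case: H2 => [[_ [Q [v [Cl -> _]]]]|[_ -> _ _]] //.
      by case: ifP => // /(cp_Q Cl) []; rewrite (negbTE Hy).
    rewrite size_rcons; case: H2 => [[B2 [Q [v [Cl HC Hk2]]]]|[B2 HC U Hk2]].
      left; split; first by rewrite B2.
      + exact: partial_extend P1 Cl HC.
      + move=> y; rewrite mem_rcons inE HC => /orP[/eqP->|Hy].
          by rewrite (cp_x Cl) -lt0n; have [] := cp_Q Cl (cp_x Cl).
        by case: ifP => [/(cp_Q Cl)[_ _]|_]; rewrite -?lt0n // lt0n; apply: Pre.
      + have := vol_extend Cl HC; rewrite -[arr s1' _]/(arr s1 _) [bcost _]/=.
        by move: Hu Hk2; clear; move: (vl _) (vl _) (vl _); lia.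
    right; split=> //; have := vlF (arr s1 aCol); rewrite [bcost _]/=.
    by move: Hu Hk2; clear; lia.
  apply: wp_den => // k2 Hk2; split=> //; rewrite size_rcons [bcost _]/=.
  case: Hst => [[B1 P1 Pre Hu]|[B1 U Hu]]; [left|right]; split=> //.
  + move=> y; rewrite mem_rcons inE => /orP[/eqP->|/Pre //].
    by apply: contraNN G => /= Cz; rewrite Cz /upd /= B1.
  + rewrite -[arr (den _ _) _]/(arr s1 aCol).
    by move: Hu Hk2; rewrite [maxcost _]/=; clear; move: (vl _); lia.
  + by move: Hu Hk2; rewrite [maxcost _]/=; clear; lia.
- move=> s1 u _ [V1 Out Hsz Hst]; have vF := vlF (arr s1 aCol); split.
    by case: Hst => [[_ _ _ H]|[_ _ H]]; move: H szHL vF;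
      move: (vl (filter _ _)) (vl HL) (size HL); clear => v w z; lia. 
  split=> //; case: Hst => [[B1 P Pre _]|[B1 U _]]; [left|right]; split=> //; split.
    by move=> y Hy; have [] := P y Hy (Pre y Hy).
  move=> y z Hy yz; have [_ /(_ z yz)] := P y Hy (Pre y Hy).
  by rewrite (negbTE (Pre z (clHL Hy yz))) => /eqP.
Qed.

End Sweep.

Lemma set_lists_ok h s : repr_list aHL rHN s HL ->
  wpb (for_HL (set_lists h)) s (50 * vl HL + 6) (fun s' => forall y,
    [/\ arr s' aL0 y = (if y \in HL then list0 h s y else arr s aL0 y),
        arr s' aL1 y = (if y \in HL then list1 h s y else arr s aL1 y)
      & arr s' aCol y = if y \in HL then 0 else arr s aCol y]).
Proof.
move=> HHL; apply: (wpb_for_HL (nb := nb) (HL := HL) (K := 40) (I := fun pre s' => forall y,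
    [/\ arr s' aL0 y = (if y \in pre then list0 h s y else arr s aL0 y),
        arr s' aL1 y = (if y \in pre then list1 h s y else arr s aL1 y)
      & arr s' aCol y = if y \in pre then 0 else arr s aCol y])) => //.
move=> pre z post s1 k E [_ A] HI; apply: wpb_den => //.
  by rewrite /=; clear; lia.
have zpre : z \notin pre by move: uHL; rewrite E cat_uniq /= negb_or => /and3P[_ /andP[]].
have [EL EP EG] : [/\ arr s1 aLev = arr s aLev, arr s1 aPar = arr s aPar & arr s1 aG = arr s aG].
  by split; apply: A.
move=> y; rewrite mem_rcons inE; have [I0 I1 I2] := HI y.
rewrite /= /upd /= EL EP EG; case: (eqVneq y z) I0 I1 I2 => [->|Nyz] I0 I1 I2 /=.
  rewrite (negbTE zpre) in I0 I1 I2.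
  rewrite /list0 /list1.
  case: ifP => _ /=; last by rewrite /upd /= eqxx I0 I1.
  case: ifP => _ /=; first by rewrite /upd /= eqxx ?EG.
  by case: (_ == 1); rewrite /= /upd /= EP EG; case: (_ == 3); rewrite /= /upd /= eqxx.
case: (_ == h.+1) => /=; last by rewrite /upd /= (negbTE Nyz) I0 I1.
case: (_ == z) => /=; first by rewrite /upd /= (negbTE Nyz) I0 I1.
by case: (_ == 1); rewrite /= /upd /= EP EG; case: (_ == 3); rewrite /= /upd /= (negbTE Nyz).
Qed.

Lemma list_coloring_eq l0 l1 l0' l1' f f' :
  (forall y, y \in HL -> [/\ l0' y = l0 y, l1' y = l1 y & f' y = f y]) ->
  list_coloring nb HL l0 l1 f -> list_coloring nb HL l0' l1' f'.
Proof.
move=> E [Hl Hp]; split=> [y Hy|y z Hy yz].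
  by have [-> -> ->] := E y Hy; apply: Hl.
by have [_ _ ->] := E y Hy; have [_ _ ->] := E z (clHL Hy yz); apply: Hp.
Qed.

Lemma solve_ok h s : repr_graph n nb s -> repr_list aHL rHN s HL ->
  (forall i y, arr s (aV i) y = 0) ->
  (forall y, y \in HL -> 0 < list0 h s y /\ 0 < list1 h s y) ->
  wpb (solve h) s (2200 * vl HL + 1200) (fun s' =>
    [/\ forall i y, arr s' (aV i) y = 0, forall y, y \notin HL -> arr s' aCol y = arr s aCol y,
        forall y, y \in HL -> arr s aLev y != h.+1 ->
          arr s' aL0 y = arr s aL0 y /\ arr s' aL1 y = arr s aL1 y
      & (reg s' rDone = 1 /\ list_coloring nb HL (list0 h s) (list1 h s) (arr s' aCol)) \/
        (reg s' rDone = reg s rDone /\ forall f, ~ list_coloring nb HL (list0 h s) (list1 h s) f)]).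
Proof.
move=> Hg HHL V0 lpos.
apply: (wpb_seq (b1 := 10) (P1 := fun s1 => s1 = set_reg s rBad 0)
  (b2 := 2200 * vl HL + 1190)); first by apply: wpb_den.
  move=> s1 _ ->.
  have HHL1 : repr_list aHL rHN (set_reg s rBad 0) HL by [].
  apply: (wpb_seq (set_lists_ok h HHL1) (b2 := 2100 * vl HL + 1150)); last first.
    by clear; lia.
  move=> s2 [R2 A2] H2.
  have l_gt0 y : y \in HL -> 0 < arr s2 aL0 y /\ 0 < arr s2 aL1 y.
    by move=> Hy; have [-> -> _] := H2 y; rewrite Hy; apply: lpos.
  have V2 i y : arr s2 (aV i) y = 0 by rewrite A2 ?V0 //; case: (i).
  have Ls2 : list_state (arr s2 aL0) (arr s2 aL1) s2.
    by split=> //; apply: repr_graph_eq Hg; rewrite A2.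
  have HHL2 : repr_list aHL rHN s2 HL.
    by case: HHL => T1 T2; split; [rewrite R2|move=> j Hj; rewrite A2 ?T2].
  have C2 y : y \in HL -> arr s2 aCol y = 0 by move=> Hy; have [_ _ ->] := H2 y; rewrite Hy.
  have B2 : reg s2 rBad = 0 by rewrite R2.
  apply: (wpb_seq (sweep_ok l_gt0 Ls2 HHL2 V2 B2 C2) (b2 := 50)); last by clear; lia.
  move=> s3 [R3 A3] [V3 Out3 H3]; apply: wpb_den => //.
  have E4 b : arr (den (If (Eq (Reg rBad) (Const 0)) (Assign rDone (Const 1)) Skip) s3) b = arr s3 b.
    by rewrite /=; case: ifP.
  split.
  - by move=> i y; rewrite E4.
  - by move=> y Hy; rewrite E4 Out3 //; have [_ _ ->] := H2 y; rewrite (negbTE Hy).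
  - move=> y Hy Ly; rewrite !E4 !A3 //; have [-> -> _] := H2 y; rewrite Hy.
    by rewrite /list0 /list1 /= (negbTE Ly).
  - case: H3 => [[B3 Lc]|[B3 U]]; [left|right]; split.
    + by rewrite /= B3.
    + rewrite E4; apply: list_coloring_eq Lc => y Hy.
      by have [-> -> _] := H2 y; rewrite Hy.
    + by rewrite /= B3 R3 // R2.
    + move=> f Hf; apply: (U f); apply: list_coloring_eq Hf => y Hy.
      by have [-> -> _] := H2 y; rewrite Hy.
by clear; lia.
Qed.

End Component.
End Graph.


(** * Connected components *)

(** The recursion unfolds in the program text, which is fixed once [h] is. The test against [rSn]
    skips the positions beyond the actual size of [S]. *)
Fixpoint enum_guesses (h j : nat) : cmd :=
  if j is j'.+1 then
    If (Lt (Const j') (Reg rSn))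
      (Write aG (Read aS (Const j')) (Const 1) ;; enum_guesses h j' ;;
       Write aG (Read aS (Const j')) (Const 2) ;; enum_guesses h j' ;;
       Write aG (Read aS (Const j')) (Const 3) ;; enum_guesses h j')
      (enum_guesses h j')
  else If (Eq (Reg rDone) (Const 0)) (solve h) Skip.

Lemma enum_same h j s s' :
  same (modr (enum_guesses h j)) (moda (enum_guesses h j)) s s' ->
  same (modr (solve 0)) (aG :: moda (solve 0)) s s'.
Proof.
apply: same_sub; elim: j => [|j IH] a.
- by move=> H; have : a \in modr (solve 0) ++ [::] := H; rewrite cats0.
- set M := modr (enum_guesses h j) in IH *.
  move=> H; have : a \in (M ++ M ++ M) ++ M := H => {}H.
  by rewrite !mem_cat !orbb in H; apply: IH.
- move=> H; have : a \in moda (solve 0) ++ [::] := H; rewrite cats0 => {}H.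
  by apply/orP; right.
set M := moda (enum_guesses h j) in IH *.
move=> H; have : a \in (aG :: M ++ aG :: M ++ aG :: M) ++ M := H => {}H.
case: (eqVneq a aG) => [->|Na]; first exact: mem_head.
by rewrite !(inE, mem_cat) (negbTE Na) /= !orbb in H; apply: IH.
Qed.

(** Regroups right-associated sequences, so that writing a guess and the recursive call after it
    count as one block. *)
Lemma wpb_seqA c1 c2 c s b b' (Q Q' : state -> Prop) :
  wpb (c1 ;; c2) s b Q -> (forall s', Q s' -> wpb c s' b' Q') ->
  wpb (c1 ;; c2 ;; c) s (b + b') Q'.
Proof.
move=> [k1 [s2 [E [Hk HQ]]]] H; have [k2 [s3 [E' [Hk' HQ']]]] := H s2 HQ.
inversion E; subst; exists (k0 + (k3 + k2)), s3; split.
  by apply: ExecSeq; [eassumption|apply: ExecSeq; eassumption].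
by split=> //; move: Hk Hk'; clear; lia.
Qed.

Section Graph.

Variables (n : nat) (nb : nat -> seq nat).
Hypothesis nb_lt : forall x y, y \in nb x -> (x < n) && (y < n).
Hypothesis nb_sym : forall x y, (y \in nb x) = (x \in nb y).
Hypothesis nb_irr : forall x, x \notin nb x.
Hypothesis nb_uniq : forall x, uniq (nb x).

Notation eg := (edge nb).
Notation vl := (vol nb).
Let eg_sym := edge_sym nb_sym.

Section Component.

Variables (h : nat) (HL : seq nat).
Hypothesis uHL : uniq HL.
Hypothesis ltHL : forall x, x \in HL -> x < n.
Hypothesis clHL : forall x y, x \in HL -> eg x y -> y \in HL.
Variable c3 : nat -> nat.
Hypothesis c3_range : forall x, 0 < c3 x <= 3.
Hypothesis c3_proper : forall x y, eg x y -> c3 x != c3 y.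

Section Guess.

Variables (k : nat) (S : seq nat) (lev par m0 m1 f : nat -> nat).
Hypothesis k_gt2 : 2 < k.
Hypothesis m_range : forall y, y \in HL -> lev y != h.+1 ->
  0 < m0 y <= k /\ 0 < m1 y <= k.
Hypothesis par_S : forall y, y \in HL -> lev y = h.+1 ->
  par y \in S /\ (par y = y \/ eg y (par y)).
Hypothesis f_old : forall y, y \in HL -> lev y = h.+1 -> f y = c3 y.
Hypothesis f_list : forall y, y \in HL -> lev y != h.+1 -> f y = m0 y \/ f y = m1 y.
Hypothesis f_proper : forall y z, y \in HL -> eg y z -> f y != f z.

Definition good_col (s : state) : Prop :=
  (forall y, y \in HL -> 0 < arr s aCol y <= k) /\
  (forall y z, y \in HL -> eg y z -> arr s aCol y != arr s aCol z).

Record guessing (s : state) : Prop := Guessing {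
  gu_graph : repr_graph n nb s;
  gu_HL : repr_list aHL rHN s HL;
  gu_S : repr_list aS rSn s S;
  gu_V : forall i y, arr s (aV i) y = 0;
  gu_lev : arr s aLev = lev;
  gu_par : arr s aPar = par;
  gu_lists : forall y, y \in HL -> lev y != h.+1 ->
    arr s aL0 y = m0 y /\ arr s aL1 y = m1 y;
  gu_done : reg s rDone = 0 \/ reg s rDone = 1 /\ good_col s
}.

Definition enum_post (s : state) (U : seq nat) (s' : state) : Prop :=
  [/\ guessing s', forall y, y \notin HL -> arr s' aCol y = arr s aCol y,
      forall v, v \notin U -> arr s' aG v = arr s aG v
    & reg s rDone = 1 -> reg s' rDone = 1].

Definition guessed_in (P : nat -> nat -> bool) (U : seq nat) (s : state) : Prop :=
  forall v, v \in S -> v \notin U -> P v (arr s aG v).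

Notation valid := (guessed_in (fun=> fun g => 0 < g <= 3)).
Notation right := (guessed_in (fun v => fun g => g == c3 v)).

(** If the guess agrees with [c3] on [S], then [f] is a list coloring, and [solve] cannot report
    that none exists. With a wrong guess it may still succeed, and the coloring is then just as
    good. *)
Lemma enum_leaf s : guessing s -> valid [::] s ->
  wpb (enum_guesses h 0) s (2200 * vl HL + 1210) (fun s' =>
    enum_post s [::] s' /\ (right [::] s -> reg s' rDone = 1)).
Proof.
move=> Gs Va; have [Hg HHL HS V0 El Ep HL01 HD] := Gs.
have Va' v : v \in S -> 0 < arr s aG v <= 3 by move=> Hv; apply: Va.
apply: (wpb_if (m := 2200 * vl HL + 1200)) => [/eqP D0|/eqP D1|];
  last (by rewrite /=; clear; lia); last first.
- case: HD => [E|[D HG]]; first (by case: D1); apply: wpb_den => //; first by rewrite /=; clear; lia.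
- have rng0 y : y \in HL -> 0 < list0 h s y <= k.
    move=> Hy; rewrite /list0 El Ep; case: (eqVneq (lev y) h.+1) => [E|N].
      have [PS _] := par_S Hy E; case: (eqVneq (par y) y) => [E1|_].
        by have := Va' (par y) PS; rewrite E1 => /andP[-> /leq_trans]; apply.
      by case: ifP => _ /=; move: k_gt2; clear; lia.
    by have [-> _] := HL01 y Hy N; have [] := m_range Hy N.
  have rng1 y : y \in HL -> 0 < list1 h s y <= k.
    move=> Hy; rewrite /list1 El Ep; case: (eqVneq (lev y) h.+1) => [E|N].
      have [PS _] := par_S Hy E; case: (eqVneq (par y) y) => [E1|_].
        by have := Va' (par y) PS; rewrite E1 => /andP[-> /leq_trans]; apply.
      by case: ifP => _ /=; move: k_gt2; clear; lia.
    by have [_ ->] := HL01 y Hy N; have [] := m_range Hy N.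
  have lpos y : y \in HL -> 0 < list0 h s y /\ 0 < list1 h s y.
    by move=> Hy; case/andP: (rng0 y Hy) => -> _; case/andP: (rng1 y Hy) => ->.
  apply: (wpb_cons (solve_ok nb_sym uHL ltHL clHL Hg HHL V0 lpos)) => //.
  move=> s' [R A] [V' Out L' H'].
  have Gs' : (reg s' rDone = 0 \/ reg s' rDone = 1 /\ good_col s') -> guessing s'.
    move=> HD'; split=> //.
    + by apply: repr_graph_eq Hg; apply: A.
    + by case: HHL => T1 T2; split; [rewrite R|move=> j Hj; rewrite A ?T2].
    + by case: HS => T1 T2; split; [rewrite R|move=> j Hj; rewrite A ?T2].
    + by rewrite A.
    + by rewrite A.
    + by move=> y Hy N; have [|-> ->] := L' y Hy; [rewrite El|apply: HL01].
  split; last first.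
    move=> Ri; case: H' => [[]|[_ /(_ f)]] // []; split=> // y Hy.
    rewrite /list0 /list1 El Ep; case: (eqVneq (lev y) h.+1) => [E|N]; last first.
      by have [-> ->] := HL01 y Hy N; apply: f_list.
    rewrite f_old //; have [PS Py] := par_S Hy E.
    have /eqP EG := Ri (par y) PS isT; rewrite EG.
    case: (eqVneq (par y) y) EG => [->|Npy] EG; first by left.
    case: Py => [E1|/c3_proper]; first by rewrite E1 eqxx in Npy.
    have := c3_range y; have := c3_range (par y).
    by move: (c3 y) (c3 (par y)) => a b; clear; do 3!case: eqP => /=; lia.
  split=> //; last by move=> E1; move: D0; rewrite /= E1.
  + apply: Gs'; case: H' => [[D' [Hl Hp]]|[-> _]]; last by left.
    right; split=> //; split=> // y Hy.
    by case: (Hl y Hy) => ->; [apply: rng0|apply: rng1].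
  + by move=> v _; rewrite A.
Qed.

Lemma guessing_write s v g : guessing s -> guessing (set_arr s aG v g).
Proof. by case=> [Hg HHL HS V0 El Ep HL01 HD]; split=> // i y; have := V0 i y; case: i. Qed.

Lemma enum_ok j s : guessing s -> valid (take j S) s ->
  wpb (enum_guesses h j) s (3 ^ j * (2200 * vl HL + 1230) - 20) (fun s' =>
    enum_post s (take j S) s' /\ (right (take j S) s -> reg s' rDone = 1)).
Proof.
set X := 2200 * vl HL + 1230.
elim: j s => [|j IH] s Gs; rewrite ?take0 => Va.
  by apply: (wpb_cons (enum_leaf Gs Va)) => //; rewrite expn0 /X; clear; lia.
set B := 3 ^ j * X - 20 in IH.
(* Subtracting 20 from the bound leaves room for the overhead: three bounds with this deficit save
   60, of which 30 pay for the test and the three writes. *)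
have costE p Y : 0 < p -> 1000 < Y -> 3 * (p * Y - 20) + 30 <= 3 * p * Y - 20.
  move=> H1 H2; have : 1 * 1000 <= p * Y by apply: leq_mul => //; apply: ltnW.
  by rewrite -mulnA; move: (p * Y) => q; clear; lia.
have HB : 3 * B + 30 <= 3 ^ j.+1 * X - 20.
  by rewrite expnS; apply: costE; rewrite ?expn_gt0 // /X; clear; lia.
case: (ltnP j (size S)) => Hj; last first.
  have Et : take j.+1 S = take j S by rewrite !take_oversize // ltnW.
  rewrite Et in Va *; apply: (wpb_if (m := B)).
  - by rewrite /= (proj1 (gu_S Gs)) ltnNge Hj.
  - by move=> _; apply: IH.
  - by move: HB; rewrite /=; clear; lia.
set v := nth 0 S j; have Et : take j.+1 S = rcons (take j S) v by rewrite (take_nth 0).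
rewrite Et in Va *.
pose P s' := enum_post s (rcons (take j S) v) s'.
have stepP g s1 : 0 < g <= 3 -> P s1 ->
    wpb (Write aG (Read aS (Const j)) (Const g)) s1 5 (fun s2 => 
      [/\ P s2, valid (take j S) s2, reg s2 rDone = reg s1 rDone
      & g = c3 v -> right (rcons (take j S) v) s -> right (take j S) s2]).
  move=> Hg [G1 O1 F1 D1]; apply: wpb_den => //.
  have Ev : arr s1 aS j = v by case: (gu_S G1) => _ ->.
  rewrite /= Ev; split.
  - split=> //; first exact: guessing_write.
    move=> w; rewrite /= /upd /= => Hw; rewrite F1 //.
    by case: eqP => // E; rewrite E mem_rcons mem_head in Hw.
  - move=> w Hw Nw; rewrite /= /upd /=; case: (eqVneq w v) => // Nv.
    by rewrite F1; first apply: Va => //; rewrite mem_rcons inE negb_or Nv.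
  - by [].
  - move=> Eg Ri w Hw Nw; rewrite /= /upd /=; case: (eqVneq w v) => [->|Nv].
      by rewrite Eg.
    by rewrite F1; first apply: Ri => //; rewrite mem_rcons inE negb_or Nv.
have callP s1 : P s1 -> valid (take j S) s1 -> wpb (enum_guesses h j) s1 B (fun s2 =>
    P s2 /\ ((reg s1 rDone = 1 -> reg s2 rDone = 1) /\ (right (take j S) s1 -> reg s2 rDone = 1))).
  move=> [G1 O1 F1 D1] V1; apply: (wpb_cons (IH s1 G1 V1)) => // s2 _ [[G2 O2 F2 D2] C2].
  split=> //; split=> //.
  - by move=> y Hy; rewrite O2 // O1.
  - move=> w Hw; rewrite F2 ?F1 //.
    by apply: contra Hw => Hw; rewrite mem_rcons inE Hw orbT.
  - by move/D1/D2.
pose R := right (rcons (take j S) v) s.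
have tryP g s1 D : 0 < g <= 3 -> P s1 -> (D -> reg s1 rDone = 1) ->
    wpb (Write aG (Read aS (Const j)) (Const g) ;; enum_guesses h j) s1 (B + 5)
    (fun s2 => P s2 /\ (D \/ g = c3 v /\ R -> reg s2 rDone = 1)).
  move=> Hg P1 HD; apply: (wpb_seq (stepP g s1 Hg P1) (b2 := B)); last by rewrite addnC.
  move=> s2 _ [P2 V2 E2 R2]; apply: (wpb_cons (callP s2 P2 V2)) => // s3 _ [P3 [H1 H2]].
  split=> // [[/HD D1|[Eg HR]]]; first by apply: H1; rewrite E2.
  exact: H2 (R2 Eg HR).
have P0 : P s by [].
apply: (wpb_if (m := 3 * B + 20)).
- move=> _.
  apply: (wpb_cons (b := (B + 5) + ((B + 5) + (B + 5))) (P := fun s' => P s' /\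
    (((False \/ 1 = c3 v /\ R) \/ 2 = c3 v /\ R) \/ 3 = c3 v /\ R -> reg s' rDone = 1))).
  + apply: wpb_seqA; first exact: (tryP 1 s False).
    move=> s1 [P1 H1]; apply: wpb_seqA; first exact: (tryP 2 s1 _ isT P1 H1).
    by move=> s2 [P2 H2]; apply: tryP.
  + by clear; lia.
  + move=> s' _ [P' H']; split=> // HR; apply: H'.
    have := c3_range v; case: (c3 v) => [|[|[|[|]]]] //= _; tauto.
- by rewrite /= (proj1 (gu_S Gs)) Hj.
- by move: HB; rewrite /=; clear; lia.
Qed.

End Guess.

End Component.
End Graph.


(** * The list coloring obtained from a 3-coloring *)

Section Graph.

Variables (n : nat) (nb : nat -> seq nat).
Hypothesis nb_lt : forall x y, y \in nb x -> (x < n) && (y < n).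
Hypothesis nb_sym : forall x y, (y \in nb x) = (x \in nb y).
Hypothesis nb_irr : forall x, x \notin nb x.
Hypothesis nb_uniq : forall x, uniq (nb x).

Notation eg := (edge nb).
Notation vl := (vol nb).
Let eg_sym := edge_sym nb_sym.

Section Component.

Variables (h : nat) (HL : seq nat).
Hypothesis uHL : uniq HL.
Hypothesis ltHL : forall x, x \in HL -> x < n.
Hypothesis clHL : forall x y, x \in HL -> eg x y -> y \in HL.
Variable c3 : nat -> nat.
Hypothesis c3_range : forall x, 0 < c3 x <= 3.
Hypothesis c3_proper : forall x y, eg x y -> c3 x != c3 y.
Hypothesis h_gt2 : 2 < h.

Section Layered.

Variables (S : seq nat) (s : state).
Hypothesis Z : zone n nb h HL S s.
Hypothesis Lev : forall y, y \in HL -> 1 < arr s aLev y < h \/ arr s aLev y = h.+1.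

Notation lev := (arr s aLev).
Notation par := (arr s aPar).

(** Which of the two colors that [c3] leaves to the neighbors of its parent is taken by [x];
    adjacent vertices with the same parent differ here. *)
Definition bit (x : nat) : bool := c3 x == next3 (c3 (par x)).

Definition many_colors : nat := if h == 3 then 5 else h.*2.-2.

(** The witness for the triangle case. A vertex on the odd side of the last level takes the color of
    level h-2 that its parent does not use, hence the negated [bit (par x)]. *)
Definition guided (x : nat) : nat :=
  if lev x == h.+1 then c3 x
  else if lev x < h.-1 then (lev x).*2 + 1 + bit x
  else if arr s aSide x == 0 then 4
  else if h == 3 then 5 else (lev x).*2.-1 + ~~ bit (par x).

(** The witness when no level has an inner edge: level [T] gets the single color T+2, so the levels
    2, ..., h-1 use the colors 4, ..., h+1. *)
Definition guided_tf (x : nat) : nat := if lev x == h.+1 then c3 x else (lev x).+2.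

Lemma lists_range y : y \in HL -> lev y != h.+1 ->
  0 < arr s aL0 y <= many_colors /\ 0 < arr s aL1 y <= many_colors.
Proof.
move=> Hy Ny; have Ly : 1 < lev y < h by case: (Lev Hy) => // E; rewrite E eqxx in Ny.
have := se_lists (zo_settled Z Hy Ly); rewrite /colors /many_colors.
case: ifP => H1; last case: ifP => Sd; last case: (eqVneq h 3) => H3; case=> -> ->.
- by rewrite ifN; move: Ly H1; clear; lia.
- by case: eqP => H3; move: h_gt2 H3; clear; lia.
- by [].
- by move: Ly H1 H3; clear; lia.
Qed.

Lemma guided_list y : y \in HL -> lev y != h.+1 ->
  guided y = arr s aL0 y \/ guided y = arr s aL1 y.
Proof.
move=> Hy Ny; have Ly : 1 < lev y < h by case: (Lev Hy) => // E; rewrite E eqxx in Ny.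
have := se_lists (zo_settled Z Hy Ly); rewrite /colors /guided (negbTE Ny) -(ltn_predRL).
case: ifP => H1; last (rewrite negbK; case: ifP => Sd); last case: ifP => H3; case=> -> ->.
- by rewrite addn1; case: (bit y); rewrite ?addn1 ?addn0; [right|left].
- by left.
- by left.
- have Ey : lev y > 1 by case/andP: Ly.
  case: (bit _); rewrite ?addn0 ?addn1; [by left|right].
  by rewrite prednK // double_gt0; apply: ltnW.
Qed.

(* The two cases that are not symmetric: levels in increasing order. *)
Lemma guided_proper_le y z : y \in HL -> eg y z -> lev y <= lev z ->
  guided y != guided z.
Proof.
move=> Hy yz Lyz; have Hz := clHL Hy yz.
rewrite /guided; case: (eqVneq (lev z) h.+1) => [Ez|Nz].
  case: (eqVneq (lev y) h.+1) => [Ey|Ny]; first exact: c3_proper.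
  have Ly : 1 < lev y < h by case: (Lev Hy) => // E; rewrite E eqxx in Ny.
  have Cz := c3_range z; move: (nat_of_bool (bit y)) (nat_of_bool _) => b b'.
  case: ltnP => H1; first by move: Ly Cz; clear; lia.
  case: ifP => _; first by move: Cz; clear; lia.
  by case: (eqVneq h 3) => H3; move: Ly H1 H3 h_gt2 Cz; clear; lia.
have Lz : 1 < lev z < h by case: (Lev Hz) => // E; rewrite E eqxx in Nz.
have Ly : 1 < lev y < h.
  case: (Lev Hy) => // E; move: Lyz Lz; rewrite E; clear; lia.
rewrite ifN; last by move: Ly; clear; lia.
have Sy := zo_settled Z Hy Ly; have Sz := zo_settled Z Hz Lz.
have zy : eg z y by rewrite eg_sym.
have bits : lev y = lev z -> bit y != bit z.
  move=> E; rewrite /bit (se_same Sy yz (esym E)).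
  apply: next3_neq => //; [exact: c3_proper (se_par Sy)| |exact: c3_proper].
  by rewrite -(se_same Sy yz (esym E)); apply: c3_proper (se_par Sz).
case: (ltnP (lev z) h.-1) => Hz1.
  rewrite (leq_ltn_trans Lyz Hz1).
  case: (eqVneq (lev y) (lev z)) => [E|N].
    by rewrite E eqn_add2l; move: (bits E); case: (bit y); case: (bit z).
  by move: N Lyz; case: (bit y); case: (bit z); clear; lia.
have Ez : lev z = h.-1 by move: Lz Hz1; clear; lia.
case: (ltnP (lev y) h.-1) => Hy1.
  case: ifP => Sdz; first by move: Ly; case: (bit y); clear; lia.
  case: (eqVneq h 3) => [E3|N3]; first by move: Ly Hy1; rewrite E3; clear; lia.
  (* Only level h-2 shares its colors with the odd side of the last level; for all other levels the
     intervals of colors are disjoint. *)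
  case: (eqVneq (lev y) h.-2) => [E2|N2]; last first.
    by rewrite Ez; move: N2 Hy1 Ly; case: (bit y); case: (bit _); clear; lia.
  have h4 : 3 < h by move: h_gt2 N3; clear; lia.
  have [Lp /(_ y yz E2) [Py Hy']] := se_above Sz h4 Ez.
  have [z' [zz' Ez']] : exists z', eg z z' /\ lev z' = h.-1.
    by apply: (se_odd Sz Ez); apply/eqP; rewrite Sdz.
  have yz' := Hy' z' zz' Ez'.
  have Ew : par z' = par z by apply: (se_same Sz zz'); rewrite Ez'.
  have Hz' := clHL Hz zz'.
  have Lz' : 1 < lev z' < h by rewrite Ez' -Ez.
  have Sz' := zo_settled Z Hz' Lz'.
  (* [y] and [par z] are both adjacent to the adjacent vertices [z] and [z']. *)
  have Ec : c3 y = c3 (par z).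
    have := c3_proper yz; have := c3_proper yz'; have := c3_proper zz'.
    have := c3_proper (se_par Sz); have := c3_proper (se_par Sz'); rewrite Ew.
    have := c3_range y; have := c3_range z; have := c3_range z'; have := c3_range (par z).
    by clear; lia.
  have -> : bit (par z) = bit y by rewrite /bit Py Ec.
  by rewrite Ez E2; move: h4; case: (bit y); clear; lia.
have Ey : lev y = h.-1 by move: Ly Hy1; clear; lia.
have := se_side Sy yz Ey Ez; rewrite Ey Ez.
case: (arr s aSide y == 0); case: (arr s aSide z == 0) => //= _;
  case: (eqVneq h 3) => // N3; move: h_gt2 N3; case: (bit _); clear; lia.
Qed.

Lemma guided_proper y z : y \in HL -> eg y z -> guided y != guided z.
Proof.
move=> Hy yz; case: (leqP (lev y) (lev z)) => [L|/ltnW L].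
  exact: guided_proper_le.
by rewrite eq_sym; apply: guided_proper_le; [apply: clHL yz|rewrite eg_sym|].
Qed.

Lemma guided_tf_proper y z :
  (forall x x', x \in HL -> eg x x' -> 1 < lev x < h -> lev x' != lev x) ->
  y \in HL -> eg y z -> guided_tf y != guided_tf z.
Proof.
move=> TF Hy yz; have Hz := clHL Hy yz; rewrite /guided_tf.
case: (eqVneq (lev y) h.+1) => [Ey|Ny]; case: (eqVneq (lev z) h.+1) => [Ez|Nz].
- exact: c3_proper.
- have Lz : 1 < lev z < h by case: (Lev Hz) => // E; rewrite E eqxx in Nz.
  by have := c3_range y; move: Lz; clear; lia.
- have Ly : 1 < lev y < h by case: (Lev Hy) => // E; rewrite E eqxx in Ny.
  by have := c3_range z; move: Ly; clear; lia.
have Ly : 1 < lev y < h by case: (Lev Hy) => // E; rewrite E eqxx in Ny.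
by rewrite !eqSS eq_sym; apply: TF yz Ly.
Qed.

End Layered.

End Component.
End Graph.


(** * Coloring one connected component *)

Definition copy_list : cmd :=
  Assign rHN (Const 0) ;;
  for_list aQ rJ rQt rZ
    (Write aHL (Reg rHN) (Reg rZ) ;; Assign rHN (Incr (Reg rHN))).

Definition start (h : nat) : cmd :=
  Write aLev (Reg rV) (Const h.+1) ;;
  Write aS (Const 0) (Reg rV) ;;
  Assign rSn (Const 1) ;;
  Write aPar (Reg rV) (Reg rV).

Definition in_levels (h : nat) : bexp :=
  And (Lt (Const 1) (rd aLev rX)) (Lt (rd aLev rX) (Const h)).

(** Adjacent vertices of the same level have the same parent ([se_same]), so an inner edge and this
    parent form a triangle. *)
Definition find_triangle (h : nat) : cmd :=
  Assign rTf (Const 0) ;;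
  for_HL (If (in_levels h)
    (for_nbr rX rP rY (If (Eq (rd aLev rY) (rd aLev rX))
       (Assign 1 (rd aPar rX) ;; Assign 2 (Reg rX) ;; Assign 3 (Reg rY) ;;
        Assign rTf (Const 1) ;; Assign rTri (Const 1)) Skip)) Skip).

(** A list of one color is encoded by repeating it, so the same solver applies. *)
Definition few_colors (h : nat) : cmd :=
  If (Eq (Reg rTf) (Const 0))
    (for_HL (If (in_levels h)
       (Write aL0 (Reg rX) (Incr (Incr (rd aLev rX))) ;;
        Write aL1 (Reg rX) (Incr (Incr (rd aLev rX)))) Skip)) Skip.

(** The search is called with level [h.+2], which is never assigned: only its queue is wanted, not
    the attached vertices. *)
Definition color_component (h : nat) : cmd :=
  explore h.+2 rV ;; copy_list ;; start h ;; rounds h h.+3 ;;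
  find_triangle h ;; few_colors h ;; Assign rDone (Const 0) ;;
  enum_guesses h h.+3.+2.

Section Graph.

Variables (n : nat) (nb : nat -> seq nat).
Hypothesis nb_lt : forall x y, y \in nb x -> (x < n) && (y < n).
Hypothesis nb_sym : forall x y, (y \in nb x) = (x \in nb y).
Hypothesis nb_irr : forall x, x \notin nb x.
Hypothesis nb_uniq : forall x, uniq (nb x).

Notation eg := (edge nb).
Notation vl := (vol nb).
Let eg_sym := edge_sym nb_sym.

Lemma size_le_vol (l : seq nat) : size l <= vl l.
Proof. by rewrite /vol -sum1_size; apply: leq_sum. Qed.

Lemma copy_list_ok s Q : repr_list aQ rQt s Q ->
  wpb copy_list s (30 * vl Q + 10) (fun s' => repr_list aHL rHN s' Q).
Proof.
move=> HQ; apply: (wpb_seq (b1 := 2) (b2 := 30 * vl Q + 6)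
  (P1 := fun s1 => s1 = set_reg s rHN 0)); first by apply: wpb_den.
  move=> s1 _ ->.
  apply: (@wpb_for_list (fun pre s' => repr_list aHL rHN s' pre) (fun=> 10)
    _ _ _ _ _ _ Q) => //.
    move=> pre z post s2 k E _ [HI1 HI2]; apply: wpb_den => //.
    split; first by rewrite /= /upd /= HI1 size_rcons.
    move=> i; rewrite size_rcons ltnS nth_rcons /= /upd /= HI1 leq_eqVlt => /orP[/eqP->|Hi].
      by rewrite eqxx ltnn.
    by rewrite Hi ltn_eqF // HI2.
  rewrite big_const_seq count_predT iter_addn; have := size_le_vol Q; clear; lia.
by clear; lia.
Qed.

Definition triangle_found (s : state) : Prop :=
  [/\ eg (reg s 1) (reg s 2), eg (reg s 2) (reg s 3) & eg (reg s 1) (reg s 3)].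

(** The invariant between components. Levels and colors are tied together only at vertices with a
    neighbor, since isolated vertices get a color but no level. A triangle found anywhere relaxes
    the color bound for the whole graph. *)
Record ready (h : nat) (s : state) : Prop := Ready {
  rd_graph : repr_graph n nb s;
  rd_cid : forall y, arr s aCid y <= reg s rC;
  rd_seen : forall y, arr s aSeen y <= reg s rC;
  rd_fail : forall c, reg s rC < c -> arr s aFail c = 0;
  rd_park : forall c, reg s rC < c -> arr s aPark c = 0;
  rd_V : forall i y, arr s (aV i) y = 0;
  rd_closed : forall y z, eg y z -> arr s aLev y != 0 -> arr s aLev z != 0;
  rd_lev : forall y z, eg y z -> (arr s aLev y == 0) = (arr s aCol y == 0);
  rd_col : forall y,
    arr s aCol y <= if reg s rTri == 0 then h.+1 else many_colors h;
  rd_proper : forall y z, eg y z -> arr s aCol y != 0 -> arr s aCol y != arr s aCol z;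
  rd_tri : reg s rTri = 0 \/ reg s rTri = 1 /\ triangle_found s
}.

Section Component.

Variables (h : nat) (HL : seq nat).
Hypothesis uHL : uniq HL.
Hypothesis ltHL : forall x, x \in HL -> x < n.
Hypothesis clHL : forall x y, x \in HL -> eg x y -> y \in HL.

Definition level_free (lev : nat -> nat) (pre : seq nat) : Prop :=
  forall x y, x \in pre -> eg x y -> 1 < lev x < h -> lev y != lev x.

Lemma find_triangle_ok s : repr_graph n nb s -> repr_list aHL rHN s HL ->
  (forall y, y \in HL -> 1 < arr s aLev y < h -> settled nb h s y) ->
  wpb (find_triangle h) s (70 * vl HL + 20) (fun s' =>
    (reg s' rTf = 0 /\ level_free (arr s aLev) HL /\
     [/\ reg s' rTri = reg s rTri, reg s' 1 = reg s 1, reg s' 2 = reg s 2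
       & reg s' 3 = reg s 3]) \/
    [/\ reg s' rTf = 1, reg s' rTri = 1 & triangle_found s']).
Proof.
move=> Hg HHL Set0.
pose J (C : Prop) s' := (reg s' rTf = 0 /\ C /\
     [/\ reg s' rTri = reg s rTri, reg s' 1 = reg s 1, reg s' 2 = reg s 2
       & reg s' 3 = reg s 3]) \/
    [/\ reg s' rTf = 1, reg s' rTri = 1 & triangle_found s'].
apply: (wpb_seq (b1 := 2) (b2 := 70 * vl HL + 6)
  (P1 := fun s1 => s1 = set_reg s rTf 0)); first by apply: wpb_den.
  move=> s1 _ ->.
  apply: (wpb_for_HL (nb := nb) (HL := HL) (K := 60)
    (I := fun pre s' => J (level_free (arr s aLev) pre) s')) => //.
    by move=> k; left.
  move=> pre x post s2 k E [_ A] HI.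
  have xHL : x \in HL by rewrite E mem_cat mem_head orbT.
  set s3 := set_reg _ rI k.
  have A3 b : arr s3 b = arr s b by apply: A.
  apply: (wpb_if (m := 50 * size (nb x) + 15)) => [/andP[]|G|]; last first.
  - by rewrite [bcost _]/=; clear; lia.
  - apply: wpb_den => //; first by rewrite [maxcost _]/=; clear; lia.
    case: HI => [[T0 [F R]]|R]; [left|by right].
    split=> //; split=> // z y; rewrite mem_rcons inE => /orP[/eqP->|Hz]; last exact: F.
    move=> _ Lx; case/negP: G; move: Lx; rewrite -(A3 aLev); by [].
  rewrite -[aeval _ _]/1 -[aeval s3 (rd aLev rX)]/(arr s3 aLev x) -[aeval s3 (Const h)]/h A3 => L1 L2.
  have Sx := Set0 x xHL; rewrite L1 L2 in Sx; move/(_ isT): Sx => Sx.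
  apply: (@wpb_for_nbr n nb (fun pr s' => J (level_free (arr s aLev) pre /\
      forall y, y \in pr -> arr s aLev y != arr s aLev x) s') 30 rX rP rY _ s3 x) => //.
  - by apply: repr_graph_eq Hg; rewrite A3.
  - exact: ltHL.
  - move=> q; case: HI => [[T0 [F R]]|R]; [left|by right].
    by split=> //; split=> //; split.
  - move=> pr y po s4 q Ey [R4 A4] H4; apply: wpb_den => //.
    have X4 : reg s4 rX = x by rewrite R4.
    have yx : eg x y by rewrite /edge Ey mem_cat mem_head orbT.
    rewrite /= /upd /= X4 !A4 // !A3; case: eqP => [Eq|Nq]; last first.
      case: H4 => [[T0 [[F Fp] R]]|R]; [left|by right].
      split=> //; split=> //; split=> // w; rewrite mem_rcons inE => /orP[/eqP->|/Fp //].
      exact/eqP.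
    right; split=> //; rewrite /triangle_found /= /upd /=.
    have Py := se_same Sx yx Eq.
    split=> //; first by rewrite eg_sym; apply: se_par Sx.
    have yHL := clHL xHL yx.
    have Sy : settled nb h s y by apply: Set0; rewrite // Eq L1 L2.
    by rewrite eg_sym -Py; apply: se_par Sy.
  - move=> s4 _ [[T0 [[F Fp] R]]|R]; [left|by right].
    split=> //; split=> // z y; rewrite mem_rcons inE => /orP[/eqP->|Hz]; last exact: F.
    by move=> xy _; apply: Fp.
  - by clear; lia.
by clear; lia.
Qed.

Lemma few_colors_ok s : repr_list aHL rHN s HL ->
  wpb (few_colors h) s (70 * vl HL + 20) (fun s' => forall y,
    arr s' aL0 y = (if [&& reg s rTf == 0, y \in HL & 1 < arr s aLev y < h]
      then (arr s aLev y).+2 else arr s aL0 y) /\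
    arr s' aL1 y = (if [&& reg s rTf == 0, y \in HL & 1 < arr s aLev y < h]
      then (arr s aLev y).+2 else arr s aL1 y)).
Proof.
move=> HHL; apply: (wpb_if (m := 70 * vl HL + 6)) => [T0|T0|]; last first.
- by rewrite /=; clear; lia.
- apply: wpb_den => //; first by rewrite /=; clear; lia.
  by move=> y; rewrite (negbTE (T0 : reg s rTf != 0)).
rewrite (T0 : reg s rTf == 0).
apply: (wpb_for_HL (nb := nb) (HL := HL) (K := 60) (I := fun pre s' => forall y,
    arr s' aL0 y = (if (y \in pre) && (1 < arr s aLev y < h)
      then (arr s aLev y).+2 else arr s aL0 y) /\
    arr s' aL1 y = (if (y \in pre) && (1 < arr s aLev y < h)
      then (arr s aLev y).+2 else arr s aL1 y))) => //.
move=> pre z post s1 k E [_ A] HI; apply: wpb_den => //.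
  by rewrite /=; clear; lia.
have EL : arr s1 aLev = arr s aLev by apply: A.
move=> y; have [I0 I1] := HI y; rewrite mem_rcons inE /= /upd /= EL.
case C: ((1 < arr s aLev z) && (arr s aLev z < h)).
  by rewrite /= /upd /=; case: (eqVneq y z) => [->|_] //; rewrite C.
rewrite /= I0 I1; case: (eqVneq y z) => [->|_] //=.
by rewrite C andbF.
Qed.

Variable c3 : nat -> nat.
Hypothesis c3_range : forall x, 0 < c3 x <= 3.
Hypothesis c3_proper : forall x y, eg x y -> c3 x != c3 y.
Hypothesis h_gt2 : 2 < h.
Hypothesis short : forall p, ipath eg p -> size p <= h.*2.

Lemma round_start_init v s : v \in HL ->
  (forall y, y \in HL -> conn eg (fun z => arr s aLev z == 0) v y) ->
  repr_graph n nb s -> repr_list aHL rHN s HL -> reg s rV = v ->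
  (forall y, arr s aCid y <= reg s rC) -> (forall y, arr s aSeen y <= reg s rC) ->
  (forall c, reg s rC < c -> arr s aFail c = 0) ->
  (forall c, reg s rC < c -> arr s aPark c = 0) ->
  round_start n nb h HL 0 (active HL (den (start h) s)) [:: v] [:: v] (den (start h) s).
Proof.
move=> vHL Cv Hg HHL Ev Hcid Hseen Hfail Hpark.
set s' := den _ _.
have L0 y : y \in HL -> arr s aLev y = 0 by move=> /Cv /conn_memr /eqP.
have Lev y : arr s' aLev y = if y == v then h.+1 else arr s aLev y.
  by rewrite /s' /= /upd /= Ev.
have LevHL y : y \in HL -> arr s' aLev y = 0 \/ arr s' aLev y = h.+1.
  by move=> Hy; rewrite Lev L0 //; case: eqP; [right|left].
have Par : arr s' aPar v = v by rewrite /s' /= /upd /= Ev eqxx.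
have low y : y \in HL -> ~~ (1 < arr s' aLev y < h).
  by move=> /LevHL[->|->]; rewrite ?andbF // -leqNgt leqnSn andbF || clear; lia.
split=> //.
- split=> //.
  + by split=> // -[|i] //; rewrite /s' /= /upd /= Ev.
  + by move=> y Hy Ly; move: (low y Hy); rewrite Ly.
  + by move=> y /LevHL[->|->].
  + by move=> y z Hy _ yz; apply: low; apply: clHL yz.
  + by move=> y Hy Ly; move: (low y Hy); rewrite Ly.
  + move=> y Hy; rewrite Lev L0 //; case: eqP => [->|_] [] // _.
    * by rewrite Par mem_head.
    * by rewrite Par mem_head.
  + by move=> y; rewrite inE => /eqP->; rewrite Lev eqxx.
- move=> y /LevHL[->|->]; split=> //; apply/eqP; move: h_gt2; clear; lia.
- by apply: phase_init; rewrite /active /level Lev eqxx andbF.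
move=> x Ax; have /andP[xHL _] := Ax.
have Cx : conn eg (fun z => arr s aLev z == 0) x v by apply: conn_sym => //; apply: Cv.
have Nv : ~~ active HL s' v by rewrite /active /level Lev eqxx andbF.
have [a [b [Ca Cb Nb ab]]] := conn_exit Cx Ax Nv.
have bHL := conn_HL clHL xHL Cb.
have Eb : b = v.
  apply/eqP; apply: contraNT Nb => Nbv.
  by rewrite /active bHL /level Lev (negbTE Nbv) L0.
rewrite Eb in ab; exists v, a; split; [exact: mem_head| |by rewrite eg_sym].
by apply: conn_sub Ca => z /andP[].
Qed.

Definition component_cost : nat := 4000 * 3 ^ h.+3.+2 + 4000 * h.+3 * h + 1000.

Lemma finish_component v s0 s : v \in HL -> ready h s0 ->
  (forall y, y \in HL -> conn eg (fun z => arr s aLev z == 0) v y) ->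
  repr_graph n nb s -> repr_list aHL rHN s HL -> reg s rV = v ->
  (forall y, arr s aCid y <= reg s rC) -> (forall y, arr s aSeen y <= reg s rC) ->
  reg s0 rC <= reg s rC ->
  (forall r, r \in [:: 1; 2; 3; rTri] -> reg s r = reg s0 r) ->
  (forall b, b \in [:: aLev; aFail; aPark; aCol; aV false; aV true] -> arr s b = arr s0 b) ->
  wpb (start h ;; rounds h h.+3 ;; find_triangle h ;; few_colors h ;;
       Assign rDone (Const 0) ;; enum_guesses h h.+3.+2) s
    ((component_cost - 300) * vl HL) (fun s' =>
    [/\ ready h s', forall y, y \in HL -> arr s' aCol y != 0,
        forall y, y \notin HL -> arr s' aCol y = arr s0 aCol y
      & reg s' rN = reg s rN /\ reg s' rV = reg s rV]).
Proof.
move=> vHL Rd Cv Hg HHL Ev Hcid Hseen HC HR HA.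
have sHL : 0 < size HL by case: (HL) vHL.
have v0 := vol_gt0 nb sHL.
have RS := round_start_init vHL Cv Hg HHL Ev Hcid Hseen.
have {}RS := RS (fun c Hc => etrans (congr1 (fun f => f c) (HA aFail isT)) (rd_fail Rd (leq_ltn_trans HC Hc)))
  (fun c Hc => etrans (congr1 (fun f => f c) (HA aPark isT)) (rd_park Rd (leq_ltn_trans HC Hc))).
pose s1 := den (start h) s.
apply: (wpb_seq (b1 := 20) (P1 := fun s' => s' = s1)
  (b2 := (component_cost - 320) * vl HL)); first by apply: wpb_den.
2: by move: v0; rewrite /component_cost; set X := vl HL; set p := 3 ^ _; clear; nia.
move=> _ _ ->.
apply: (wpb_seq (rounds_ok nb_lt nb_sym nb_uniq uHL ltHL clHL c3_range c3_proper h_gt2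
  sHL short (leqnn _) RS) (b2 := (4000 * 3 ^ h.+3.+2 + 600) * vl HL)); last first.
  by move: v0; rewrite /component_cost; set X := vl HL; set p := 3 ^ _; clear; nia.
move=> s2 S2 [[U [K [S RS2]]] Out2]; have {}S2 := rounds_same S2.
have [Z szS Lev2] := rounds_end nb_sym h_gt2 short RS2.
apply: (wpb_seq (find_triangle_ok (zo_graph Z) (zo_HL Z) (zo_settled Z))
  (b2 := (4000 * 3 ^ h.+3.+2 + 500) * vl HL)); last first.
  by move: v0; set X := vl HL; set p := 3 ^ _; clear; nia.
move=> s3 [R3 A3] Tri.
have HL3 : repr_list aHL rHN s3 HL.
  by case: (zo_HL Z) => T1 T2; split; [rewrite R3|move=> j Hj; rewrite A3 ?T2].
apply: (wpb_seq (few_colors_ok HL3) (b2 := (4000 * 3 ^ h.+3.+2 + 400) * vl HL)); last first.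
  by move: v0; set X := vl HL; set p := 3 ^ _; clear; nia.
move=> s4 [R4 A4] L4.
pose s5 := set_reg s4 rDone 0.
apply: (wpb_seq (b1 := 2) (P1 := fun s' => s' = s5)
  (b2 := (4000 * 3 ^ h.+3.+2) * vl HL)); first by apply: wpb_den.
2: by move: v0; set X := vl HL; set p := 3 ^ _; clear; nia.
move=> _ _ ->.
pose tf := reg s3 rTf == 0.
pose k := if tf then h.+1 else many_colors h.
(* The coloring that exists under the right guess; [tf] says that no inner edge was found, so that
   the lists are singletons on the levels. *)
pose f := if tf then guided_tf h c3 s2 else guided h c3 s2.
have A5 b : b \notin [:: aL0; aL1] -> arr s5 b = arr s2 b.
  by move=> Hb; rewrite /= A4 ?A3 //; move: Hb; rewrite !inE.
have [R2 A2] := S2.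
have R5 r : r \notin [:: rTf; rTri; rDone; 1; 2; 3; rI; rX; rP; rY] -> reg s5 r = reg s2 r.
  rewrite !inE !negb_or => /and5P[N1 N2 N3 N4 /and5P[N5 N6 N7 N8 /andP[N9 N10]]].
  rewrite /= /upd (negbTE N3) R4 ?R3 //= !inE ?negb_or;
    by rewrite ?N1 ?N2 ?N4 ?N5 ?N6 ?N7 ?N8 ?N9 ?N10.
have Gr : repr_graph n nb s5 by apply: repr_graph_eq (zo_graph Z); apply: A5.
have HL5 : repr_list aHL rHN s5 HL.
  by case: (zo_HL Z) => T1 T2; split; [rewrite R5|move=> j Hj; rewrite A5 ?T2].
have S5 : repr_list aS rSn s5 S.
  by case: (zo_S Z) => T1 T2; split; [rewrite R5|move=> j Hj; rewrite A5 ?T2].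
have V5 i y : arr s5 (aV i) y = 0.
  rewrite A5 ?A2; try by case: (i).
  have -> : arr (den (start h) s) (aV i) = arr s (aV i) by case: (i).
  by rewrite HA ?(rd_V Rd) //; case: (i).
have lvl y : y \in HL -> arr s5 aLev y != h.+1 -> 1 < arr s2 aLev y < h.
  by rewrite A5 // => /Lev2[//|->]; rewrite eqxx.
have L5 y : y \in HL -> arr s5 aLev y != h.+1 ->
    if tf then arr s5 aL0 y = (arr s2 aLev y).+2 /\ arr s5 aL1 y = (arr s2 aLev y).+2
    else arr s5 aL0 y = arr s2 aL0 y /\ arr s5 aL1 y = arr s2 aL1 y.
  move=> Hy Ly; have := L4 y; rewrite -[arr s5 _]/(arr s4 _) -[arr s5 aL1]/(arr s4 aL1).
  by rewrite -/tf Hy !A3 // (lvl y Hy Ly); case: (tf).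
have many_gt : h < many_colors h.
  by rewrite /many_colors; case: eqP => [->|] //; move: h_gt2; clear; lia.
have k_gt2 : 2 < k.
  by rewrite /k; case: (tf); [apply: leqW|apply: ltn_trans many_gt].
have mr y : y \in HL -> arr s5 aLev y != h.+1 ->
    0 < arr s5 aL0 y <= k /\ 0 < arr s5 aL1 y <= k.
  move=> Hy Ly; have := L5 y Hy Ly; have Ly2 := lvl y Hy Ly; rewrite /k; case: (tf) => -[-> ->].
    by move: Ly2; clear; lia.
  by apply: (lists_range h_gt2 Z Lev2 Hy); rewrite -A5.
have pS y : y \in HL -> arr s5 aLev y = h.+1 ->
    arr s5 aPar y \in S /\ (arr s5 aPar y = y \/ eg y (arr s5 aPar y)).
  rewrite !A5 // => Hy Ly; have [PS] := zo_old Z Hy (or_intror Ly).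
  by case: ifP => _ H; split=> //; [left|right].
have f_old y : y \in HL -> arr s5 aLev y = h.+1 -> f y = c3 y.
  by rewrite A5 // /f => _ Ly; case: (tf); rewrite /guided_tf /guided Ly eqxx.
have f_list y : y \in HL -> arr s5 aLev y != h.+1 ->
    f y = arr s5 aL0 y \/ f y = arr s5 aL1 y.
  move=> Hy Ly; have := L5 y Hy Ly; rewrite /f; case: (tf) => -[-> ->].
    by left; rewrite /guided_tf -A5 // (negbTE Ly).
  by apply: (guided_list c3 Z Lev2 Hy); rewrite -A5.
have TriS : tf -> level_free (arr s2 aLev) HL.
  by rewrite /tf; case: Tri => [[_ [F _]]|[-> _ _]].
have f_proper y z : y \in HL -> eg y z -> f y != f z.
  move=> Hy yz; rewrite /f; case E: tf.
    by apply: (guided_tf_proper clHL c3_range c3_proper Lev2 _ Hy yz); apply: TriS.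
  exact: (guided_proper nb_sym clHL c3_range c3_proper h_gt2 Z Lev2 Hy yz).
have Gu : guessing n nb h HL k S (arr s5 aLev) (arr s5 aPar) (arr s5 aL0) (arr s5 aL1) s5.
  by split=> //; left.
have Etake : take h.+3.+2 S = S by apply: take_oversize.
(* [S] has at most h+5 elements, so the enumeration runs over all of it and nothing is required of
   the guesses present before. *)
have vac P : guessed_in S P (take h.+3.+2 S) s5.
  by rewrite Etake => w Hw; rewrite Hw.
apply: (wpb_cons (enum_ok nb_sym uHL ltHL clHL c3_range c3_proper k_gt2 mr pS f_old
  f_list f_proper Gu (vac _))).
  apply: leq_trans (leq_subr _ _) _; rewrite -mulnA [X in _ <= X]mulnCA leq_mul2l.
  apply/orP; right.
  by move: v0; clear; lia.
move=> s6 S6 [[Gu6 Out6 _ _] D6]; have [R6 A6] := enum_same S6.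
have D1 := D6 (vac _).
have [Rng Prop6] : good_col nb HL k s6 by case: (gu_done Gu6) => [|[]//]; rewrite D1.
have A26 b : b \notin [:: aL0; aL1; aG; aCol; aV false; aV true; aQu false; aQu true] ->
    arr s6 b = arr s2 b.
  rewrite !inE !negb_or => /and5P[N1 N2 N3 N4 /and4P[N5 N6 N7 N8]].
  rewrite A6 ?A5 // !inE ?negb_or ?N1 ?N2 //.
  by rewrite ?N3 ?N4 ?N5 ?N6 ?N7 ?N8.
have C6 : reg s6 rC = reg s2 rC by rewrite R6 // R5.
have Lev6 y : y \notin HL -> arr s6 aLev y = arr s0 aLev y.
  move=> Hy; rewrite A26 // Out2 //= /upd /= Ev.
  by case: eqP => [E|_]; [rewrite E vHL in Hy|rewrite HA].
have Col6 y : y \notin HL -> arr s6 aCol y = arr s0 aCol y.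
  by move=> Hy; rewrite Out6 // A5 // A2 // -[LHS]/(arr s aCol y) HA.
have LevHL y : y \in HL -> arr s6 aLev y != 0.
  by move=> Hy; rewrite A26 //; case: (Lev2 y Hy) => [|->] //; case: (arr s2 aLev y).
have ColHL y : y \in HL -> arr s6 aCol y != 0 by move=> /Rng; case: (arr s6 aCol y).
have outHL y z : y \notin HL -> eg y z -> z \notin HL.
  by move=> Hy yz; apply: contra Hy => zHL; apply: clHL zHL _; rewrite eg_sym.
have Rs2 r : r \in [:: 1; 2; 3; rTri] -> reg s2 r = reg s0 r.
  move=> Hr; rewrite -HR // R2 //; first by move: Hr; rewrite !inE => /or4P[]/eqP->.
  by move: Hr; rewrite !inE => /or4P[]/eqP->.
have Rs6 r : r \in [:: 1; 2; 3; rTri] -> reg s6 r = reg s3 r.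
  move=> Hr; rewrite R6; last by move: Hr; rewrite !inE => /or4P[]/eqP->.
  by move: Hr; rewrite !inE => /or4P[]/eqP->; rewrite /= /upd /= R4.
have Tri6 : (tf /\ reg s6 rTri = reg s0 rTri /\
    (forall r, r \in [:: 1; 2; 3] -> reg s6 r = reg s0 r)) \/
    (reg s6 rTri = 1 /\ triangle_found s6).
  case: Tri => [[T0 [_ [E0 E1 E2 E3]]]|[_ E0 [F1 F2 F3]]]; [left|right].
    split; first by rewrite /tf T0.
    split; first by rewrite Rs6 // E0 Rs2.
    by move=> r; rewrite !inE => /or3P[]/eqP->; rewrite Rs6 // ?E1 ?E2 ?E3 Rs2.
  by split; [rewrite Rs6|split; rewrite !Rs6].
split=> //; last by rewrite !R6 // !R5 // !R2.
split.
- exact: gu_graph Gu6.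
- by move=> y; rewrite A26 // C6; apply: (zo_cid Z).
- by move=> y; rewrite A26 // C6; apply: (zo_seen Z).
- by move=> c Hc; rewrite A26 //; apply: (zo_fail Z); rewrite -C6.
- by move=> c Hc; rewrite A26 //; apply: (zo_park Z); rewrite -C6.
- exact: gu_V Gu6.
- move=> y z yz; case yHL: (y \in HL); first by move=> _; apply: LevHL; apply: clHL yz.
  rewrite !Lev6 ?yHL // ?(outHL y z _ yz) ?yHL //; exact: (rd_closed Rd).
- move=> y z yz; case yHL: (y \in HL).
    by rewrite (negbTE (LevHL y yHL)) (negbTE (ColHL y yHL)).
  by rewrite Lev6 ?Col6 ?yHL //; apply: (rd_lev Rd yz).
- move=> y; case yHL: (y \in HL).
    have /andP[_] := Rng y yHL; rewrite /k; case: Tri6 => [[-> [E _]]|[-> _]] /=.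
      by case: ifP => // _ Hc; apply: leq_trans Hc _.
    by case: (tf) => // Hc; apply: leq_trans Hc _.
  rewrite Col6 ?yHL //; have := rd_col Rd y.
  case: Tri6 => [[_ [-> _]]|[-> _]] //=.
  by case: ifP => // _ Hc; apply: leq_trans Hc _.
- move=> y z yz; case yHL: (y \in HL); first by move=> _; apply: Prop6.
  rewrite !Col6 ?yHL // ?(outHL y z _ yz) ?yHL //; exact: (rd_proper Rd).
- case: Tri6 => [[_ [E F]]|H]; last by right.
  by rewrite E; case: (rd_tri Rd) => [|[E1 T]]; [left|right; split=> //; rewrite /triangle_found !F].
Qed.

End Component.

Variables (h : nat) (c3 : nat -> nat).
Hypothesis c3_range : forall x, 0 < c3 x <= 3.
Hypothesis c3_proper : forall x y, eg x y -> c3 x != c3 y.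
Hypothesis h_gt2 : 2 < h.
Hypothesis short : forall p, ipath eg p -> size p <= h.*2.

Lemma color_component_ok v w s : ready h s -> reg s rV = v -> v < n -> eg v w ->
  arr s aCol v = 0 ->
  wp (color_component h) s (fun s' k => exists HL,
    [/\ uniq HL, v \in HL,
        forall y, y \in HL -> [/\ y < n, arr s aCol y = 0 & nb y != [::]],
        k <= component_cost h * vl HL
      & [/\ ready h s', forall y, y \in HL -> arr s' aCol y != 0,
           forall y, y \notin HL -> arr s' aCol y = arr s aCol y
         & reg s' rN = reg s rN /\ reg s' rV = reg s rV]]).
Proof.
move=> Rd Ev vn vw Cv.
have Lv : arr s aLev v = 0 by apply/eqP; rewrite (rd_lev Rd vw) Cv.
apply: (wp_seq (explore_ok nb_lt nb_sym nb_uniq _ (ltn0Sn _) (rd_graph Rd) Ev vn Lv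
  (rd_cid Rd) (rd_seen Rd))) => // s1 k1 [R1 A1] [HL [AL [Ex Hk1]]].
have ltHL x : x \in HL -> x < n by move=> /(ex_conn Ex); apply: conn_edge_lt.
have col0 y : y \in HL -> arr s aCol y = 0.
  move=> /(ex_conn Ex); apply: (conn_ind (P := fun y => arr s aCol y = 0)) => // a b _ _ /eqP Lb ab.
  have ba : eg b a by rewrite eg_sym.
  by apply/eqP; rewrite -(rd_lev Rd ba) Lb.
have clHL x y : x \in HL -> eg x y -> y \in HL.
  move=> xHL xy; apply: (ex_closed Ex xHL xy); apply/negPn/negP => Ny.
  have yx : eg y x by rewrite eg_sym.
  by have := rd_closed Rd yx Ny; rewrite (conn_memr (ex_conn Ex xHL)).
have v0 : 0 < vl HL by apply: vl_gt0 (ex_x Ex).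
apply: (wp_seq (copy_list_ok (ex_q Ex))) => s2 k2 [R2 A2] [Hk2 HL2].
have Lev2 : arr s2 aLev = arr s aLev by rewrite A2 // (ex_lev Ex).
have C2 : reg s2 rC = (reg s rC).+1 by rewrite R2 // (ex_c Ex).
apply: (wp_cons (finish_component (ex_uniq Ex) ltHL clHL
  c3_range c3_proper h_gt2 short (ex_x Ex) Rd _ _ HL2 _ _ _ _ _ _)).
- by rewrite Lev2; apply: (ex_conn Ex).
- by apply: repr_graph_eq (rd_graph Rd); rewrite A2 // A1.
- by rewrite R2 // R1.
- move=> y; rewrite C2 A2 // (ex_cid Ex); case: ifP => // _.
  exact: leqW (rd_cid Rd y).
- move=> y; rewrite C2 A2 //; case yAL: (y \in AL); first by have [-> _] := ex_cnt Ex yAL.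
  by rewrite (ex_seen Ex) ?yAL //; apply: leqW (rd_seen Rd y).
- by rewrite C2.
- by move=> r; rewrite !inE => /or4P[]/eqP->; rewrite R2 // R1.
- move=> b; rewrite !inE => /orP[/eqP->|]; first exact: Lev2.
  by case/or4P => [/eqP->|/eqP->|/eqP->|/orP[]/eqP->]; rewrite A2 // A1.
move=> s3 k3 _ [Hk3 H3]; exists HL; split=> //.
- exact: ex_uniq Ex.
- exact: ex_x Ex.
- move=> y Hy; split; [exact: ltHL|exact: col0|].
  apply: (conn_ind (P := fun y => nb y != [::]) _ _ (ex_conn Ex Hy)).
    by apply/eqP => E; move: vw; rewrite /edge E.
  by move=> a b _ _ _; rewrite eg_sym /edge; case: (nb b).
- have : 300 <= component_cost h by rewrite /component_cost; clear; lia.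
  by move: Hk1 Hk2 Hk3 v0; set X := vl HL; set c := component_cost h; clear; nia.
case: H3 => Rd3 C3 O3 [N3 V3]; split=> //.
by rewrite N3 V3 !R2 // !R1.
Qed.

End Graph.


(** * The main loop *)

(** Isolated vertices get color 1 in constant time, so only components with an edge pay the factor
    that depends on [t]. *)
Definition color_all (h : nat) : cmd :=
  While (Lt (Reg rV) (Reg rN))
    (If (Lt (Read 0 (Reg rV)) (Read 0 (Incr (Reg rV))))
       (If (Eq (rd aCol rV) (Const 0)) (color_component h) Skip)
       (Write aCol (Reg rV) (Const 1)) ;;
     Assign rV (Incr (Reg rV))).

Definition copy_output : cmd :=
  Assign rV (Const 0) ;;
  While (Lt (Reg rV) (Reg rN))
    (Write 0 (Reg rV) (rd aCol rV) ;; Assign rV (Incr (Reg rV))).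

Definition main (h : nat) : cmd :=
  color_all h ;; copy_output ;;
  If (Eq (Reg rTri) (Const 1)) (Assign 0 (Const 0)) (Assign 0 (Const 1)).

Section Graph.

Variables (n : nat) (nb : nat -> seq nat).
Hypothesis nb_lt : forall x y, y \in nb x -> (x < n) && (y < n).
Hypothesis nb_sym : forall x y, (y \in nb x) = (x \in nb y).
Hypothesis nb_irr : forall x, x \notin nb x.
Hypothesis nb_uniq : forall x, uniq (nb x).

Notation eg := (edge nb).
Notation vl := (vol nb).
Let eg_sym := edge_sym nb_sym.

Variables (h : nat) (c3 : nat -> nat).
Hypothesis c3_range : forall x, 0 < c3 x <= 3.
Hypothesis c3_proper : forall x y, eg x y -> c3 x != c3 y.
Hypothesis h_gt2 : 2 < h.
Hypothesis short : forall p, ipath eg p -> size p <= h.*2.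

Let touched (s : state) : seq nat :=
  [seq y <- iota 0 n | (arr s aCol y != 0) && (nb y != [::])].

(** Where the degree is positive, deg + 1 is at most twice the degree; this removes the number of
    vertices from the expensive term. *)
Lemma vol_le_degrees (P : pred nat) :
  vl [seq y <- iota 0 n | P y && (nb y != [::])] <= 2 * \sum_(0 <= y < n) size (nb y).
Proof.
rewrite /vol big_filter big_distrr /= /index_iota subn0 [X in X <= _]big_mkcond /=.
apply: leq_sum => y _; case: ifP => // /andP[_]; case: (nb y) => //= a l _.
by clear; lia.
Qed.

Lemma ready_isolated s v : ready n nb h s -> nb v = [::] ->
  ready n nb h (set_arr s aCol v 1).
Proof.
move=> [H1 H2 H3 H4 H5 H6 H7 H8 H9 H10 H11] Ev.
have Nl y z : eg y z -> (y == v) = false.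
  by move=> yz; apply/eqP => E; move: yz; rewrite E /edge Ev.
have Nr y z : eg y z -> (z == v) = false by rewrite eg_sym; apply: Nl.
split=> //.
- by move=> i y; have := H6 i y; case: i.
- by move=> y z yz; rewrite /= /upd /= (Nl y z yz); apply: H8 yz.
- by move=> y; rewrite /= /upd /=; case: ifP => // _; case: ifP => // _;
     rewrite /many_colors; case: ifP => // _; move: h_gt2; clear; lia.
- by move=> y z yz; rewrite /= /upd /= (Nl y z yz) (Nr y z yz); apply: H10.
Qed.

Lemma color_all_ok s : ready n nb h s -> reg s rN = n -> reg s rV = 0 ->
  wp (color_all h) s (fun s' k => [/\ ready n nb h s', reg s' rN = n,
    forall y, y < n -> arr s' aCol y != 0
    & k <= 60 * n + 2 * component_cost h * \sum_(0 <= y < n) size (nb y) + 20]).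
Proof.
move=> Rd EN EV.
pose c := component_cost h; pose D := \sum_(0 <= y < n) size (nb y).
have vD s1 : c * vl (touched s1) <= 2 * c * D.
  by rewrite mulnAC [2 * D * c]mulnC leq_mul2l vol_le_degrees orbT.
apply: (wp_while (Inv := fun s1 u => [/\ ready n nb h s1, reg s1 rN = n,
   reg s1 rV <= n, forall y, y < reg s1 rV -> arr s1 aCol y != 0
   & u <= 60 * reg s1 rV + c * vl (touched s1)]) (bound := 60 * n + 2 * c * D)).
- move=> s1 u _ [_ _ Hv _ Hu]; apply: leq_trans Hu _.
  by apply: leq_add; [rewrite leq_mul2l Hv|apply: vD].
- move=> s1 u _ [Rd1 EN1 Hv Hc Hu]; rewrite /= EN1 => Hlt.
  set v := reg s1 rV in Hv Hc Hu Hlt.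
  pose Q s2 k := [/\ ready n nb h s2, reg s2 rN = n, reg s2 rV = v,
    forall y, y < v.+1 -> arr s2 aCol y != 0
    & u + k <= 60 * v + 40 + c * vl (touched s2)].
  have keep s2 : (forall y, y < v -> arr s2 aCol y = arr s1 aCol y) -> arr s2 aCol v != 0 ->
      forall y, y < v.+1 -> arr s2 aCol y != 0.
    move=> H H' y; rewrite ltnS leq_eqVlt => /orP[/eqP->|Hy] //.
    by rewrite H // Hc.
  apply: (wp_seq (Q1 := Q)); last first.
    move=> s2 k2 _ [Rd2 EN2 EV2 Hc2 Hu2]; apply: wp_den => // k Hk.
    split.
    + by case: Rd2 => *; split.
    + by [].
    + by rewrite /= /upd /= EV2.
    + by move=> y; rewrite /= /upd /= EV2; apply: Hc2.
    + rewrite /= /upd /= EV2 -[touched _]/(touched s2).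
      move: Hu2 (Hk : k <= 3); move: (c * _) => X; clear; lia.
  have [Hoff _] := rd_graph Rd1.
  apply: wp_if => /=; rewrite -/v Hoff // -{1}[arr s1 0 v]addn0 ltn_add2l => Hsz.
  + have [w vw] : exists w, eg v w.
      by move: Hsz; rewrite /edge; case: (nb v) => // w l _; exists w; rewrite mem_head.
    apply: wp_if => /= [/eqP Cv|Cv].
    * apply: (wp_cons (color_component_ok nb_lt nb_sym nb_uniq c3_range c3_proper h_gt2 short
        Rd1 (erefl v) Hlt vw Cv)).
      move=> s2 k _ [HL [uHL vHL HHL Hk [Rd2 C2 O2 [EN2 EV2]]]].
      have touchedE : vl (touched s1) + vl HL <= vl (touched s2).
        rewrite /vol -big_cat; apply: sum_uniq_sub.
          rewrite cat_uniq uHL filter_uniq ?iota_uniq // andbT; apply/hasPn => y /HHL[_ Cy _].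
          by rewrite mem_filter Cy.
        move=> y; rewrite mem_cat !mem_filter mem_iota => /orP[/andP[/andP[Cy ->] ->]|Hy].
          rewrite andbT andbT; case yHL: (y \in HL); first exact: C2.
          by rewrite O2 ?yHL.
        by have [yn _ ->] := HHL y Hy; rewrite C2.
      split=> //; first by rewrite EN2.
        move=> y Hy; case yHL: (y \in HL); first exact: C2.
        rewrite O2 ?yHL //; apply: Hc; move: Hy; rewrite ltnS leq_eqVlt => /orP[/eqP E|//].
        by rewrite E vHL in yHL.
      have : c * vl (touched s1) + c * vl HL <= c * vl (touched s2).
        by rewrite -mulnDr leq_mul2l touchedE orbT.
      move: Hk Hu; rewrite -/c; move: (c * vl HL) (c * _) (c * _) => X Y W; clear; lia.
    * apply: wp_den => // k Hk; split=> //; first exact: keep.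
      rewrite -[touched (den _ _)]/(touched s1).
      move: Hu (Hk : k <= 1); move: (c * _) => X; clear; lia.
  + have Ev : nb v = [::] by move: Hsz; case: (nb v).
    apply: wp_den => // k Hk.
    have -> : den (Write aCol (Reg rV) (Const 1)) s1 = set_arr s1 aCol v 1 by [].
    split=> //.
    * exact: ready_isolated.
    * apply: keep; last by rewrite /= /upd /= eqxx.
      by move=> y Hy; rewrite /= /upd /= ltn_eqF.
    have -> : touched (set_arr s1 aCol v 1) = touched s1.
      apply: eq_filter => y; rewrite /= /upd /=; case: (eqVneq y v) => [->|//].
      by rewrite Ev !andbF.
    move: Hu (Hk : k <= 3); move: (c * _) => X; clear; lia.
- move=> s1 u _ [Rd1 EN1 Hv Hc Hu]; rewrite /= EN1 -leqNgt => Hn.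
  have Ev : reg s1 rV = n by apply/eqP; rewrite eqn_leq Hv.
  rewrite Ev in Hc Hu; split=> //.
  have := vD s1; move: Hu; move: (c * _) (2 * c * D) => X Y; clear; lia.
- split=> //; first by rewrite EV.
  by rewrite EV.
Qed.

Lemma copy_output_ok s : reg s rN = n ->
  wpb copy_output s (40 * n + 20) (fun s' => forall y, y < n -> arr s' 0 y = arr s aCol y).
Proof.
move=> EN; apply: (wpb_seq (b1 := 2) (P1 := fun s1 => s1 = set_reg s rV 0)
  (b2 := 40 * n + 10)); first by apply: wpb_den.
  move=> _ _ ->.
  apply: (wp_while (Inv := fun s1 u => [/\ reg s1 rV <= n, reg s1 rN = n,
    arr s1 aCol = arr s aCol, forall y, y < reg s1 rV -> arr s1 0 y = arr s aCol y
    & u <= 40 * reg s1 rV]) (bound := 40 * n)).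
  - by move=> s1 u _ [Hv _ _ _ Hu]; apply: leq_trans Hu _; rewrite leq_mul2l.
  - move=> s1 u _ [Hv EN1 C1 H1 Hu]; rewrite /= EN1 => Hlt; apply: wp_den => // k Hk.
    split=> //.
    + move=> y; rewrite /= /upd /= ltnS leq_eqVlt => /orP[/eqP->|Hy].
        by rewrite eqxx C1.
      by rewrite ltn_eqF // H1.
    + move: Hu (Hk : k <= 7); rewrite /= /upd /=; clear; lia.
  - move=> s1 u _ [Hv EN1 C1 H1 Hu]; rewrite /= EN1 -leqNgt => Hn.
    have Ev : reg s1 rV = n by apply/eqP; rewrite eqn_leq Hv.
    by rewrite Ev in Hu H1; split=> //; move: Hu; clear; lia.
  - by split.
by clear; lia.
Qed.

Lemma main_ok s : ready n nb h s -> reg s rN = n -> reg s rV = 0 ->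
  wp (main h) s (fun s' k =>
    k <= 100 * n + 2 * component_cost h * \sum_(0 <= y < n) size (nb y) + 60 /\
    exists K, [/\ forall y, y < n -> 0 < arr s' 0 y <= K,
      forall y z, eg y z -> arr s' 0 y != arr s' 0 z
      & [/\ reg s' 0 = 0, K = many_colors h & triangle_found nb s'] \/
        reg s' 0 = 1 /\ K = h.+1]).
Proof.
move=> Rd EN EV; apply: (wp_seq (color_all_ok Rd EN EV)) => s1 k1 _ [Rd1 EN1 C1 Hk1].
apply: (wp_seq (copy_output_ok EN1)) => s2 k2 [R2 _] [Hk2 O2].
apply: wp_den => // k Hk; split.
  by move: Hk1 Hk2 (Hk : k <= 6); move: (2 * _ * _) => X; clear; lia.
exists (if reg s1 rTri == 0 then h.+1 else many_colors h).
set s3 := den _ _.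
have A3 : arr s3 0 = arr s2 0 by rewrite /s3 /=; case: ifP.
split.
- move=> y Hy; rewrite A3 O2 // lt0n C1 //; exact: rd_col Rd1 y.
- move=> y z yz; have /andP[yn zn] := nb_lt yz; rewrite A3 !O2 //.
  by apply: (rd_proper Rd1 yz); apply: C1.
rewrite /s3 /= R2 //; case: (rd_tri Rd1) => [E|[E [T1 T2 T3]]]; rewrite E /=; [right|left] => //.
by split=> //; split; rewrite /= /upd /= !R2.
Qed.

End Graph.


(** * From the input to the main loop *)

Section Input.

Variables (n : nat) (e : rel 'I_n) (adj : 'I_n -> seq 'I_n).
Hypothesis e_sym : symmetric e.
Hypothesis e_irr : irreflexive e.
Hypothesis adj_e : adjacency_lists e adj.

(** The adjacency lists carried over to all natural numbers, with empty lists from [n] on, because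
    the machine knows no ordinals. *)
Definition neighbors (x : nat) : seq nat :=
  nth [::] [seq [seq val v | v <- adj u] | u <- enum 'I_n] x.

Lemma neighborsE (u : 'I_n) : neighbors u = [seq val v | v <- adj u].
Proof. by rewrite /neighbors (nth_map u) ?size_enum_ord // nth_ord_enum. Qed.

Lemma neighbors_out x : n <= x -> neighbors x = [::].
Proof. by move=> Hx; rewrite /neighbors nth_default // size_map size_enum_ord. Qed.

Lemma mem_neighbors (u v : 'I_n) : (val v \in neighbors u) = e u v.
Proof. by rewrite neighborsE mem_map; [have [_ ->] := adj_e u|exact: val_inj]. Qed.

Lemma neighbors_ord x y : y \in neighbors x ->
  exists u v : 'I_n, [/\ x = u, y = v & e u v].
Proof.
case: (ltnP x n) => [Hx|/neighbors_out ->] // Hy.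
move: (Hy); rewrite -[x]/(val (Ordinal Hx)) neighborsE => /mapP[v Hv E].
by exists (Ordinal Hx), v; split=> //; rewrite -mem_neighbors -E.
Qed.

Lemma neighbors_lt x y : y \in neighbors x -> (x < n) && (y < n).
Proof. by case/neighbors_ord=> u [v [-> -> _]]; rewrite !ltn_ord. Qed.

Lemma neighbors_sym x y : (y \in neighbors x) = (x \in neighbors y).
Proof.
by apply/idP/idP => /neighbors_ord[u [v [-> -> uv]]]; rewrite mem_neighbors e_sym.
Qed.

Lemma neighbors_uniq x : uniq (neighbors x).
Proof.
case: (ltnP x n) => [Hx|/neighbors_out ->] //.
rewrite -[x]/(val (Ordinal Hx)) neighborsE map_inj_uniq; last exact: val_inj.
by have [] := adj_e (Ordinal Hx).
Qed.

Lemma input_repr : repr_graph n neighbors (input adj).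
Proof.
pose L := [seq [seq val v | v <- adj u] | u <- enum 'I_n].
have shapeE : shape [seq adj u | u <- enum 'I_n] = shape L.
  by rewrite /shape /L -!map_comp; apply: eq_map => u /=; rewrite size_map.
have sL : size L = n by rewrite size_map size_enum_ord.
have offE x : x <= n -> arr (input adj) 0 x = sumn (take x (shape L)).
  by rewrite /= shapeE => ->.
have nth_shape x : nth 0 (shape L) x = size (neighbors x).
  case: (ltnP x n) => Hx; first by rewrite (nth_map [::]) // sL.
  by rewrite neighbors_out // nth_default // size_map sL.
split=> x.
  move=> Hx; rewrite !offE //; last exact: ltnW.
  have Hx' : x < size (shape L) by rewrite size_map sL.
  by rewrite (take_nth 0 Hx') -cats1 sumn_cat nth_shape /= addn0.
move=> i Hx Hi; rewrite offE; last exact: ltnW.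
have fE : [seq val v | v <- flatten [seq adj u | u <- enum 'I_n]] = flatten L.
  by rewrite map_flatten /L -map_comp.
rewrite -[LHS]/(nth 0 [seq val v | v <- flatten [seq adj u | u <- enum 'I_n]] _) fE.
have Hi' : i < nth 0 (shape L) x by rewrite nth_shape.
by rewrite nth_flatten -/(flatten_index (shape L) x i) flatten_indexKl // flatten_indexKr.
Qed.

(** The ordered pairs of adjacent vertices split into increasing and decreasing ones, equally many
    by symmetry, and the increasing ones inject into the edges. *)
Lemma sum_degrees : \sum_(0 <= x < n) size (neighbors x) <= 2 * #|edges e|.
Proof.
have -> : \sum_(0 <= x < n) size (neighbors x) = #|[set p : 'I_n * 'I_n | e p.1 p.2]|.
  rewrite big_mkord (eq_bigr (fun u : 'I_n => #|[set v | e u v]|)).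
    rewrite -sum1_card (eq_bigr (fun u : 'I_n => \sum_(v | e u v) 1)).
      by rewrite pair_big_dep; apply: eq_bigl => p; rewrite inE.
    by move=> u _; rewrite -sum1_card; apply: eq_bigl => v; rewrite inE.
  move=> u _; rewrite neighborsE size_map; have [uu mu] := adj_e u.
  by rewrite -(card_uniqP uu); apply: eq_card => v; rewrite inE mu.
pose A := [set p : 'I_n * 'I_n | e p.1 p.2 && (p.1 < p.2)].
pose B := [set p : 'I_n * 'I_n | e p.1 p.2 && (p.2 < p.1)].
have AB : #|B| = #|A|.
  have swapI : injective (fun p : 'I_n * 'I_n => (p.2, p.1)) by move=> [a b] [c d] [-> ->].
  rewrite -(card_imset _ swapI); apply: eq_card => -[a b]; rewrite [in RHS]inE /=.
  apply/imsetP/andP => [[[c d]]|[ab Hlt]].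
    by rewrite inE /= => /andP[cd Hlt] [-> ->]; rewrite e_sym.
  by exists (b, a); rewrite // inE /= e_sym ab.
have -> : #|[set p : 'I_n * 'I_n | e p.1 p.2]| = #|A| + #|B|.
  rewrite -cardsUI [X in _ = _ + X]eq_card0 ?addn0; last first.
    by move=> [a b]; rewrite !inE /=; case: ltngtP; rewrite ?andbF.
  apply: eq_card => -[a b]; rewrite !inE /= -andb_orr.
  case: ltngtP => [||E]; rewrite ?andbT ?andbF //.
  by rewrite (val_inj E) e_irr.
rewrite AB addnn -mul2n leq_mul2l /=.
pose f (p : 'I_n * 'I_n) := [set p.1; p.2].
have fI : {in A &, injective f}.
  move=> [a b] [c d]; rewrite !inE /= => /andP[_ ab] /andP[_ cd] E.
  have Ha : a \in f (c, d) by rewrite -E !inE eqxx.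
  have Hb : b \in f (c, d) by rewrite -E !inE eqxx orbT.
  move: Ha Hb; rewrite !inE /= => /orP[]/eqP Ea /orP[]/eqP Eb; rewrite Ea Eb // in ab *;
    by move: ab cd; clear; lia.
rewrite -(card_in_imset fI); apply: subset_leq_card; apply/subsetP => X.
case/imsetP=> -[a b]; rewrite inE /= => /andP[ab _] ->.
by apply/imset2P; exists a b => //; rewrite !inE ab.
Qed.

End Input.

(** * From the excluded path to the parameter [h] and the constants *)

(** The first [t] vertices of a longer induced path would be an induced copy of the excluded
    path. *)
Lemma ipath_short t n (e : rel 'I_n) adj p h :
  symmetric e -> irreflexive e -> adjacency_lists e adj ->
  path_free t e -> 2 < h -> t <= h.*2.+1 -> ipath (edge (neighbors adj)) p ->
  size p <= h.*2.
Proof.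
move=> e_sym e_irr adj_e Pf h_gt2 th Hp; rewrite leqNgt; apply/negP => Hsz; apply: Pf.
have irr x : edge (neighbors adj) x x = false.
  apply/negP => /(neighbors_ord adj_e)[u [v [-> /val_inj <-]]].
  by rewrite e_irr.
have nthE i j := @ipath_nth _ (edge (neighbors adj)) (edge_sym (neighbors_sym e_sym adj_e)) irr 0 p i j Hp.
(* [p] is a list of natural numbers; its members are vertices because each of them lies on an edge
   of the path. *)
have lt i : i < size p -> nth 0 p i < n.
  move=> Hi; case: i Hi => [|i] Hi.
    have H1 : 1 < size p by move: Hsz h_gt2; clear; lia.
    have [E _] := nthE 0 1 Hi H1.
    have : edge (neighbors adj) (nth 0 p 0) (nth 0 p 1) by rewrite E.
    by case/(neighbors_lt adj_e)/andP.
  have [E _] := nthE i.+1 i Hi (ltnW Hi).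
  have : edge (neighbors adj) (nth 0 p i.+1) (nth 0 p i) by rewrite E eqxx orbT.
  by case/(neighbors_lt adj_e)/andP.
have ltt (i : 'I_t) : i < size p by apply: leq_trans (ltn_ord i) (leq_trans th Hsz).
exists (fun i : 'I_t => Ordinal (lt i (ltt i))); split=> [i j [] E|i j].
  by have [_] := nthE i j (ltt i) (ltt j); rewrite E eqxx => /esym/eqP/val_inj.
have [E _] := nthE i j (ltt i) (ltt j).
by rewrite -(mem_neighbors adj_e) -[LHS]/(edge (neighbors adj) (nth 0 p i) (nth 0 p j)) E.
Qed.

Lemma input_ready n (e : rel 'I_n) adj h : symmetric e -> adjacency_lists e adj ->
  ready n (neighbors adj) h (input adj).
Proof.
move=> e_sym adj_e; split=> //.
- exact: input_repr.
- by case.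
- by left.
Qed.

(** The value 3 is the least for which there is a level at all; it is the source of the 5 and the 4
    in the color bounds. *)
Definition half_length (t : nat) : nat := maxn 3 (uphalf t.-1).

Lemma half_length_bound t : t <= (half_length t).*2.+1.
Proof. by rewrite /half_length /maxn; case: ifP; case: t => // t; lia. Qed.

Definition cost_factor : nat := 4000 * 3 ^ 8 + 4000 * 18 + 1000.

(** Since [h] is at most 3 + (t-2), the number 3^(h+5) of guesses is at most 3^8 * 3^(t-2), and
    (h+3)h is quadratic in [t]. With truncated subtraction this covers t < 2 as well. *)
Lemma component_cost_bound t :
  component_cost (half_length t) <= cost_factor * (3 ^ (t - 2) + t ^ 2).
Proof.
have Hh : half_length t <= 3 + (t - 2) by rewrite /half_length; lia.
have Hh' : half_length t <= 3 + t by apply: leq_trans Hh _; rewrite leq_add2l leq_subr.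
move: (half_length t) Hh Hh' => h Hh Hh'; rewrite /component_cost /cost_factor.
have H1 : 3 ^ h.+3.+2 <= 3 ^ 8 * 3 ^ (t - 2).
  by rewrite -expnD leq_exp2l //; move: Hh; clear; lia.
have H2 : h.+3 * h <= 18 * (1 + t ^ 2).
  apply: leq_trans (leq_mul (_ : h.+3 <= 6 + t) Hh') _; first by move: Hh'; clear; lia.
  by rewrite expnS expn1; clear; case: t => // t; nia.
have H3 : 0 < 3 ^ (t - 2) by rewrite expn_gt0.
move: (3 ^ 8) H1 => P H1.
have H4 A B : A * 3 ^ h.+3.+2 + A * h.+3 * h + B <=
    (A * P + A * 18 + B) * (3 ^ (t - 2) + t ^ 2).
  rewrite 2!mulnDl -!mulnA -!addnA leq_add //.
    by rewrite leq_mul2l (leq_trans H1) ?orbT // leq_mul2l leq_addr orbT.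
  rewrite leq_add //.
    by rewrite leq_mul2l (leq_trans H2) ?orbT // leq_mul2l leq_add2r H3 orbT.
  by rewrite -{1}[B]muln1 leq_mul2l ltn_addr ?orbT.
exact: H4.
Qed.
(* For every natural number t, uphalf t.-1 is the ceiling of (t - 1) / 2.  The
   constant C is absolute: it depends neither on t nor on the graph.  The last
   summand 1 of the time bound matters only for the graph without vertices. *)
Theorem theorem6 :
  exists C : nat, forall t : nat, exists prog : cmd,
    forall (n : nat) (e : rel 'I_n) (adj : 'I_n -> seq 'I_n),
      symmetric e -> irreflexive e -> adjacency_lists e adj ->
      colorable 3 e -> path_free t e ->
      exists (k : nat) (s : state),
        [/\ exec prog (input adj) k s,
            k <= C * ((3 ^ (t - 2) + t ^ 2) * #|edges e| + n + 1)
          & (output_kind s = 0 /\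
             proper_coloring (maxn 5 (2 * uphalf t.-1 - 2)) e
               (@output_coloring n s) /\
             output_triangle e s)
            \/
            (output_kind s = 1 /\
             proper_coloring (maxn 4 (uphalf t.-1 + 1)) e
               (@output_coloring n s))].
Proof.
exists (4 * cost_factor + 100) => t.
exists (main (half_length t)) => n e adj e_sym e_irr adj_e [c [c_range c_proper]] Pf.
pose nb := neighbors adj.
(* Outside the graph the value 1 is a dummy that only keeps the range. *)
pose c3 x := if insub x is Some u then c u else 1.
have c3E (u : 'I_n) : c3 u = c u by rewrite /c3 valK.
have c3_range x : 0 < c3 x <= 3 by rewrite /c3; case: insub => // u; apply: c_range.
have c3_proper x y : edge nb x y -> c3 x != c3 y.
  by case/(neighbors_ord adj_e)=> u [v [-> -> /c_proper]]; rewrite !c3E => /eqP.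
have h_gt2 : 2 < half_length t by rewrite leq_max.
have short p := @ipath_short t n e adj p _ e_sym e_irr adj_e Pf h_gt2 (half_length_bound t).
have [k [s [E [Hk [K [Hrange Hproper Hout]]]]]] := main_ok (neighbors_lt adj_e)
  (neighbors_sym e_sym adj_e) (neighbors_uniq adj_e) c3_range c3_proper h_gt2 short
  (input_ready (half_length t) e_sym adj_e) (erefl n) (erefl 0).
have proper K' : K <= K' -> proper_coloring K' e (@output_coloring n s).
  move=> HK; split=> [v|u v uv].
    by have /andP[-> /leq_trans] := Hrange v (ltn_ord v); apply.
  by apply/eqP/Hproper; rewrite /edge (mem_neighbors adj_e).
exists k, s; split=> //.
  apply: leq_trans Hk _; have := sum_degrees e_sym e_irr adj_e.
  have := component_cost_bound t.
  move: (component_cost _) (\sum_(_ <= _ < _) _) (3 ^ _ + _) cost_factor #|edges e|.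
  move=> D d T A m HD Hd.
  (* The cost factor of a component times the degree sum, which is at most twice the number of
     edges. *)
  have : 2 * D * d <= 4 * A * (T * m).
    have -> : 4 * A * (T * m) = 2 * (A * T) * (2 * m) by lia.
    by rewrite leq_mul // leq_mul2l.
  by move: (2 * D * d) (T * m) => x y; rewrite mulnDl !mulnDr; lia.
case: Hout => [[E0 EK [T1 T2 T3]]|[E1 EK]]; [left|right].
  split=> //; split.
    by apply: proper; rewrite EK /many_colors /half_length; case: ifP; lia.
  have [x [y [Ex Ey xy]]] := neighbors_ord adj_e T1.
  have [y' [z [Ey' Ez yz]]] := neighbors_ord adj_e T2.
  have Eyy : y' = y by apply: val_inj; rewrite /= -Ey' -Ey.
  rewrite Eyy in yz; exists x, y, z; split=> //; split=> //.
  by move: T3; rewrite Ex Ez /edge (mem_neighbors adj_e).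
by split=> //; apply: proper; rewrite EK /half_length; lia.
Qed.
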